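(* Let $\varphi\in C_c^\infty(\mathbb{R})$ be an arbitrary function that is not identically vanishing. Take periodic Fourier eigenmeasures $(\sigma_n)_{n\in\mathbb{N}}$ with eigenvalue $\lambda\in\{\pm1,\pm i\}$ and rational numbers $(y_n)_{n\in\mathbb{N}}$ as described in the context. Then one can choose a real number $y$, a decreasing sequence $(t_n)_{n\in\mathbb{N}}$ of positive numbers converging to zero and an increasing sequence $(a_n)_{n\in\mathbb{N}}$ of positive numbers diverging to $\infty$ such that $$\sigma:=\sum_{k=1}^\infty a_k(\tau_{t_k}\sigma_k-\sigma_k)\qquad\text{and}\qquad \Sigma:=\lambda\sum_{k=1}^\infty a_k\bigl(e^{2\pi i x\cdot t_k}-1\bigr)\sigma_k$$ are crystalline measures with $\widehat\sigma=\Sigma$, which satisfy $$\sum_{n=1}^\infty\bigl|\sigma(\{y_n-t_n\})\,\widehat\varphi(y_n-t_n-y)\bigr|^2=\infty.$$ Moreover, they satisfy, for all $n\in\mathbb{N}$, $$\Sigma(\{y_n-t_n\})=\sigma(\{-y_n+t_n\})=\Sigma(\{-y_n+t_n\})=0.$$ As a consequence, $\eta:=\sigma+\mathcal{F}(\sigma)+\mathcal{F}^2(\sigma)+\mathcal{F}^3(\sigma)$ is a crystalline Fourier eigenmeasure satisfying $\widehat\eta=\lambda\eta$, and with $\psi(x)=e^{2\pi i x\cdot y}\varphi(x)$ the function $\eta*\psi$ is not Bohr almost periodic. Thus, $\eta$ fails to be strongly almost periodic or translation bounded as a distribution, and $\eta$ fails to be a strongly tempered measure.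
   Context: A measure is a complex Radon measure. A measure $\mu$ is tempered if it agrees on $C_c^\infty$ with a tempered distribution, with which it is identified; it is strongly tempered if also its total variation measure $|\mu|$ is a tempered measure. $\widehat{\cdot}=\mathcal{F}(\cdot)$ is the Fourier transform of tempered distributions, with $\widehat f(k)=\int e^{-2\pi i k x}f(x)\,dx$. A crystalline measure is a tempered measure $\mu$ such that both $\mu$ and $\widehat\mu$ are pure-point measures with locally finite support. The translate $\tau_t\mu$ is here given by $(\tau_t\mu)(\{x\})=\mu(\{x+t\})$, i.e. $\tau_t\delta_x=\delta_{x-t}$. For a distribution $Y$, $(Y*\psi)(s)=\langle Y,\psi(s-\cdot)\rangle$. A distribution $Y$ is translation bounded (resp. strongly almost periodic) as a distribution if $Y*\psi$ is bounded (resp. Bohr almost periodic) for all $\psi\in C_c^\infty(\mathbb{R})$. Periodic eigenmeasures: fix $\lambda\in\{\pm1,\pm i\}$. For every integer $m\ge4$ let $\mu_m$ be a non-zero measure on $\mathbb{R}$ such that: (i) $\mathrm{supp}(\mu_m)\subset\frac1m\mathbb{Z}$; (ii) $\mu_m$ is $m\mathbb{Z}$-periodic; (iii) $\widehat{\mu_m}=\lambda\mu_m$; (iv) $|\mu_m|\bigl((-\frac m4+1,\frac m4-1)\bigr)=0$; (v) $|\mu_m|(\{x\})\le1$ for all $x\in\mathrm{supp}(\mu_m)$, and $\mu_m(\{x\})=1$ for some $x\in\mathbb{R}$. (Such measures exist.) The sequence $(\sigma_n)_{n\in\mathbb{N}}$ is given by $\sigma_n=\mu_{k_n}$, where $(k_n)_{n\in\mathbb{N}}$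 are positive integers with $k_1\ge4$ and $\frac{k_{n+1}}4-1\ge\frac{k_n}2+1$ for all $n$ (for example $k_n=4^n$). The rational numbers $y_1,y_2,\dots$ are distinct and such that for every $n$: $\sigma_n(\{y_n\})=1$, and $\sigma_m(\{y_n+z\})=0$ for all $m>n$ and all $z\in[-1,1)$. (Such numbers exist.)
   Formalization: Since F^4=id, η=σ+F(σ)+F²(σ)+F³(σ) is nonzero with η̂=η, so η̂=λη fails for λ≠1; all conclusions on η are proved both for this η with eigenvalue 1 and for the weighted sum σ+λ^{-1}F(σ)+λ^{-2}F²(σ)+λ^{-3}F³(σ) with eigenvalue λ. *)

(* Defs.v *)
From Stdlib Require Export Reals Lra List.
From Coquelicot Require Export Coquelicot.

Set Implicit Arguments.
Unset Strict Implicit.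

Open Scope R_scope.

(** * Test functions on the line *)

Definition compactly_supported (f : R -> C) : Prop :=
  exists A : R, forall x : R, A < Rabs x -> f x = RtoC 0.

(* C_c(R) *)
Definition Cc (f : R -> C) : Prop :=
  (forall x : R, continuous f x) /\ compactly_supported f.

Definition smooth (f : R -> C) : Prop :=
  forall (n : nat) (x : R),
    ex_derive_n (fun u => Re (f u)) n x /\ ex_derive_n (fun u => Im (f u)) n x.

Definition CDerive_n (f : R -> C) (n : nat) (x : R) : C :=
  (Derive_n (fun u => Re (f u)) n x, Derive_n (fun u => Im (f u)) n x).

(* C_c^infty(R) *)
Definition Cc_infty (f : R -> C) : Prop := smooth f /\ compactly_supported f.

Definition schwartz_bound (N : nat) (B : R) (f : R -> C) : Prop :=
  forall (i j : nat) (x : R), (i <= N)%nat -> (j <= N)%nat ->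
    Rabs x ^ i * Cmod (CDerive_n f j x) <= B.

(* the Schwartz space S(R) *)
Definition schwartz (f : R -> C) : Prop :=
  smooth f /\ forall N : nat, exists B : R, schwartz_bound N B f.

(* e^{i u} *)
Definition cis (u : R) : C := (cos u, sin u).

Definition fourier (f : R -> C) (k : R) : C :=
  RInt_gen (V := C_R_CompleteNormedModule)
    (fun x : R => (cis (- (2 * PI * k * x)) * f x)%C)
    (Rbar_locally m_infty) (Rbar_locally p_infty).

(** * Measures and distributions

    Both are represented by functionals on the set of all functions R -> C.
    Only the values on the relevant test space (C_c, C_c^infty or S) are
    meaningful, and equality is always stated relative to such a space. *)

Definition functional : Type := (R -> C) -> C.

Definition agree_on (D : (R -> C) -> Prop) (S T : functional) : Prop :=
  forall f : R -> C, D f -> S f = T f.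

Definition linear_on (D : (R -> C) -> Prop) (T : functional) : Prop :=
  forall (c d : C) (f g : R -> C), D f -> D g ->
    T (fun x => (c * f x + d * g x)%C) = (c * T f + d * T g)%C.

(* Complex Radon measures: linear functionals on C_c(R), bounded for the
   supremum norm on the functions supported in any fixed compact set. *)
Definition is_measure (mu : functional) : Prop :=
  linear_on Cc mu /\
  forall A : R, exists M : R, forall (f : R -> C) (B : R),
    Cc f -> (forall x : R, A < Rabs x -> f x = RtoC 0) ->
    (forall x : R, Cmod (f x) <= B) -> Cmod (mu f) <= M * B.

Definition zero_measure : functional := fun _ => RtoC 0.

Definition mscal (c : C) (mu : functional) : functional := fun f => (c * mu f)%C.

Definition msub (mu nu : functional) : functional := fun f => (mu f - nu f)%C.

(* the measure with density g with respect to mu *)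
Definition mdens (g : R -> C) (mu : functional) : functional :=
  fun f => mu (fun x => (g x * f x)%C).

(* tau_t delta_x = delta_{x-t}, i.e. (tau_t mu)({x}) = mu({x+t}) *)
Definition mtranslate (t : R) (mu : functional) : functional :=
  fun f => mu (fun x => f (x - t)).

(* mu is the sum of the nu_k in the vague topology *)
Definition is_msum (nu : nat -> functional) (mu : functional) : Prop :=
  forall f : R -> C, Cc f ->
    is_series (V := C_R_NormedModule) (fun k => nu k f) (mu f).

(* |mu|(h) = sup { |mu(g)| : g in C_c, |g| <= h } for h >= 0 in C_c,
   extended to complex-valued functions by linearity. *)
Definition tv_pos (mu : functional) (h : R -> R) : R :=
  real (Lub_Rbar (fun r => exists g : R -> C,
    Cc g /\ (forall x : R, Cmod (g x) <= h x) /\ r = Cmod (mu g))).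

Definition total_variation (mu : functional) : functional := fun f =>
  (tv_pos mu (fun x => Rmax (Re (f x)) 0) - tv_pos mu (fun x => Rmax (- Re (f x)) 0),
   tv_pos mu (fun x => Rmax (Im (f x)) 0) - tv_pos mu (fun x => Rmax (- Im (f x)) 0)).

(* nu(U) = sup { nu(h) : h in C_c, 0 <= h <= 1_U } for a positive measure nu and
   an open set U *)
Definition open_mass (nu : functional) (U : R -> Prop) : Rbar :=
  Lub_Rbar (fun r => exists h : R -> R,
    Cc (fun x => RtoC (h x)) /\ (forall x : R, 0 <= h x <= 1) /\
    (forall x : R, ~ U x -> h x = 0) /\ r = Re (nu (fun x => RtoC (h x)))).

(* mu({x}), as the limit of mu(f_n) along the tent functions
   f_n = max(0, 1 - (n+1)|. - x|), which decrease to the indicator of {x} *)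
Definition tent (x : R) (n : nat) (u : R) : C :=
  RtoC (Rmax 0 (1 - INR (S n) * Rabs (u - x))).

Definition mass (mu : functional) (x : R) : C :=
  (real (Lim_seq (fun n => Re (mu (tent x n)))),
   real (Lim_seq (fun n => Im (mu (tent x n))))).

Definition msupport (mu : functional) (x : R) : Prop :=
  forall eps : R, 0 < eps -> exists g : R -> C,
    Cc g /\ (forall u : R, eps <= Rabs (u - x) -> g u = RtoC 0) /\ mu g <> RtoC 0.

Definition locally_finite (P : R -> Prop) : Prop :=
  forall A : R, exists l : list R, forall x : R, P x -> Rabs x <= A -> In x l.

(* countable sums of weighted point masses *)
Definition pure_point (mu : functional) : Prop :=
  exists (x : nat -> R) (c : nat -> C), forall f : R -> C, Cc f ->
    ex_series (fun j => Cmod (c j * f (x j))%C) /\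
    is_series (V := C_R_NormedModule) (fun j => (c j * f (x j))%C) (mu f).

(** * Tempered distributions *)

Definition tempered_distribution (T : functional) : Prop :=
  linear_on schwartz T /\
  exists (N : nat) (M : R), forall (f : R -> C) (B : R),
    schwartz f -> schwartz_bound N B f -> Cmod (T f) <= M * B.

Definition FT (T : functional) : functional := fun f => T (fourier f).

(* the tempered distribution T is identified with the measure mu *)
Definition represents (T mu : functional) : Prop :=
  tempered_distribution T /\ agree_on Cc_infty T mu.

Definition tempered (mu : functional) : Prop :=
  exists T : functional, represents T mu.

Definition strongly_tempered (mu : functional) : Prop :=
  tempered mu /\ tempered (total_variation mu).

(* the Fourier transform of the tempered measure mu is the measure nu *)
Definition has_fourier (mu nu : functional) : Prop :=
  exists T : functional, represents T mu /\ represents (FT T) nu.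

Definition crystalline (mu : functional) : Prop :=
  is_measure mu /\ tempered mu /\
  pure_point mu /\ locally_finite (msupport mu) /\
  exists nu : functional, is_measure nu /\ has_fourier mu nu /\
    pure_point nu /\ locally_finite (msupport nu).

(* (Y * psi)(s) = < Y , psi(s - .) > *)
Definition conv (Y : functional) (psi : R -> C) (s : R) : C :=
  Y (fun x => psi (s - x)).

Definition bounded (f : R -> C) : Prop :=
  exists M : R, forall x : R, Cmod (f x) <= M.

Definition bohr_almost_periodic (f : R -> C) : Prop :=
  (forall x : R, continuous f x) /\
  forall eps : R, 0 < eps -> exists L : R, 0 < L /\
    forall a : R, exists tau : R, a <= tau <= a + L /\
      forall x : R, Cmod (Cminus (f (x + tau)) (f x)) <= eps.

Definition translation_bounded_distribution (Y : functional) : Prop :=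
  forall psi : R -> C, Cc_infty psi -> bounded (conv Y psi).

Definition strongly_almost_periodic_distribution (Y : functional) : Prop :=
  forall psi : R -> C, Cc_infty psi -> bohr_almost_periodic (conv Y psi).

(** * The periodic eigenmeasures *)

Definition is_periodic_eigenmeasure (lambda : C) (m : nat) (mu : functional) : Prop :=
  is_measure mu /\ ~ agree_on Cc mu zero_measure /\
  (forall x : R, msupport mu x -> exists z : Z, x = IZR z / INR m) /\
  (forall z : Z, agree_on Cc (mtranslate (IZR z * INR m) mu) mu) /\
  has_fourier mu (mscal lambda mu) /\
  open_mass (total_variation mu)
    (fun x => - (INR m / 4) + 1 < x < INR m / 4 - 1) = Finite 0 /\
  (forall x : R, msupport mu x -> Re (mass (total_variation mu) x) <= 1) /\
  (exists x : R, mass mu x = RtoC 1).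

Definition rational (x : R) : Prop :=
  exists p q : Z, q <> 0%Z /\ x = IZR p / IZR q.

(* Main.v *)
From Stdlib Require Import FunctionalExtensionality ClassicalEpsilon Lia Znat Permutation Cantor Wf_nat.
Require Import Defs.

(** A periodic eigenmeasure is a weighted lattice comb [S_n] that vanishes near the origin.
    With [W(a,b) f (x) = e^{2 pi i b x} f(x - a)] one has [W(a,b) F = F W(-b,a)] when [a b = 0],
    so the Fourier transform permutes, up to the factor [lambda], the four functionals
    [f |-> S_n (W f - f)], [W = W(t,0), W(0,t), W(-t,0), W(0,-t)].  Hence every series of such
    differences with coefficients [a_n] is tempered as soon as [a_n t_n] is small, its transform
    is a series of the same kind, and all these measures are crystalline; in particular
    [F^4 = id] on them without any inversion theorem.

    The [t_n] are rational multiples of [sqrt 2], so irrationality separates the shifted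
    lattices and [eta] has mass exactly [a_n] at [y_n - t_n].  The zeros of the Fourier transform
    of [phi] are nowhere dense, which gives [y].  By the eigenvalue equation, [eta * psi] is the
    superposition of the waves [e^{-2 pi i s x}] with coefficients [eta({x}) hat(psi)(-x)].  The
    supremum of a trigonometric series dominates each of its coefficients, so [a_n] can be taken
    large enough for the [n]-th block to exceed [n] plus all earlier blocks at some [s_n]; the
    later [t_m] are chosen so small that they do not matter at [s_n].  Thus [eta * psi] is
    unbounded.  If moreover [a_n] beats every power of [y_n], the total variation of [eta] cannot
    be tempered. *)

(** The obstacle is a circularity: the argument [s_n] at which the [n]-th block is large depends on
    [t_n], while [t_n] must already be small. Two estimates of a block resolve it. One gains the
    factor [t] at the price of derivatives of the argument, hence of powers of [s]; the other
    contains neither [t] nor [s], because a wave has modulus 1. The second allows all [a_n] to be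
    fixed before any [t_n]; the first governs the later [t_m] once [s_n] is known. The given
    eigenmeasures are specified only on compactly supported functions, and their eigenvalue equation
    only against test functions, whose transforms have unbounded support. Each is therefore replaced
    by its explicit lattice sum, absolutely convergent on quadratically decaying functions, and the
    equation is carried to all Schwartz functions by density. The eigenvalues 1 and [lambda] are
    treated together: weighting the four shifts by the unimodular numbers [(lambda / kappa) ^ i]
    gives an eigenvector for [kappa] with mass [a_n] at [y_n - t_n] in either case. *)

(** * Moduli and components of complex numbers *)

Lemma C_ext (z w : C) : Re z = Re w -> Im z = Im w -> z = w.
Proof. destruct z, w; unfold Re, Im; simpl; intros -> ->; reflexivity. Qed.

Lemma Rabs_Re_le (z : C) : Rabs (Re z) <= Cmod z.
Proof.
  apply Rle_trans with (2 := Rmax_Cmod z). apply Rmax_l.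
Qed.

Lemma Rabs_Im_le (z : C) : Rabs (Im z) <= Cmod z.
Proof.
  apply Rle_trans with (2 := Rmax_Cmod z). apply Rmax_r.
Qed.

Lemma Cmod_le_Re_Im (z : C) : Cmod z <= Rabs (Re z) + Rabs (Im z).
Proof.
  destruct z as [a b]; unfold Cmod, Re, Im; simpl.
  apply Rsqr_incr_0_var.
  2: { pose proof (Rabs_pos a); pose proof (Rabs_pos b); lra. }
  rewrite Rsqr_sqrt by nra.
  unfold Rsqr. pose proof (Rabs_pos a); pose proof (Rabs_pos b).
  pose proof (Rsqr_abs a); pose proof (Rsqr_abs b); unfold Rsqr in *. nra.
Qed.

Lemma Cmod_zero (z : C) : Cmod z <= 0 -> z = 0.
Proof.
  intros H. apply Cmod_eq_0. apply Rle_antisym; [exact H | apply Cmod_ge_0].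
Qed.

Lemma Cmod_RtoC (r : R) : Cmod (RtoC r) = Rabs r.
Proof. apply Cmod_R. Qed.

(** * Finite sums and absolutely convergent series of complex numbers *)

Definition lsum {A : Type} (f : A -> C) (l : list A) : C :=
  fold_right (fun x s => (f x + s)%C) (RtoC 0) l.

Lemma lsum_app {A} (f : A -> C) l l' : lsum f (l ++ l') = (lsum f l + lsum f l')%C.
Proof.
  induction l as [|x l IH]; simpl; [ring | rewrite IH; ring].
Qed.

Lemma lsum_ext {A} (f g : A -> C) l : (forall x, In x l -> f x = g x) -> lsum f l = lsum g l.
Proof.
  induction l as [|x l IH]; simpl; intros H; [reflexivity|].
  rewrite H, IH; auto.
Qed.

Lemma lsum_zero {A} (f : A -> C) l : (forall x, In x l -> f x = 0) -> lsum f l = 0.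
Proof.
  induction l as [|x l IH]; simpl; intros H; [reflexivity|].
  rewrite H, IH; auto. ring.
Qed.

Lemma lsum_plus {A} (f g : A -> C) l :
  lsum (fun x => (f x + g x)%C) l = (lsum f l + lsum g l)%C.
Proof.
  induction l as [|x l IH]; simpl; [ring | rewrite IH; ring].
Qed.

Lemma lsum_scal {A} (c : C) (f : A -> C) l :
  lsum (fun x => (c * f x)%C) l = (c * lsum f l)%C.
Proof.
  induction l as [|x l IH]; simpl; [ring | rewrite IH; ring].
Qed.

Lemma lsum_map {A B} (h : B -> A) (f : A -> C) l : lsum f (map h l) = lsum (fun x => f (h x)) l.
Proof.
  induction l as [|x l IH]; simpl; [reflexivity | rewrite IH; reflexivity].
Qed.

Lemma lsum_swap {A B} (f : A -> B -> C) l l' :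
  lsum (fun x => lsum (f x) l') l = lsum (fun y => lsum (fun x => f x y) l) l'.
Proof.
  induction l as [|x l IH]; simpl.
  - symmetry; apply lsum_zero; reflexivity.
  - rewrite IH, <- lsum_plus. reflexivity.
Qed.

Lemma lsum_perm {A} (f : A -> C) l l' : Permutation l l' -> lsum f l = lsum f l'.
Proof.
  induction 1; simpl; try congruence. ring.
Qed.

Lemma lsum_bound {A} (f : A -> C) (b : A -> R) l :
  (forall x, In x l -> Cmod (f x) <= b x) ->
  Cmod (lsum f l) <= fold_right (fun x s => b x + s) 0 l.
Proof.
  induction l as [|x l IH]; simpl; intros H.
  - rewrite Cmod_0; lra.
  - eapply Rle_trans; [apply Cmod_triangle|].
    apply Rplus_le_compat; auto.
Qed.

(** Equality with 0 is decided classically, so that vanishing terms can be removed by [filter]. *)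
Definition Cnonzero (z : C) : bool := if excluded_middle_informative (z = 0) then false else true.

Lemma Cnonzero_spec z : Cnonzero z = true <-> z <> 0.
Proof. unfold Cnonzero. destruct excluded_middle_informative; intuition congruence. Qed.

Lemma lsum_filter {A} (f : A -> C) l : lsum f (filter (fun x => Cnonzero (f x)) l) = lsum f l.
Proof.
  induction l as [|x l IH]; simpl; [reflexivity|].
  destruct (Cnonzero (f x)) eqn:E; simpl; rewrite IH; [reflexivity|].
  assert (f x = 0) as ->; [|ring].
  apply NNPP. intros H. apply Cnonzero_spec in H. congruence.
Qed.

(** Stripped of their zero terms, both lists enumerate the support of [f] without repetition, so
    they are permutations of each other. This makes the value of a discrete measure independent of
    the covering list. *)
Lemma lsum_support {A} (f : A -> C) l l' :
  NoDup l -> NoDup l' ->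
  (forall x, f x <> 0 -> In x l) -> (forall x, f x <> 0 -> In x l') ->
  lsum f l = lsum f l'.
Proof.
  intros N N' H H'.
  rewrite <- (lsum_filter f l), <- (lsum_filter f l').
  apply lsum_perm, NoDup_Permutation; try (apply NoDup_filter; assumption).
  intros x. rewrite !filter_In, !Cnonzero_spec. intuition.
Qed.

Lemma lsum_single {A} (f : A -> C) l a :
  NoDup l -> In a l -> (forall x, In x l -> x <> a -> f x = 0) -> lsum f l = f a.
Proof.
  induction l as [|x l IH]; simpl; intros N I H; [tauto|].
  inversion_clear N as [|? ? Nx Nl].
  destruct I as [->|I].
  - rewrite lsum_zero; [ring|]. intros y Hy. apply H; auto. congruence.
  - rewrite (H x); [|auto|congruence]. rewrite IH; auto. ring.
Qed.

(** Real and imaginary parts are summed separately, so that the theory of real series applies; the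
    value carries meaning only for convergent series. *)
Definition CSeries (u : nat -> C) : C :=
  (Series (fun n => Re (u n)), Series (fun n => Im (u n))).

Definition Csummable (u : nat -> C) : Prop := ex_series (fun n => Cmod (u n)).

Lemma Csummable_le (u : nat -> C) (b : nat -> R) :
  (forall n, Cmod (u n) <= b n) -> ex_series b -> Csummable u.
Proof.
  intros H. apply (ex_series_le (V := R_CompleteNormedModule)).
  intros n. unfold norm; simpl; unfold abs; simpl.
  rewrite Rabs_right; auto. apply Rle_ge, Cmod_ge_0.
Qed.

Lemma Csummable_Re u : Csummable u -> ex_series (fun n => Re (u n)).
Proof.
  apply (ex_series_le (V := R_CompleteNormedModule)).
  intros n. apply Rabs_Re_le.
Qed.

Lemma Csummable_Im u : Csummable u -> ex_series (fun n => Im (u n)).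
Proof.
  apply (ex_series_le (V := R_CompleteNormedModule)).
  intros n. apply Rabs_Im_le.
Qed.

Lemma sum_n_C (u : nat -> C) n :
  sum_n (G := C_R_NormedModule) u n = (sum_n (fun k => Re (u k)) n, sum_n (fun k => Im (u k)) n).
Proof.
  induction n as [|n IH].
  - rewrite !sum_O. destruct (u 0%nat); reflexivity.
  - rewrite !sum_Sn, IH. reflexivity.
Qed.

Lemma is_series_C (u : nat -> C) (l : C) :
  is_series (fun n => Re (u n)) (Re l) -> is_series (fun n => Im (u n)) (Im l) ->
  is_series (V := C_R_NormedModule) u l.
Proof.
  unfold is_series. intros H1 H2.
  apply filterlim_locally. intros eps.
  apply filter_imp with (2 := filter_and _ _ (proj1 (filterlim_locally _ _) H1 eps)
    (proj1 (filterlim_locally _ _) H2 eps)).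
  intros n [A B]. rewrite sum_n_C. split; assumption.
Qed.

Lemma CSeries_correct u : Csummable u -> is_series (V := C_R_NormedModule) u (CSeries u).
Proof.
  intros H. apply is_series_C; apply Series_correct.
  - apply Csummable_Re, H.
  - apply Csummable_Im, H.
Qed.

Lemma CSeries_ext u v : (forall n, u n = v n) -> CSeries u = CSeries v.
Proof. intros H. replace u with v; [reflexivity|]. apply functional_extensionality; auto. Qed.

Lemma CSeries_plus u v : Csummable u -> Csummable v ->
  CSeries (fun n => (u n + v n)%C) = (CSeries u + CSeries v)%C.
Proof.
  intros Hu Hv. apply C_ext; unfold CSeries; simpl.
  - rewrite <- Series_plus; auto using Csummable_Re.
  - rewrite <- Series_plus; auto using Csummable_Im.
Qed.

Lemma CSeries_scal c u : Csummable u -> CSeries (fun n => (c * u n)%C) = (c * CSeries u)%C.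
Proof.
  intros Hu. destruct c as [a b].
  apply C_ext; unfold CSeries; simpl.
  - rewrite <- !Series_scal_l, <- Series_minus; auto;
      apply (ex_series_scal (V := R_NormedModule)); auto using Csummable_Re, Csummable_Im.
  - rewrite <- !Series_scal_l, <- Series_plus; auto;
      apply (ex_series_scal (V := R_NormedModule)); auto using Csummable_Re, Csummable_Im.
Qed.

Lemma Csummable_scal c u : Csummable u -> Csummable (fun n => (c * u n)%C).
Proof.
  intros H. unfold Csummable.
  apply ex_series_ext with (fun n => Cmod c * Cmod (u n)).
  - intros n. symmetry. apply Cmod_mult.
  - apply (ex_series_scal (V := R_NormedModule)), H.
Qed.

Lemma Csummable_plus u v : Csummable u -> Csummable v -> Csummable (fun n => (u n + v n)%C).
Proof.
  intros H H'. apply Csummable_le with (fun n => Cmod (u n) + Cmod (v n)).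
  - intros n; apply Cmod_triangle.
  - apply (ex_series_plus (V := R_NormedModule)); assumption.
Qed.

(** Terms may have any sign here, so the series of differences is compared with zero. *)
Lemma Series_le_weak (a b : nat -> R) :
  (forall n, a n <= b n) -> ex_series a -> ex_series b -> Series a <= Series b.
Proof.
  intros H Ha Hb.
  cut (0 <= Series (fun n => b n - a n)).
  { rewrite Series_minus by assumption. lra. }
  replace 0 with (Series (fun n => 0 * (b n - a n))) by (rewrite Series_scal_l; ring).
  apply Series_le.
  - intros n. specialize (H n). lra.
  - apply (ex_series_minus (V := R_NormedModule)); assumption.
Qed.

(** The unimodular factor [w] rotates the sum onto the positive axis; its modulus then is a real
    part, which is estimated term by term. Bounding the two components separately would lose a
    constant. *)
Lemma CSeries_bound u b : (forall n, Cmod (u n) <= b n) -> ex_series b ->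
  Cmod (CSeries u) <= Series b.
Proof.
  intros H Hb.
  assert (Hu : Csummable u) by (eapply Csummable_le; eauto).
  assert (H0 : forall n, 0 <= b n) by (intros n; eapply Rle_trans; [apply Cmod_ge_0 | auto]).
  destruct (Req_dec (Cmod (CSeries u)) 0) as [E|E].
  - rewrite E. replace 0 with (Series (fun n => 0 * b n)) by (rewrite Series_scal_l; ring).
    apply Series_le; auto. intros n; specialize (H0 n); lra.
  - set (z := CSeries u) in *.
    set (w := (Cconj z / RtoC (Cmod z))%C).
    assert (Hw : Cmod w = 1).
    { unfold w. rewrite Cmod_div, Cmod_conj, Cmod_RtoC, Rabs_right.
      - now field.
      - apply Rle_ge, Cmod_ge_0.
      - intros F. apply E. apply RtoC_inj, F. }
    assert (Hz : Re (w * z)%C = Cmod z).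
    { unfold w. destruct z as [a c].
      pose proof (Cmod2_alt (a, c)) as Q. simpl in Q.
      set (m := Cmod (a, c)) in *. unfold Cdiv, Cinv, Cconj, RtoC; simpl.
      replace ((a * (m / (m * (m * 1) + 0 * (0 * 1))) - - c * (- 0 / (m * (m * 1) + 0 * (0 * 1)))) * a -
               (a * (- 0 / (m * (m * 1) + 0 * (0 * 1))) + - c * (m / (m * (m * 1) + 0 * (0 * 1)))) * c)
        with ((a * (a * 1) + c * (c * 1)) / m) by (field; exact E).
      rewrite <- Q. field. exact E. }
    rewrite <- Hz. unfold z. rewrite <- CSeries_scal by assumption.
    clearbody w. change (Series (fun n => Re (w * u n)%C) <= Series b). apply Series_le_weak.
    + intros n. apply Rle_trans with (1 := Rle_abs _).
      eapply Rle_trans; [apply Rabs_Re_le|]. rewrite Cmod_mult, Hw, Rmult_1_l. auto.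
    + apply Csummable_Re with (u := fun n => (w * u n)%C). now apply Csummable_scal.
    + assumption.
Qed.

Lemma sum_n_lsum (u : nat -> C) n :
  sum_n (G := C_R_NormedModule) u n = lsum u (List.seq 0 (S n)).
Proof.
  induction n as [|n IH].
  - rewrite sum_O. simpl. symmetry; apply Cplus_0_r.
  - rewrite sum_Sn, IH, (List.seq_S (S n)), lsum_app.
    change (lsum u (0 + S n :: nil)%nat) with (u (S n) + 0)%C.
    rewrite Cplus_0_r. reflexivity.
Qed.

Lemma is_series_finite (u : nat -> C) N :
  (forall n, (N <= n)%nat -> u n = 0) -> is_series (V := C_R_NormedModule) u (lsum u (List.seq 0 N)).
Proof.
  intros H. unfold is_series.
  apply (filterlim_ext_loc (fun _ => lsum u (List.seq 0 N))).
  2: apply filterlim_const.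
  exists N. intros n Hn. rewrite sum_n_lsum.
  replace (S n) with (N + (S n - N))%nat by lia.
  rewrite List.seq_app, lsum_app.
  rewrite (lsum_zero u (List.seq (0 + N) (S n - N))); [ring|].
  intros x Hx. apply in_seq in Hx. apply H; lia.
Qed.

Lemma Csummable_finite (u : nat -> C) N : (forall n, (N <= n)%nat -> u n = 0) -> Csummable u.
Proof.
  intros H. apply ex_series_incr_n with (n := N).
  apply ex_series_ext with (fun _ => 0).
  - intros n. rewrite H, Cmod_0; [reflexivity|lia].
  - exists 0. apply (filterlim_ext (fun _ => 0)); [|apply filterlim_const].
    intros n. rewrite sum_n_const. ring.
Qed.

Lemma CSeries_unique u l : Csummable u -> is_series (V := C_R_NormedModule) u l -> CSeries u = l.
Proof.
  intros H Hl.
  apply (filterlim_locally_unique (V := C_R_NormedModule) (F := eventually)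
    (sum_n (G := C_R_NormedModule) u)); [apply CSeries_correct, H | exact Hl].
Qed.

Lemma CSeries_finite (u : nat -> C) N :
  (forall n, (N <= n)%nat -> u n = 0) -> CSeries u = lsum u (List.seq 0 N).
Proof.
  intros H. apply CSeries_unique; [eapply Csummable_finite; eauto|].
  apply is_series_finite, H.
Qed.

Lemma CSeries_single (u : nat -> C) j : (forall n, n <> j -> u n = 0) -> CSeries u = u j.
Proof.
  intros H. rewrite (CSeries_finite u (S j)).
  - apply lsum_single; [apply seq_NoDup | apply in_seq; lia | auto].
  - intros n Hn. apply H. lia.
Qed.

(** * Continuity, characters, and functions of compact support *)

Lemma continuous_C (f : R -> C) x :
  continuous f x <-> continuous (fun u => Re (f u)) x /\ continuous (fun u => Im (f u)) x.
Proof.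
  split.
  - intros H; split.
    + apply (continuous_comp f (fun z : C => fst z)); [exact H|].
      destruct (f x); apply continuous_fst.
    + apply (continuous_comp f (fun z : C => snd z)); [exact H|].
      destruct (f x); apply continuous_snd.
  - intros [H1 H2]. apply filterlim_locally. intros eps.
    apply filter_imp with (2 := filter_and _ _ (proj1 (filterlim_locally _ _) H1 eps)
      (proj1 (filterlim_locally _ _) H2 eps)).
    intros n [A B]. split; assumption.
Qed.

Lemma continuous_R_C (f : R -> R) x : continuous f x -> continuous (fun u => RtoC (f u)) x.
Proof.
  intros H. apply continuous_C; split; [exact H | apply continuous_const].
Qed.

Lemma continuous_Cplus (f g : R -> C) x :
  continuous f x -> continuous g x -> continuous (fun u => (f u + g u)%C) x.
Proof.
  rewrite !continuous_C. intros [A B] [A' B']; split.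
  - apply (continuous_plus (V := R_NormedModule) (fun u => Re (f u)) (fun u => Re (g u))); auto.
  - apply (continuous_plus (V := R_NormedModule) (fun u => Im (f u)) (fun u => Im (g u))); auto.
Qed.

Lemma continuous_Cmult (f g : R -> C) x :
  continuous f x -> continuous g x -> continuous (fun u => (f u * g u)%C) x.
Proof.
  rewrite !continuous_C. intros [A B] [A' B']; split.
  - apply (continuous_minus (V := R_NormedModule) (fun u => Re (f u) * Re (g u))
      (fun u => Im (f u) * Im (g u))); apply (continuous_mult (K := R_AbsRing)); auto.
  - apply (continuous_plus (V := R_NormedModule) (fun u => Re (f u) * Im (g u))
      (fun u => Im (f u) * Re (g u))); apply (continuous_mult (K := R_AbsRing)); auto.
Qed.

Lemma continuous_comp_affine (f : R -> C) (a b x : R) :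
  continuous f (a * x + b) -> continuous (fun u => f (a * u + b)) x.
Proof.
  intros H. apply (continuous_comp (fun u : R => a * u + b) f); [|exact H].
  apply (ex_derive_continuous (V := R_NormedModule)). auto_derive; auto.
Qed.

Lemma cis_plus u v : cis (u + v) = (cis u * cis v)%C.
Proof.
  unfold cis. apply C_ext; simpl; [apply cos_plus | rewrite sin_plus; ring].
Qed.

Lemma cis_0 : cis 0 = 1.
Proof. unfold cis. rewrite cos_0, sin_0. reflexivity. Qed.

Lemma Cmod_cis u : Cmod (cis u) = 1.
Proof.
  unfold Cmod, cis; simpl. rewrite <- sqrt_1 at 3. f_equal.
  pose proof (sin2_cos2 u). unfold Rsqr in *. lra.
Qed.

Lemma continuous_cis (a b x : R) : continuous (fun u => cis (a * u + b)) x.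
Proof.
  apply continuous_C; split; unfold cis; simpl;
    apply (ex_derive_continuous (V := R_NormedModule)); auto_derive; auto.
Qed.

Lemma Cc_comb (c d : C) (f g : R -> C) : Cc f -> Cc g -> Cc (fun x => (c * f x + d * g x)%C).
Proof.
  intros [Hf [A HA]] [Hg [B HB]]; split.
  - intros x. apply continuous_Cplus; apply continuous_Cmult; auto; apply continuous_const.
  - exists (Rmax A B). intros x Hx. rewrite HA, HB; [ring| |].
    + eapply Rle_lt_trans; [apply Rmax_r | exact Hx].
    + eapply Rle_lt_trans; [apply Rmax_l | exact Hx].
Qed.

Lemma Cc_mult (g f : R -> C) : (forall x, continuous g x) -> Cc f -> Cc (fun x => (g x * f x)%C).
Proof.
  intros Hg [Hf [A HA]]; split.
  - intros x. apply continuous_Cmult; auto.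
  - exists A. intros x Hx. rewrite HA by assumption. ring.
Qed.

Lemma Cc_translate (f : R -> C) (t : R) : Cc f -> Cc (fun x => f (x - t)).
Proof.
  intros [Hf [A HA]]; split.
  - intros x. replace (fun x => f (x - t)) with (fun x => f (1 * x + - t)).
    + apply continuous_comp_affine, Hf.
    + apply functional_extensionality; intros y; f_equal; ring.
  - exists (A + Rabs t). intros x Hx. apply HA.
    pose proof (Rabs_triang (x - t) t). replace (x - t + t) with x in * by ring. lra.
Qed.

Lemma tent_le_1 x n u : 0 <= Rmax 0 (1 - INR (S n) * Rabs (u - x)) <= 1.
Proof.
  split; [apply Rmax_l|]. apply Rmax_lub; [lra|].
  pose proof (Rabs_pos (u - x)). pose proof (pos_INR (S n)). nra.
Qed.

Lemma tent_center x n : tent x n x = 1.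
Proof.
  unfold tent. replace (x - x) with 0 by ring. rewrite Rabs_R0, Rmult_0_r, Rminus_0_r, Rmax_right; [reflexivity|lra].
Qed.

Lemma tent_far x n u : / INR (S n) <= Rabs (u - x) -> tent x n u = 0.
Proof.
  intros H. unfold tent. rewrite Rmax_left; [reflexivity|].
  pose proof (lt_0_INR (S n) ltac:(lia)).
  apply Rmult_le_compat_l with (r := INR (S n)) in H; [|lra].
  rewrite Rinv_r in H; lra.
Qed.

Lemma continuous_Rmax0 (f : R -> R) x : continuous f x -> continuous (fun u => Rmax 0 (f u)) x.
Proof.
  intros H. apply continuous_ext with (fun u => (f u + Rabs (f u)) / 2).
  - intros u. unfold Rmax. destruct Rle_dec.
    + rewrite Rabs_right; simpl; lra.
    + rewrite Rabs_left; simpl; lra.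
  - apply (continuous_comp f (fun v => (v + Rabs v) / 2)); [exact H|].
    apply (continuous_mult (K := R_AbsRing)); [|apply continuous_const].
    apply (continuous_plus (V := R_NormedModule)); [apply continuous_id | apply continuous_Rabs].
Qed.

Lemma tent_Cc x n : Cc (tent x n).
Proof.
  split.
  - intros u. unfold tent. apply continuous_R_C, continuous_Rmax0.
    apply (continuous_minus (V := R_NormedModule)); [apply continuous_const|].
    apply (continuous_mult (K := R_AbsRing)); [apply continuous_const|].
    apply (continuous_comp (fun u => u - x) Rabs); [|apply continuous_Rabs].
    apply (continuous_minus (V := R_NormedModule)); [apply continuous_id | apply continuous_const].
  - exists (Rabs x + 1). intros u Hu. apply tent_far.
    apply Rle_trans with 1.
    + rewrite <- Rinv_1. apply Rinv_le_contravar; [lra|]. rewrite S_INR. pose proof (pos_INR n); lra.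
    + pose proof (Rabs_triang (u - x) x). replace (u - x + x) with u in * by ring. lra.
Qed.

Lemma inv_INR_S_lt (d : R) : 0 < d -> exists N : nat, forall n, (N <= n)%nat -> / INR (S n) < d.
Proof.
  intros Hd. destruct (archimed_cor1 d Hd) as [N [H1 H2]].
  exists N. intros n Hn. eapply Rle_lt_trans; [|exact H1].
  apply Rinv_le_contravar; [apply lt_0_INR; lia | apply le_INR; lia].
Qed.

(** * Locally finite sets and discrete measures *)

Lemma locally_finite_list (P : R -> Prop) (A : R) :
  locally_finite P -> exists l, NoDup l /\ forall x, In x l <-> P x /\ Rabs x <= A.
Proof.
  intros H. destruct (H A) as [l Hl].
  set (p := fun x => if excluded_middle_informative (P x /\ Rabs x <= A) then true else false).
  exists (filter p (nodup Req_EM_T l)). split.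
  - apply NoDup_filter, NoDup_nodup.
  - intros x. rewrite filter_In, nodup_In. unfold p.
    specialize (Hl x). destruct excluded_middle_informative; intuition congruence.
Qed.

Lemma locally_finite_incl (P Q : R -> Prop) :
  (forall x, P x -> Q x) -> locally_finite Q -> locally_finite P.
Proof.
  intros H HQ A. destruct (HQ A) as [l Hl]. exists l. auto.
Qed.

Lemma locally_finite_union (P Q : R -> Prop) :
  locally_finite P -> locally_finite Q -> locally_finite (fun x => P x \/ Q x).
Proof.
  intros HP HQ A. destruct (HP A) as [l Hl]. destruct (HQ A) as [l' Hl'].
  exists (l ++ l'). intros x Hx Ax. apply in_or_app. destruct Hx; auto.
Qed.

Lemma locally_finite_translate (P : R -> Prop) (t : R) :
  locally_finite P -> locally_finite (fun x => P (x + t)).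
Proof.
  intros H A. destruct (H (A + Rabs t)) as [l Hl].
  exists (map (fun x => x - t) l). intros x Hx Ax. apply in_map_iff.
  exists (x + t). split; [ring|]. apply Hl; auto.
  eapply Rle_trans; [apply Rabs_triang|]. lra.
Qed.

Lemma locally_finite_lattice (m : R) :
  0 < m -> locally_finite (fun x => exists z : Z, x = IZR z / m).
Proof.
  intros Hm A.
  set (N := Z.abs (up (m * A))).
  exists (map (fun i => IZR (Z.of_nat i - N) / m) (seq 0 (Z.to_nat (2 * N + 1)))).
  intros x [z ->] HA. apply in_map_iff.
  assert (Hz : (Z.abs z <= N)%Z).
  { apply le_IZR. rewrite abs_IZR. apply Rle_trans with (m * A).
    - unfold Rdiv in HA. rewrite Rabs_mult, Rabs_inv, (Rabs_right m) in HA by lra.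
      apply Rmult_le_compat_l with (r := m) in HA; [|lra].
      replace (m * (Rabs (IZR z) * / m)) with (Rabs (IZR z)) in HA by (field; lra). exact HA.
    - unfold N. rewrite abs_IZR. eapply Rle_trans; [|apply Rle_abs].
      left; apply archimed. }
  exists (Z.to_nat (z + N)). split.
  - f_equal. f_equal. lia.
  - apply in_seq. lia.
Qed.

Lemma list_isolated (l : list R) (x : R) :
  exists d, 0 < d /\ forall u, In u l -> Rabs (u - x) < d -> u = x.
Proof.
  induction l as [|v l [d [Hd IH]]].
  - exists 1. split; [lra|]. simpl; tauto.
  - destruct (Req_dec v x) as [E|E].
    + exists d. split; [exact Hd|]. intros u [<-|Hu]; auto.
    + exists (Rmin d (Rabs (v - x))). split.
      * apply Rmin_glb_lt; [exact Hd|]. apply Rabs_pos_lt. lra.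
      * intros u [<-|Hu] H.
        -- pose proof (Rmin_r d (Rabs (v - x))). lra.
        -- apply IH; auto. pose proof (Rmin_l d (Rabs (v - x))). lra.
Qed.

Lemma locally_finite_isolated (P : R -> Prop) (x : R) :
  locally_finite P -> exists d, 0 < d /\ forall u, P u -> Rabs (u - x) < d -> u = x.
Proof.
  intros H. destruct (H (Rabs x + 1)) as [l Hl]. destruct (list_isolated l x) as [d [Hd HI]].
  exists (Rmin d 1). split; [apply Rmin_glb_lt; lra|].
  intros u Pu Hu. apply HI.
  - apply Hl; auto. pose proof (Rabs_triang (u - x) x).
    replace (u - x + x) with u in * by ring. pose proof (Rmin_r d 1). lra.
  - pose proof (Rmin_l d 1). lra.
Qed.

(** [mu] is the sum of the point masses [c x] at [x]. On a test function this is a finite sum over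
    any repetition-free list covering the support of [c * f], which avoids fixing an enumeration of
    the atoms. *)
Definition discrete (c : R -> C) (mu : functional) : Prop :=
  locally_finite (fun x => c x <> 0) /\
  forall f l, Cc f -> NoDup l -> (forall x, (c x * f x)%C <> 0 -> In x l) ->
    mu f = lsum (fun x => (c x * f x)%C) l.

Lemma Cmult_neq_0_l (a b : C) : (a * b)%C <> 0 -> a <> 0.
Proof. intros H ->. apply H. ring. Qed.

Lemma Cmult_neq_0_r (a b : C) : (a * b)%C <> 0 -> b <> 0.
Proof. intros H ->. apply H. ring. Qed.

Lemma locally_finite_cover (c f : R -> C) :
  locally_finite (fun x => c x <> 0) -> compactly_supported f ->
  exists l, NoDup l /\ forall x, (c x * f x)%C <> 0 -> In x l.
Proof.
  intros H [A HA]. destruct (locally_finite_list _ A H) as [l [N Hl]].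
  exists l. split; [exact N|]. intros x Hx. apply Hl. split.
  - apply (Cmult_neq_0_l _ _ Hx).
  - apply Rnot_lt_le. intros F. apply (Cmult_neq_0_r _ _ Hx), HA, F.
Qed.

Lemma discrete_intro (c : R -> C) (mu : functional) :
  locally_finite (fun x => c x <> 0) ->
  (forall f, Cc f -> exists l, NoDup l /\ (forall x, (c x * f x)%C <> 0 -> In x l) /\
     mu f = lsum (fun x => (c x * f x)%C) l) ->
  discrete c mu.
Proof.
  intros H1 H2. split; [exact H1|]. intros f l Hf N Hl.
  destruct (H2 f Hf) as [l' [N' [Hl' ->]]]. apply lsum_support; assumption.
Qed.

Section Discrete.
Variables (c : R -> C) (mu : functional).
Hypothesis D : discrete c mu.

Lemma discrete_linear : linear_on Cc mu.
Proof.
  intros a b f g Hf Hg.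
  destruct (locally_finite_cover c f) as [l [_ Hl]]; [apply D | apply Hf |].
  destruct (locally_finite_cover c g) as [l' [_ Hl']]; [apply D | apply Hg |].
  set (L := nodup Req_EM_T (l ++ l')).
  assert (HL : forall x, In x l \/ In x l' -> In x L)
    by (intros x; unfold L; rewrite nodup_In, in_app_iff; auto).
  assert (N : NoDup L) by apply NoDup_nodup.
  rewrite (proj2 D f L), (proj2 D g L), (proj2 D _ L); auto.
  - rewrite <- !lsum_scal, <- lsum_plus. apply lsum_ext. intros x _. ring.
  - apply Cc_comb; assumption.
  - intros x Hx. apply HL. destruct (classic (c x * f x = 0)%C) as [E|E]; [|left; auto].
    right. apply Hl'. intros E'. apply Hx.
    replace (c x * (a * f x + b * g x))%C with (a * (c x * f x) + b * (c x * g x))%C by ring.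
    rewrite E, E'. ring.
Qed.

Lemma discrete_measure : is_measure mu.
Proof.
  split; [exact discrete_linear|].
  intros A. destruct (locally_finite_list _ A (proj1 D)) as [l [N Hl]].
  exists (fold_right (fun x s => Cmod (c x) + s) 0 l).
  intros f B Hf HA HB.
  rewrite (proj2 D f l Hf N).
  - eapply Rle_trans; [apply lsum_bound with (b := fun x => Cmod (c x) * B)|].
    + intros x _. rewrite Cmod_mult. apply Rmult_le_compat_l; [apply Cmod_ge_0 | apply HB].
    + right. clear. induction l as [|x l IH]; simpl; [ring | rewrite IH; ring].
  - intros x Hx. apply Hl. split; [apply (Cmult_neq_0_l _ _ Hx)|].
    apply Rnot_lt_le. intros F. apply (Cmult_neq_0_r _ _ Hx), HA, F.
Qed.

(** Closer to [x] than all other atoms, a test function sees only the atom at [x]. *)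
Lemma discrete_local (x : R) :
  exists d, 0 < d /\ forall g, Cc g -> (forall u, d <= Rabs (u - x) -> g u = 0) ->
    mu g = (c x * g x)%C.
Proof.
  destruct (locally_finite_isolated _ x (proj1 D)) as [d [Hd H]].
  exists d. split; [exact Hd|]. intros g Hg Hs.
  rewrite (proj2 D g (x :: nil)); auto.
  - simpl. ring.
  - constructor; [simpl; tauto | constructor].
  - intros u Hu. left. symmetry. apply H; [apply (Cmult_neq_0_l _ _ Hu)|].
    apply Rnot_le_lt. intros F. apply (Cmult_neq_0_r _ _ Hu), Hs, F.
Qed.

(** The tents are eventually narrower than the gap around [x], so the limit defining [mass] is
    attained at a finite stage. *)
Lemma discrete_tent (x : R) : exists N : nat, forall n, (N <= n)%nat -> mu (tent x n) = c x.
Proof.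
  destruct (discrete_local x) as [d [Hd H]]. destruct (inv_INR_S_lt d Hd) as [N HN].
  exists N. intros n Hn. rewrite H.
  - rewrite tent_center. ring.
  - apply tent_Cc.
  - intros u Hu. apply tent_far. specialize (HN n Hn). lra.
Qed.

Lemma discrete_mass (x : R) : mass mu x = c x.
Proof.
  destruct (discrete_tent x) as [N HN].
  apply C_ext; unfold mass; simpl.
  - rewrite (Lim_seq_ext_loc _ (fun _ => Re (c x))); [rewrite Lim_seq_const; reflexivity|].
    exists N; intros n Hn; rewrite HN by assumption; reflexivity.
  - rewrite (Lim_seq_ext_loc _ (fun _ => Im (c x))); [rewrite Lim_seq_const; reflexivity|].
    exists N; intros n Hn; rewrite HN by assumption; reflexivity.
Qed.

Lemma discrete_msupport (x : R) : msupport mu x -> c x <> 0.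
Proof.
  intros H E. destruct (discrete_local x) as [d [Hd Hl]].
  destruct (H d Hd) as [g [Hg [Hs Hn]]]. apply Hn. rewrite Hl, E by assumption. ring.
Qed.

Lemma discrete_support_locally_finite : locally_finite (msupport mu).
Proof. apply locally_finite_incl with (2 := proj1 D). exact discrete_msupport. Qed.

Lemma lsum_filter_zero {A} (f : A -> C) (p : A -> bool) l :
  (forall x, p x = false -> f x = 0) -> lsum f (filter p l) = lsum f l.
Proof.
  intros H. induction l as [|x l IH]; simpl; [reflexivity|].
  destruct (p x) eqn:E; simpl; rewrite IH; [reflexivity|]. rewrite (H x E). ring.
Qed.

(** The atoms are sorted into annuli [n <= |x| < n + 1], each with finitely many of them. The Cantor
    pairing turns an annulus and a position in its list into one index, and positions past the end
    of a list get weight 0. For a compactly supported function the series is then a finite sum. *)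
Lemma discrete_pure_point : pure_point mu.
Proof.
  assert (HD : forall n : nat, { l : list R | NoDup l /\
    forall x, In x l <-> (c x <> 0 /\ INR n <= Rabs x < INR n + 1) }).
  { intros n. apply constructive_indefinite_description.
    assert (F : locally_finite (fun x => c x <> 0 /\ INR n <= Rabs x < INR n + 1)).
    { apply locally_finite_incl with (2 := proj1 D). tauto. }
    destruct (locally_finite_list _ (INR n + 1) F) as [l [N Hl]].
    exists l. split; [exact N|]. intros x. rewrite Hl. intuition lra. }
  set (L := fun n => proj1_sig (HD n)).
  assert (NL : forall n, NoDup (L n)) by (intros n; apply (proj2_sig (HD n))).
  assert (IL : forall n x, In x (L n) <-> (c x <> 0 /\ INR n <= Rabs x < INR n + 1))
    by (intros n; apply (proj2_sig (HD n))).
  clearbody L; clear HD.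
  set (valid := fun j => Nat.ltb (snd (Cantor.of_nat j)) (length (L (fst (Cantor.of_nat j))))).
  set (pt := fun j => nth (snd (Cantor.of_nat j)) (L (fst (Cantor.of_nat j))) 0).
  exists pt, (fun j => if valid j then c (pt j) else RtoC 0).
  intros f Hf.
  destruct (proj2 Hf) as [A HA].
  destruct (nfloor_ex (Rabs A) (Rabs_pos A)) as [N HN].
  (* [J] exceeds the codes of all positions in the annuli [0, ..., N], where annulus [N] contains
     [|A|]; larger indices see only points outside the support of [f]. *)
  assert (HJ : exists J, forall n i, (n <= N)%nat -> (i < length (L n))%nat ->
    (Cantor.to_nat (n, i) < J)%nat).
  { assert (Row : forall n, exists J, forall i, (i < length (L n))%nat -> (Cantor.to_nat (n, i) < J)%nat).
    { intros n. generalize (length (L n)). intros k. induction k as [|k [J HJ]]; [exists 0%nat; lia|].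
      exists (Nat.max J (S (Cantor.to_nat (n, k)))). intros i Hi.
      destruct (Nat.eq_dec i k) as [->|]; [lia|]. specialize (HJ i ltac:(lia)). lia. }
    clear HN. induction N as [|N [J IH]].
    - destruct (Row 0%nat) as [J HJ]. exists J. intros n i Hn Hi. replace n with 0%nat in * by lia. auto.
    - destruct (Row (S N)) as [J' HJ']. exists (Nat.max J J'). intros n i Hn Hi.
      destruct (Nat.eq_dec n (S N)) as [->|].
      + specialize (HJ' i Hi). lia.
      + specialize (IH n i ltac:(lia) Hi). lia. }
  destruct HJ as [J HJ].
  set (u := fun j => ((if valid j then c (pt j) else RtoC 0) * f (pt j))%C).
  assert (Hin : forall j, valid j = true -> In (pt j) (L (fst (Cantor.of_nat j)))).
  { intros j Hj. apply nth_In. apply Nat.ltb_lt, Hj. }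
  assert (Z : forall j, (J <= j)%nat -> u j = 0).
  { intros j Hj. unfold u. destruct (valid j) eqn:V; [|ring].
    specialize (Hin j V). apply IL in Hin. rewrite HA; [ring|].
    assert (Hn : (N < fst (Cantor.of_nat j))%nat).
    { apply Nat.nle_gt. intros F. apply Nat.ltb_lt in V. specialize (HJ _ _ F V).
      rewrite <- surjective_pairing, Cantor.cancel_to_of in HJ. lia. }
    apply (le_INR (S N)) in Hn. rewrite S_INR in Hn.
    pose proof (Rle_abs A). lra. }
  split.
  - apply (Csummable_finite u J Z).
  - replace (mu f) with (lsum u (seq 0 J)).
    { apply is_series_finite, Z. }
    rewrite <- (lsum_filter_zero u valid).
    2: { intros j V. unfold u. rewrite V. ring. }
    rewrite (proj2 D f (map pt (filter valid (seq 0 J))) Hf).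
    + rewrite lsum_map. apply lsum_ext. intros j Hj. apply filter_In in Hj.
      unfold u. rewrite (proj2 Hj). reflexivity.
    + apply NoDup_map_NoDup_ForallPairs; [|apply NoDup_filter, seq_NoDup].
      intros i j Hi Hj E. apply filter_In in Hi. apply filter_In in Hj.
      assert (En : fst (Cantor.of_nat i) = fst (Cantor.of_nat j)).
      { pose proof (Hin i (proj2 Hi)) as Ii. pose proof (Hin j (proj2 Hj)) as Ij.
        rewrite <- E in Ij. apply IL in Ii. apply IL in Ij.
        destruct (Nat.lt_trichotomy (fst (Cantor.of_nat i)) (fst (Cantor.of_nat j))) as [F|[F|F]]; auto;
          apply le_INR in F; rewrite S_INR in F; lra. }
      assert (Es : snd (Cantor.of_nat i) = snd (Cantor.of_nat j)).
      { destruct Hi as [_ Vi]. destruct Hj as [_ Vj]. apply Nat.ltb_lt in Vi. apply Nat.ltb_lt in Vj.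
        unfold pt in E. rewrite En in E, Vi. eapply NoDup_nth; eauto. }
      rewrite <- (Cantor.cancel_to_of i), <- (Cantor.cancel_to_of j).
      rewrite (surjective_pairing (Cantor.of_nat i)), (surjective_pairing (Cantor.of_nat j)).
      congruence.
    + intros x Hx. apply in_map_iff.
      assert (Ax : Rabs x <= A).
      { apply Rnot_lt_le. intros F. apply (Cmult_neq_0_r _ _ Hx), HA, F. }
      destruct (nfloor_ex (Rabs x) (Rabs_pos x)) as [n Hn].
      assert (Ix : In x (L n)).
      { apply IL. split; [apply (Cmult_neq_0_l _ _ Hx) | lra]. }
      destruct (In_nth _ _ 0 Ix) as [i [Hi Ei]].
      assert (HnN : (n <= N)%nat).
      { apply Nat.nlt_ge. intros F. apply (le_INR (S N)) in F. rewrite S_INR in F.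
        pose proof (Rle_abs A). lra. }
      exists (Cantor.to_nat (n, i)). split.
      * unfold pt. rewrite Cantor.cancel_of_to. exact Ei.
      * apply filter_In. split; [apply in_seq; specialize (HJ n i HnN Hi); lia|].
        unfold valid. rewrite Cantor.cancel_of_to. apply Nat.ltb_lt, Hi.
Qed.

End Discrete.

(** In a bounded window all but finitely many [d n] vanish, so locally the series is a finite sum
    and its atoms stay locally finite. *)
Lemma discrete_CSeries (d : nat -> R -> C) (nu : nat -> functional) (mu : functional) :
  (forall n, discrete (d n) (nu n)) ->
  (forall A : R, exists N : nat, forall n x, (N <= n)%nat -> Rabs x <= A -> d n x = 0) ->
  (forall f, Cc f -> mu f = CSeries (fun n => nu n f)) ->
  discrete (fun x => CSeries (fun n => d n x)) mu.
Proof.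
  intros HD HN Hmu.
  assert (Hfin : forall N (P : R -> Prop), (forall x, P x -> exists n, (n < N)%nat /\ d n x <> 0) ->
    locally_finite P).
  { intros N. induction N as [|N IH]; intros P HP.
    - intros A. exists nil. intros x Px. destruct (HP x Px) as [n [Hn _]]; lia.
    - apply locally_finite_incl with
        (fun x => d N x <> 0 \/ exists n, (n < N)%nat /\ d n x <> 0).
      + intros x Px. destruct (HP x Px) as [n [Hn Hx]].
        destruct (Nat.eq_dec n N) as [->|]; [left; exact Hx|].
        right; exists n; split; [lia|exact Hx].
      + apply locally_finite_union; [apply HD | apply IH; auto]. }
  apply discrete_intro.
  - intros A. destruct (HN A) as [N Hz].
    destruct (Hfin N (fun x => exists n, (n < N)%nat /\ d n x <> 0) (fun x H => H) A) as [l Hl].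
    exists l. intros x Hx Ax. apply Hl; auto.
    apply NNPP. intros F. apply Hx.
    rewrite (CSeries_finite _ 0); [reflexivity|].
    intros n _. destruct (Nat.le_gt_cases N n) as [L|L]; [apply Hz; auto|].
    apply NNPP. intros E. apply F. exists n; auto.
  - intros f Hf. destruct (proj2 Hf) as [A HA]. destruct (HN A) as [N Hz].
    destruct (locally_finite_list _ A (Hfin N (fun x => exists n, (n < N)%nat /\ d n x <> 0) (fun x H => H)))
      as [l [Nd Hl]].
    assert (HA' : forall x, f x <> 0 -> Rabs x <= A).
    { intros x Hx. apply Rnot_lt_le. intros F. apply Hx, HA, F. }
    assert (Hnu : forall n, nu n f = lsum (fun x => (d n x * f x)%C) l).
    { intros n. apply (proj2 (HD n)); auto. intros x Hx. apply Hl.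
      pose proof (HA' x (Cmult_neq_0_r _ _ Hx)) as Ax. split; [|exact Ax].
      exists n. split; [|apply (Cmult_neq_0_l _ _ Hx)].
      destruct (Nat.le_gt_cases N n) as [L|L]; auto. exfalso.
      apply (Cmult_neq_0_l _ _ Hx), Hz; auto. }
    exists l. split; [exact Nd|]. split.
    + intros x Hx. pose proof (HA' x (Cmult_neq_0_r _ _ Hx)) as Ax.
      apply Hl. split; [|exact Ax]. apply NNPP. intros F.
      apply (Cmult_neq_0_l _ _ Hx). rewrite (CSeries_finite _ 0); [reflexivity|].
      intros n _. destruct (Nat.le_gt_cases N n) as [L|L]; [apply Hz; auto|].
      apply NNPP. intros E. apply F. exists n; auto.
    + rewrite Hmu by assumption.
      assert (Hx : forall x, In x l -> (CSeries (fun n => d n x) * f x)%C =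
        lsum (fun n => (d n x * f x)%C) (seq 0 N)).
      { intros x Ix. apply Hl in Ix. rewrite (CSeries_finite _ N).
        - rewrite Cmult_comm, <- lsum_scal. apply lsum_ext. intros; ring.
        - intros n Hn. apply Hz; tauto. }
      rewrite (lsum_ext _ _ _ Hx), lsum_swap, (CSeries_finite _ N).
      * apply lsum_ext. intros n _. apply Hnu.
      * intros n Hn. rewrite Hnu. apply lsum_zero. intros x Ix. apply Hl in Ix.
        rewrite Hz; [ring | assumption | tauto].
Qed.

Lemma discrete_comb (c d : R -> C) (mu nu : functional) (a b : C) :
  discrete c mu -> discrete d nu ->
  discrete (fun x => (a * c x + b * d x)%C) (fun f => (a * mu f + b * nu f)%C).
Proof.
  intros Hc Hd.
  assert (HF : locally_finite (fun x => c x <> 0 \/ d x <> 0))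
    by (apply locally_finite_union; [apply Hc | apply Hd]).
  assert (Hor : forall x, (a * c x + b * d x)%C <> 0 -> c x <> 0 \/ d x <> 0).
  { intros x Hx. destruct (classic (c x = 0)) as [E|E]; [|left; exact E].
    right. intros E'. apply Hx. rewrite E, E'. ring. }
  apply discrete_intro.
  - apply locally_finite_incl with (2 := HF). exact Hor.
  - intros f Hf. destruct (proj2 Hf) as [A HA].
    destruct (locally_finite_list _ A HF) as [l [N Hl]].
    assert (HI : forall x, (c x <> 0 \/ d x <> 0) -> f x <> 0 -> In x l).
    { intros x Hx Fx. apply Hl. split; [exact Hx|].
      apply Rnot_lt_le. intros F. apply Fx, HA, F. }
    exists l. split; [exact N|]. split.
    + intros x Hx. apply HI; [apply Hor, (Cmult_neq_0_l _ _ Hx) | apply (Cmult_neq_0_r _ _ Hx)].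
    + rewrite (proj2 Hc f l Hf N), (proj2 Hd f l Hf N).
      * rewrite <- !lsum_scal, <- lsum_plus. apply lsum_ext. intros x _. ring.
      * intros x Hx. apply HI; [right; apply (Cmult_neq_0_l _ _ Hx) | apply (Cmult_neq_0_r _ _ Hx)].
      * intros x Hx. apply HI; [left; apply (Cmult_neq_0_l _ _ Hx) | apply (Cmult_neq_0_r _ _ Hx)].
Qed.

Lemma discrete_density (c : R -> C) (mu : functional) (g : R -> C) :
  (forall x, continuous g x) -> discrete c mu -> discrete (fun x => (c x * g x)%C) (mdens g mu).
Proof.
  intros Hg Hc. split.
  - apply locally_finite_incl with (2 := proj1 Hc). intros x. apply Cmult_neq_0_l.
  - intros f l Hf N Hl. unfold mdens. rewrite (proj2 Hc _ l); auto.
    + apply lsum_ext. intros x _. ring.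
    + apply Cc_mult; assumption.
    + intros x Hx. apply Hl. intros E. apply Hx. rewrite <- E. ring.
Qed.

Lemma discrete_translate (c : R -> C) (mu : functional) (t : R) :
  discrete c mu -> discrete (fun x => c (x + t)) (mtranslate t mu).
Proof.
  intros Hc. split.
  - apply (locally_finite_translate (fun x => c x <> 0)), Hc.
  - intros f l Hf N Hl. unfold mtranslate. rewrite (proj2 Hc _ (map (fun x => x + t) l)).
    + rewrite lsum_map. apply lsum_ext. intros x _. do 2 f_equal. ring.
    + apply Cc_translate, Hf.
    + apply FinFun.Injective_map_NoDup; [|exact N]. intros x y E. lra.
    + intros x Hx. apply in_map_iff. exists (x - t). split; [ring|].
      apply Hl. replace (x - t + t) with x by ring. exact Hx.
Qed.

Lemma discrete_agree (c : R -> C) (mu nu : functional) :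
  agree_on Cc mu nu -> discrete c mu -> discrete c nu.
Proof.
  intros H [H1 H2]; split; [exact H1|]. intros f l Hf N Hl. rewrite <- H by exact Hf. auto.
Qed.

Lemma discrete_ext (c d : R -> C) (mu : functional) :
  (forall x, c x = d x) -> discrete c mu -> discrete d mu.
Proof. intros H. replace d with c by (apply functional_extensionality, H). auto. Qed.

(** * Measures with locally finite support *)

Definition ramp (h s u : R) : R := Rmax 0 (Rmin 1 ((u - s) / h)).

Lemma continuous_ramp h s x : continuous (ramp h s) x.
Proof.
  unfold ramp. apply continuous_Rmax0.
  apply continuous_ext with (fun u => 1 - Rmax 0 (1 - (u - s) / h)).
  - intros u. unfold Rmax, Rmin. repeat destruct Rle_dec; simpl; lra.
  - apply (continuous_minus (V := R_NormedModule)); [apply continuous_const|].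
    apply continuous_Rmax0.
    apply (ex_derive_continuous (V := R_NormedModule)). auto_derive; auto.
Qed.

Lemma ramp_right h s u : 0 < h -> s + h <= u -> ramp h s u = 1.
Proof.
  intros Hh Hu. unfold ramp.
  assert (1 <= (u - s) / h) by (apply Rmult_le_reg_r with h; [lra|]; field_simplify; lra).
  rewrite Rmin_left, Rmax_right; lra.
Qed.

Lemma ramp_left h s u : 0 < h -> u <= s -> ramp h s u = 0.
Proof.
  intros Hh Hu. unfold ramp.
  assert ((u - s) / h <= 0) by (apply Rmult_le_reg_r with h; [lra|]; field_simplify; lra).
  rewrite Rmin_right, Rmax_left; lra.
Qed.

Lemma linear_on_zero (mu : functional) : linear_on Cc mu -> mu (fun _ => RtoC 0) = 0.
Proof.
  intros L.
  assert (H : Cc (fun _ => RtoC 0)) by (split; [intros; apply continuous_const | exists 0; auto]).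
  pose proof (L 0 0 _ _ H H) as E. cbv beta in E.
  replace (fun _ : R => (0 * 0 + 0 * 0)%C) with (fun _ : R => RtoC 0) in E
    by (apply functional_extensionality; intros; ring).
  rewrite E. ring.
Qed.

Lemma linear_on_lsum {A : Type} (mu : functional) (g : A -> R -> C) (a : A -> C) l :
  linear_on Cc mu -> (forall x, In x l -> Cc (g x)) ->
  Cc (fun u => lsum (fun x => (a x * g x u)%C) l) /\
  mu (fun u => lsum (fun x => (a x * g x u)%C) l) = lsum (fun x => (a x * mu (g x))%C) l.
Proof.
  intros L. induction l as [|x l IH]; simpl; intros H.
  - split; [split; [intros; apply continuous_const | exists 0; auto]|].
    apply linear_on_zero, L.
  - destruct IH as [I1 I2]; [auto|].
    assert (E : (fun u => (a x * g x u + lsum (fun y => (a y * g y u)%C) l)%C) =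
                (fun u => (a x * g x u + 1 * lsum (fun y => (a y * g y u)%C) l)%C))
      by (apply functional_extensionality; intros; ring).
    rewrite E. split.
    + apply (Cc_comb (a x) 1); auto.
    + rewrite (L (a x) 1 (g x)), I2; auto. ring.
Qed.

Lemma linear_on_sub (mu : functional) (f g : R -> C) :
  linear_on Cc mu -> Cc f -> Cc g -> mu (fun x => (f x - g x)%C) = (mu f - mu g)%C.
Proof.
  intros L Hf Hg.
  replace (fun x : R => (f x - g x)%C) with (fun x : R => (RtoC 1 * f x + RtoC (-1) * g x)%C)
    by (apply functional_extensionality; intros; ring).
  rewrite L by assumption. ring.
Qed.

(* Moving the ramp to the right in small steps never changes mu (ramp * f); it starts as
   the constant 1 and ends as 0 on the support of f. *)
Lemma measure_locally_zero (mu : functional) (f : R -> C) :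
  is_measure mu -> Cc f ->
  (forall t, exists d, 0 < d /\ forall g, Cc g ->
     (forall u, d <= Rabs (u - t) -> g u = 0) -> mu (fun u => (g u * f u)%C) = 0) ->
  mu f = 0.
Proof.
  intros [L _] Hf H.
  destruct (proj2 Hf) as [A0 HA0].
  set (A := Rmax A0 1).
  assert (HA : forall x, A < Rabs x -> f x = 0).
  { intros x Hx. apply HA0. eapply Rle_lt_trans; [apply Rmax_l | exact Hx]. }
  assert (A1 : 1 <= A) by apply Rmax_r.
  assert (HD : forall t, { d : posreal | forall g, Cc g ->
     (forall u, 2 * d <= Rabs (u - t) -> g u = 0) -> mu (fun u => (g u * f u)%C) = 0}).
  { intros t. apply constructive_indefinite_description.
    destruct (H t) as [d [Hd Ht]].
    assert (Hd2 : 0 < d / 2) by lra.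
    exists (mkposreal _ Hd2). intros g Hg Hs. apply Ht; auto.
    intros u Hu. apply Hs. simpl. lra. }
  (* Compactness provides one step width: every centre lies within the radius attached to some [t],
     and that radius is at least [d]. The stored radii are half the admissible ones, so the
     difference of two neighbouring ramps, which lives within [h <= d] of its centre, still fits. *)
  destruct (compactness_value_1d (- A - 1) (A + 1) (fun t => proj1_sig (HD t))) as [d Hd].
  set (h := Rmin d 1).
  assert (h0 : 0 < h) by (apply Rmin_glb_lt; [apply cond_pos | lra]).
  assert (h1 : h <= 1) by apply Rmin_r.
  assert (hd : h <= d) by apply Rmin_l.
  assert (Hr : forall s, Cc (fun u => (RtoC (ramp h s u) * f u)%C)).
  { intros s. apply Cc_mult; auto. intros x. apply continuous_R_C, continuous_ramp. }
  assert (Step : forall s, - A - 1 <= s + h <= A + 1 ->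
    mu (fun u => (RtoC (ramp h s u) * f u)%C) = mu (fun u => (RtoC (ramp h (s + h) u) * f u)%C)).
  { intros s Hs.
    assert (Hloc : mu (fun u => ((RtoC (ramp h s u) - RtoC (ramp h (s + h) u)) * f u)%C) = 0).
    { apply NNPP. intros F. apply (Hd (s + h) Hs). intros [t [_ [Ht1 Ht2]]]. apply F.
      cbv beta in Ht1, Ht2. pose proof (proj2_sig (HD t)) as Ht. cbv beta in Ht.
      apply Ht with (g := fun u => (RtoC (ramp h s u) - RtoC (ramp h (s + h) u))%C).
      - split.
        + intros x. apply continuous_C; split; simpl.
          * apply (continuous_minus (V := R_NormedModule)); apply continuous_ramp.
          * apply continuous_const.
        + exists (Rabs s + 2 * h). intros x Hx.
          assert (x <= s \/ s + h + h <= x) as [E|E].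
          { destruct (Rle_lt_dec x s); [left; auto|].
            destruct (Rle_lt_dec (s + h + h) x); [right; auto|]. exfalso.
            revert Hx. unfold Rabs. repeat destruct Rcase_abs; lra. }
          * rewrite !ramp_left by lra. ring.
          * rewrite !ramp_right by lra. ring.
      - intros u Hu.
        assert (u <= s \/ s + h + h <= u) as [E|E].
        { destruct (Rle_lt_dec u s); [left; auto|].
          destruct (Rle_lt_dec (s + h + h) u); [right; auto|]. exfalso.
          clearbody h. revert Ht2 Hu Ht1. generalize (pos (proj1_sig (HD t))). intros q.
          unfold Rabs. repeat destruct Rcase_abs; lra. }
        + rewrite !ramp_left by lra. ring.
        + rewrite !ramp_right by lra. ring. }
    replace (fun u => ((RtoC (ramp h s u) - RtoC (ramp h (s + h) u)) * f u)%C)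
      with (fun u => (RtoC (ramp h s u) * f u - RtoC (ramp h (s + h) u) * f u)%C) in Hloc
      by (apply functional_extensionality; intros; ring).
    rewrite linear_on_sub in Hloc by auto.
    replace (mu (fun u => (RtoC (ramp h s u) * f u)%C)) with
      ((mu (fun u => RtoC (ramp h s u) * f u) - mu (fun u => RtoC (ramp h (s + h) u) * f u))
       + mu (fun u => RtoC (ramp h (s + h) u) * f u))%C by ring.
    rewrite Hloc. ring. }
  assert (Iter : forall i : nat, INR i * h <= 2 * A ->
    mu f = mu (fun u => (RtoC (ramp h (- A - h + INR i * h) u) * f u)%C)).
  { induction i as [|i IH]; intros Hi.
    - f_equal. apply functional_extensionality. intros u.
      destruct (Rlt_le_dec A (Rabs u)) as [E|E]; [rewrite HA by assumption; ring|].
      rewrite ramp_right; [ring | lra|]. simpl. revert E; unfold Rabs; destruct Rcase_abs; lra.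
    - rewrite S_INR in *. assert (0 <= INR i * h) by (apply Rmult_le_pos; [apply pos_INR | lra]).
      rewrite IH, Step by lra.
      replace (- A - h + (INR i + 1) * h) with (- A - h + INR i * h + h) by ring. reflexivity. }
  destruct (nfloor_ex (2 * A / h)) as [N [HN1 HN2]].
  { apply Rmult_le_pos; [lra|]. left. apply Rinv_0_lt_compat, h0. }
  assert (E1 : INR N * h <= 2 * A).
  { apply Rmult_le_compat_r with (r := h) in HN1; [|lra].
    unfold Rdiv in HN1. rewrite Rmult_assoc, Rinv_l in HN1; lra. }
  assert (E2 : 2 * A < (INR N + 1) * h).
  { apply Rmult_lt_compat_r with (r := h) in HN2; [|lra].
    unfold Rdiv in HN2. rewrite Rmult_assoc, Rinv_l in HN2; lra. }
  rewrite (Iter N E1), Step, Step by lra.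
  rewrite <- (linear_on_zero mu L) at 1. f_equal.
  apply functional_extensionality. intros u.
  destruct (Rlt_le_dec A (Rabs u)) as [E|E]; [rewrite HA by assumption; ring|].
  rewrite ramp_left; [ring | lra|]. revert E; unfold Rabs; destruct Rcase_abs; lra.
Qed.

(** Soft thresholding at level [e]: continuous, zero on [[-e, e]], and within [e] of the
    identity. *)
Definition soft (e v : R) : R := v - Rmax (- e) (Rmin e v).

Lemma continuous_soft (e : R) (f : R -> R) x :
  0 < e -> continuous f x -> continuous (fun u => soft e (f u)) x.
Proof.
  intros He H. apply continuous_ext with (fun u => Rmax 0 (f u - e) - Rmax 0 (- f u - e)).
  - intros u. unfold soft, Rmax, Rmin. repeat destruct Rle_dec; simpl; lra.
  - apply (continuous_minus (V := R_NormedModule)); apply continuous_Rmax0.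
    + apply (continuous_minus (V := R_NormedModule)); [exact H | apply continuous_const].
    + apply (continuous_minus (V := R_NormedModule)); [|apply continuous_const].
      apply (continuous_opp (V := R_NormedModule)), H.
Qed.

Lemma soft_small e v : Rabs v <= e -> soft e v = 0.
Proof. unfold soft, Rmax, Rmin, Rabs. repeat destruct Rle_dec; destruct Rcase_abs; lra. Qed.

Lemma soft_near e v : 0 < e -> Rabs (v - soft e v) <= e.
Proof. unfold soft, Rmax, Rmin, Rabs. repeat destruct Rle_dec; destruct Rcase_abs; lra. Qed.

(** Near a support point [f] is smaller than [e] by continuity, so its thresholded version vanishes
    there; near any other point [mu] itself vanishes. Hence [mu] kills the thresholded function, and
    local boundedness of [mu] controls the difference as [e] shrinks. *)
Lemma measure_zero_on_support (mu : functional) (f : R -> C) :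
  is_measure mu -> Cc f -> (forall x, msupport mu x -> f x = 0) -> mu f = 0.
Proof.
  intros Hmu Hf H. pose proof Hmu as [L HM].
  destruct (proj2 Hf) as [A HA]. destruct (HM A) as [M HMA].
  set (fe := fun (e : R) (u : R) => (soft e (Re (f u)), soft e (Im (f u))) : C).
  assert (Hfe : forall e, 0 < e -> Cc (fe e)).
  { intros e He. split.
    - intros x. pose proof (proj1 (continuous_C f x) (proj1 Hf x)) as [C1 C2].
      apply continuous_C; split; apply continuous_soft; auto.
    - exists A. intros x Hx. unfold fe. rewrite HA by assumption. simpl.
      rewrite soft_small; [reflexivity | rewrite Rabs_R0; lra]. }
  assert (Z : forall e, 0 < e -> mu (fe e) = 0).
  { intros e He. apply measure_locally_zero; auto. intros t.
    destruct (classic (msupport mu t)) as [St|St].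
    - pose proof (proj1 Hf t) as Ct.
      assert (Hloc : locally t (fun u => Rabs (Re (f u)) <= e /\ Rabs (Im (f u)) <= e)).
      { pose proof (proj1 (continuous_C f t) Ct) as [C1 C2].
        set (e' := mkposreal e He).
        apply filter_imp with (2 := filter_and _ _ (proj1 (filterlim_locally _ _) C1 e')
          (proj1 (filterlim_locally _ _) C2 e')).
        rewrite H by assumption. simpl. unfold ball; simpl; unfold AbsRing_ball, abs, minus, plus, opp; simpl.
        intros u. rewrite !Ropp_0, !Rplus_0_r. lra. }
      destruct Hloc as [d Hd]. exists d. split; [apply cond_pos|].
      intros g Hg Hs. rewrite <- (linear_on_zero mu L). f_equal.
      apply functional_extensionality. intros u.
      destruct (Rlt_le_dec (Rabs (u - t)) d) as [E|E].
      + destruct (Hd u E) as [E1 E2]. unfold fe. rewrite !soft_small by assumption.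
        apply C_ext; simpl; ring.
      + rewrite Hs by assumption. ring.
    - apply NNPP. intros F. apply St. intros eps Heps.
      apply NNPP. intros F'. apply F. exists eps. split; [exact Heps|].
      intros g Hg Hs. apply NNPP. intros E. apply F'.
      exists (fun u => (g u * fe e u)%C). repeat split.
      + apply (Cc_mult g (fe e)); auto. apply Hg.
      + apply (Cc_mult g (fe e)); auto. apply Hg.
      + intros u Hu. rewrite Hs by assumption. ring.
      + exact E. }
  apply Cmod_zero. apply Rnot_lt_le. intros F.
  (* With this [e] the bound [M * (2 * e)] is at most half of [Cmod (mu f)]; the factor 2 accounts
     for thresholding both components. *)
  set (e := Cmod (mu f) / (4 * (Rabs M + 1))).
  pose proof (Rabs_pos M) as PM.
  assert (He : 0 < e) by (apply Rdiv_lt_0_compat; lra).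
  assert (E : mu f = mu (fun u => (f u - fe e u)%C)).
  { rewrite linear_on_sub, Z by auto. ring. }
  assert (B : Cmod (mu (fun u => (f u - fe e u)%C)) <= M * (2 * e)).
  { apply HMA.
    - replace (fun x => (f x - fe e x)%C) with (fun x => (1 * f x + RtoC (-1) * fe e x)%C)
        by (apply functional_extensionality; intros; ring).
      apply Cc_comb; auto.
    - intros x Hx. unfold fe. rewrite HA by assumption. simpl.
      rewrite soft_small by (rewrite Rabs_R0; lra). apply C_ext; simpl; ring.
    - intros x. eapply Rle_trans; [apply Cmod_le_Re_Im|]. simpl.
      pose proof (soft_near e (Re (f x)) He). pose proof (soft_near e (Im (f x)) He).
      unfold Re, Im, Rminus in *. lra. }
  rewrite <- E in B.
  assert (M * (2 * e) <= (Rabs M + 1) * (2 * e)).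
  { apply Rmult_le_compat_r; [lra|]. pose proof (Rle_abs M). lra. }
  assert ((Rabs M + 1) * (2 * e) = Cmod (mu f) / 2) by (unfold e; field; lra).
  lra.
Qed.

(** Take tents so narrow that each vanishes at all support points but its own. Subtracting from [f]
    the combination of tents with coefficients [f x] leaves a function that vanishes on the support,
    so [mu f] is the sum of the [f x] times the masses. *)
Lemma measure_discrete (mu : functional) :
  is_measure mu -> locally_finite (msupport mu) -> discrete (mass mu) mu.
Proof.
  intros Hmu HF. pose proof (proj1 Hmu) as L.
  assert (Iso : forall x, exists N : nat, forall n, (N <= n)%nat -> forall u, msupport mu u -> u <> x ->
    tent x n u = 0).
  { intros x. destruct (locally_finite_isolated _ x HF) as [d [Hd H]].
    destruct (inv_INR_S_lt d Hd) as [N HN]. exists N. intros n Hn u Hu Hux.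
    apply tent_far. specialize (HN n Hn). apply Rnot_lt_le. intros F. apply Hux, H; auto. lra. }
  assert (Mass : forall x, exists N : nat, forall n, (N <= n)%nat -> mu (tent x n) = mass mu x).
  { intros x. destruct (Iso x) as [N HN]. exists N.
    assert (E : forall n, (N <= n)%nat -> mu (tent x n) = mu (tent x N)).
    { intros n Hn.
      assert (Z : mu (fun u => (tent x n u - tent x N u)%C) = 0).
      { apply measure_zero_on_support; auto.
        - replace (fun u => (tent x n u - tent x N u)%C) with (fun u => (1 * tent x n u + RtoC (-1) * tent x N u)%C)
            by (apply functional_extensionality; intros; ring).
          apply Cc_comb; apply tent_Cc.
        - intros u Hu. destruct (Req_dec u x) as [->|E]; [rewrite !tent_center; ring|].
          rewrite !HN; auto. ring. }
      rewrite linear_on_sub in Z by (auto using tent_Cc).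
      replace (mu (tent x n)) with ((mu (tent x n) - mu (tent x N)) + mu (tent x N))%C by ring.
      rewrite Z. ring. }
    intros n Hn. rewrite E by assumption. symmetry.
    apply C_ext; unfold mass; simpl.
    - rewrite (Lim_seq_ext_loc _ (fun _ => Re (mu (tent x N)))); [rewrite Lim_seq_const; reflexivity|].
      exists N; intros k Hk; rewrite E by assumption; reflexivity.
    - rewrite (Lim_seq_ext_loc _ (fun _ => Im (mu (tent x N)))); [rewrite Lim_seq_const; reflexivity|].
      exists N; intros k Hk; rewrite E by assumption; reflexivity. }
  assert (Supp : forall x, mass mu x <> 0 -> msupport mu x).
  { intros x Hx. apply NNPP. intros F. apply Hx.
    destruct (Mass x) as [N1 H1]. destruct (Iso x) as [N2 H2].
    rewrite <- (H1 (Nat.max N1 N2)) by lia. apply measure_zero_on_support; auto using tent_Cc.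
    intros u Hu. apply H2; auto; [lia|]. congruence. }
  apply discrete_intro; [apply locally_finite_incl with (2 := HF); exact Supp|].
  intros f Hf. destruct (proj2 Hf) as [A HA].
  destruct (locally_finite_list _ A HF) as [l [Nd Hl]].
  assert (Hn : exists n, forall x, In x l -> mu (tent x n) = mass mu x /\
    forall u, msupport mu u -> u <> x -> tent x n u = 0).
  { assert (HN : exists N, forall n, (N <= n)%nat -> forall x, In x l -> mu (tent x n) = mass mu x /\
      forall u, msupport mu u -> u <> x -> tent x n u = 0).
    { clear Nd Hl. induction l as [|x l [N IH]]; [exists 0%nat; simpl; tauto|].
      destruct (Mass x) as [N1 H1]. destruct (Iso x) as [N2 H2].
      exists (Nat.max N (Nat.max N1 N2)). intros n Hn y [<-|Hy].
      - split; [apply H1; lia | apply H2; lia].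
      - apply IH; auto; lia. }
    destruct HN as [N HN]. exists N. apply HN; lia. }
  destruct Hn as [n Hn].
  exists l. split; [exact Nd|]. split.
  - intros x Hx. apply Hl. split; [apply Supp, (Cmult_neq_0_l _ _ Hx)|].
    apply Rnot_lt_le. intros F. apply (Cmult_neq_0_r _ _ Hx), HA, F.
  - destruct (linear_on_lsum mu (fun x => tent x n) f l L) as [I1 I2]; [intros; apply tent_Cc|].
    assert (Z : mu (fun u => (f u - lsum (fun x => (f x * tent x n u)%C) l)%C) = 0).
    { apply measure_zero_on_support; auto.
      - replace (fun u => (f u - lsum (fun x => (f x * tent x n u)%C) l)%C)
          with (fun u => (1 * f u + RtoC (-1) * lsum (fun x => (f x * tent x n u)%C) l)%C)
          by (apply functional_extensionality; intros; ring).
        apply Cc_comb; auto.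
      - intros u Hu. destruct (classic (In u l)) as [Iu|Iu].
        + rewrite (lsum_single _ l u Nd Iu).
          * rewrite tent_center. ring.
          * intros x Ix Hxu. rewrite (proj2 (Hn x Ix)); auto. ring.
        + rewrite lsum_zero.
          * rewrite HA; [ring|]. apply Rnot_le_lt. intros F. apply Iu, Hl; auto.
          * intros x Ix. rewrite (proj2 (Hn x Ix)); auto; [ring|]. congruence. }
    rewrite linear_on_sub in Z by auto. rewrite I2 in Z.
    rewrite (lsum_ext _ (fun x => (f x * mu (tent x n))%C)).
    + replace (mu f) with ((mu f - lsum (fun x => (f x * mu (tent x n))%C) l) +
        lsum (fun x => (f x * mu (tent x n))%C) l)%C by ring.
      rewrite Z. ring.
    + intros x Ix. rewrite (proj1 (Hn x Ix)). ring.
Qed.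

(** * Total variation *)

(** The supremum is an extended real, so [tv_pos] is meaningful only if some finite bound [B] is
    known; the competitor 0 excludes minus infinity. *)
Lemma tv_pos_lub (mu : functional) (h : R -> R) (B : R) :
  is_measure mu -> (forall x, 0 <= h x) ->
  (forall g, Cc g -> (forall x, Cmod (g x) <= h x) -> Cmod (mu g) <= B) ->
  (forall g, Cc g -> (forall x, Cmod (g x) <= h x) -> Cmod (mu g) <= tv_pos mu h) /\
  tv_pos mu h <= B.
Proof.
  intros Hmu Hh HB. unfold tv_pos.
  set (E := fun r => exists g : R -> C,
    Cc g /\ (forall x : R, Cmod (g x) <= h x) /\ r = Cmod (mu g)).
  destruct (Lub_Rbar_correct E) as [U1 U2].
  assert (E0 : E 0).
  { exists (fun _ => RtoC 0). split; [split; [intros; apply continuous_const | exists 0; auto]|].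
    split; [intros; rewrite Cmod_0; auto|].
    rewrite linear_on_zero, Cmod_0 by apply Hmu. reflexivity. }
  assert (UB : Rbar_le (Lub_Rbar E) B).
  { apply U2. intros r [g [Hg [Hgh ->]]]. apply HB; auto. }
  pose proof (U1 0 E0) as LB.
  destruct (Lub_Rbar E) as [r| |]; simpl in *; try tauto.
  split; [|exact UB]. intros g Hg Hgh. apply (U1 (Cmod (mu g))). exists g. auto.
Qed.

Lemma tv_pos_zero (mu : functional) : is_measure mu -> tv_pos mu (fun _ => 0) = 0.
Proof.
  intros Hmu.
  assert (HB : forall g, Cc g -> (forall x, Cmod (g x) <= 0) -> Cmod (mu g) <= 0).
  { intros g Hg Hz. replace g with (fun _ : R => RtoC 0).
    - rewrite linear_on_zero, Cmod_0 by apply Hmu. lra.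
    - apply functional_extensionality. intros x. symmetry. apply Cmod_zero, Hz. }
  destruct (tv_pos_lub mu (fun _ => 0) 0 Hmu) as [H1 H2]; auto; [intros; lra|].
  apply Rle_antisym; [exact H2|].
  eapply Rle_trans; [apply Cmod_ge_0 | apply (H1 (fun _ => RtoC 0))].
  - split; [intros; apply continuous_const | exists 0; auto].
  - intros. rewrite Cmod_0. lra.
Qed.

Lemma total_variation_nonneg (mu : functional) (h : R -> R) :
  is_measure mu -> (forall x, 0 <= h x) ->
  total_variation mu (fun x => RtoC (h x)) = RtoC (tv_pos mu h).
Proof.
  intros Hmu Hh. unfold total_variation. simpl.
  replace (fun x => Rmax (h x) 0) with h
    by (apply functional_extensionality; intros x; rewrite Rmax_left; auto).
  replace (fun x => Rmax (- h x) 0) with (fun _ : R => 0).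
  2: { apply functional_extensionality; intros x; rewrite Rmax_right; auto. specialize (Hh x); lra. }
  replace (fun _ : R => Rmax 0 0) with (fun _ : R => 0)
    by (apply functional_extensionality; intros x; rewrite Rmax_left; lra).
  replace (fun _ : R => Rmax (- 0) 0) with (fun _ : R => 0)
    by (apply functional_extensionality; intros x; rewrite Rmax_right; lra).
  rewrite tv_pos_zero by assumption. apply C_ext; simpl; ring.
Qed.

(** A competitor dominated by a narrow tent meets only the atom at [x], with a value of modulus at
    most 1, and the tent itself attains the bound. *)
Lemma discrete_tv_tent (c : R -> C) (mu : functional) (x : R) : discrete c mu ->
  exists N : nat, forall n, (N <= n)%nat -> total_variation mu (tent x n) = RtoC (Cmod (c x)).
Proof.
  intros D. pose proof (discrete_measure c mu D) as Hmu.
  destruct (discrete_local c mu D x) as [d [Hd H]]. destruct (inv_INR_S_lt d Hd) as [N HN].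
  exists N. intros n Hn. unfold tent.
  rewrite total_variation_nonneg by (auto; intros; apply tent_le_1).
  f_equal.
  destruct (tv_pos_lub mu (fun u => Rmax 0 (1 - INR (S n) * Rabs (u - x))) (Cmod (c x)) Hmu) as [T1 T2].
  - intros; apply tent_le_1.
  - intros g Hg Hb. rewrite H; auto.
    + rewrite Cmod_mult. rewrite <- (Rmult_1_r (Cmod (c x))) at 2.
      apply Rmult_le_compat_l; [apply Cmod_ge_0|].
      eapply Rle_trans; [apply Hb | apply tent_le_1].
    + intros u Hu. apply Cmod_zero. eapply Rle_trans; [apply Hb|].
      pose proof (tent_far x n u) as T. unfold tent in T.
      specialize (HN n Hn). apply (f_equal Re) in T; [|lra]. simpl in T. simpl. lra.
  - apply Rle_antisym; [exact T2|].
    replace (c x) with (mu (tent x n)).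
    + apply T1; [apply tent_Cc|]. intros u. unfold tent. rewrite Cmod_RtoC, Rabs_right; [lra|].
      apply Rle_ge, tent_le_1.
    + rewrite H; [rewrite tent_center; ring | apply tent_Cc|].
      intros u Hu. apply tent_far. specialize (HN n Hn). lra.
Qed.

Lemma discrete_mass_tv (c : R -> C) (mu : functional) (x : R) :
  discrete c mu -> mass (total_variation mu) x = RtoC (Cmod (c x)).
Proof.
  intros D. destruct (discrete_tv_tent c mu x D) as [N HN].
  unfold mass.
  rewrite (Lim_seq_ext_loc (fun n => Re (total_variation mu (tent x n))) (fun _ => Cmod (c x)))
    by (exists N; intros n Hn; rewrite HN by assumption; reflexivity).
  rewrite (Lim_seq_ext_loc (fun n => Im (total_variation mu (tent x n))) (fun _ => 0))
    by (exists N; intros n Hn; rewrite HN by assumption; reflexivity).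
  rewrite !Lim_seq_const. reflexivity.
Qed.

(** A narrow tent inside the interval competes in the supremum [open_mass], so an atom there has
    modulus at most 0. *)
Lemma open_mass_zero (c : R -> C) (mu : functional) (a b x : R) :
  discrete c mu -> open_mass (total_variation mu) (fun u => a < u < b) = Finite 0 ->
  a < x < b -> c x = 0.
Proof.
  intros D H Hx. unfold open_mass in H.
  match type of H with Lub_Rbar ?E = _ => destruct (Lub_Rbar_correct E) as [U _] end.
  rewrite H in U.
  destruct (discrete_tv_tent c mu x D) as [N1 H1].
  destruct (inv_INR_S_lt (Rmin (x - a) (b - x))) as [N2 H2]; [apply Rmin_glb_lt; lra|].
  set (n := Nat.max N1 N2).
  apply Cmod_zero.
  apply (U (Cmod (c x))). exists (fun u => Rmax 0 (1 - INR (S n) * Rabs (u - x))).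
  split; [apply tent_Cc|]. split; [intros; apply tent_le_1|]. split.
  - intros u Hu. specialize (H2 n ltac:(lia)).
    pose proof (tent_far x n u) as T. unfold tent in T. apply (f_equal Re) in T; [exact T|].
    pose proof (Rmin_l (x - a) (b - x)). pose proof (Rmin_r (x - a) (b - x)).
    apply Rnot_lt_le. intros F. apply Hu.
    revert F; unfold Rabs; destruct Rcase_abs; lra.
  - assert (E : total_variation mu (tent x n) = RtoC (Cmod (c x))) by (apply H1; lia).
    exact (f_equal Re (eq_sym E)).
Qed.

(** Converts the conditions on support and total variation into conditions on the coefficients
    [mass mu], which is the form used by all later estimates. *)
Lemma eigenmeasure_discrete (lambda : C) (m : nat) (mu : functional) :
  (0 < m)%nat -> is_periodic_eigenmeasure lambda m mu ->
  discrete (mass mu) mu /\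
  forall x, mass mu x <> 0 ->
    (exists z : Z, x = IZR z / INR m) /\ INR m / 4 - 1 <= Rabs x /\ Cmod (mass mu x) <= 1.
Proof.
  intros Hm [Hmu [_ [Hs [_ [_ [Hgap [Htv _]]]]]]].
  assert (Hm0 : 0 < INR m) by (apply lt_0_INR, Hm).
  assert (HF : locally_finite (msupport mu)).
  { apply locally_finite_incl with (1 := Hs). apply locally_finite_lattice, Hm0. }
  pose proof (measure_discrete mu Hmu HF) as D.
  assert (Supp : forall x, mass mu x <> 0 -> msupport mu x).
  { intros x Hx eps Heps.
    destruct (discrete_local _ mu D x) as [d [Hd H]].
    destruct (inv_INR_S_lt (Rmin d eps)) as [N HN]; [apply Rmin_glb_lt; lra|].
    specialize (HN N ltac:(lia)). pose proof (Rmin_l d eps). pose proof (Rmin_r d eps).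
    exists (tent x N). split; [apply tent_Cc|]. split.
    - intros u Hu. apply tent_far. lra.
    - rewrite H, tent_center, Cmult_1_r; [exact Hx | apply tent_Cc|].
      intros u Hu. apply tent_far. lra. }
  split; [exact D|]. intros x Hx. split; [apply Hs, Supp, Hx|]. split.
  - apply Rnot_lt_le. intros F. apply Hx.
    apply (open_mass_zero _ mu (- (INR m / 4) + 1) (INR m / 4 - 1) x D Hgap).
    revert F; unfold Rabs; destruct Rcase_abs; lra.
  - specialize (Htv x (Supp x Hx)). rewrite (discrete_mass_tv _ mu x D) in Htv. exact Htv.
Qed.

(** * Smooth complex-valued functions *)

Definition is_Cderive (f : R -> C) (x : R) (l : C) : Prop :=
  is_derive (fun u => Re (f u)) x (Re l) /\ is_derive (fun u => Im (f u)) x (Im l).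

Definition CD (f : R -> C) (x : R) : C :=
  (Derive (fun u => Re (f u)) x, Derive (fun u => Im (f u)) x).

Lemma is_Cderive_unique f x l : is_Cderive f x l -> CD f x = l.
Proof. intros [H1 H2]. apply C_ext; apply is_derive_unique; assumption. Qed.

Lemma is_Cderive_continuous f x l : is_Cderive f x l -> continuous f x.
Proof.
  intros [H1 H2]. apply continuous_C; split;
    apply (ex_derive_continuous (V := R_NormedModule)); eexists; eassumption.
Qed.

Lemma is_Cderive_plus f g x l m :
  is_Cderive f x l -> is_Cderive g x m -> is_Cderive (fun u => (f u + g u)%C) x (l + m)%C.
Proof.
  intros [H1 H2] [H3 H4]; split.
  - apply (is_derive_plus (fun u => Re (f u)) (fun u => Re (g u))); assumption.
  - apply (is_derive_plus (fun u => Im (f u)) (fun u => Im (g u))); assumption.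
Qed.

Lemma is_derive_mult_R (f g : R -> R) x l m :
  is_derive f x l -> is_derive g x m -> is_derive (fun u => f u * g u) x (l * g x + f x * m).
Proof. intros H1 H2. apply (is_derive_mult f g x l m H1 H2 Rmult_comm). Qed.

Lemma is_Cderive_mult f g x l m :
  is_Cderive f x l -> is_Cderive g x m ->
  is_Cderive (fun u => (f u * g u)%C) x (l * g x + f x * m)%C.
Proof.
  intros [H1 H2] [H3 H4]; split.
  - replace (Re (l * g x + f x * m)%C) with
      ((Re l * Re (g x) + Re (f x) * Re m) - (Im l * Im (g x) + Im (f x) * Im m))
      by (simpl; unfold Re, Im; ring).
    apply (is_derive_minus (fun u => Re (f u) * Re (g u)) (fun u => Im (f u) * Im (g u)));
      apply is_derive_mult_R; assumption.
  - replace (Im (l * g x + f x * m)%C) with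
      ((Re l * Im (g x) + Re (f x) * Im m) + (Im l * Re (g x) + Im (f x) * Re m))
      by (simpl; unfold Re, Im; ring).
    apply (is_derive_plus (fun u => Re (f u) * Im (g u)) (fun u => Im (f u) * Re (g u)));
      apply is_derive_mult_R; assumption.
Qed.

Lemma is_derive_cst (c x : R) : is_derive (fun _ : R => c) x 0.
Proof. exact (is_derive_const (K := R_AbsRing) (V := R_NormedModule) c x). Qed.

Lemma is_Cderive_const (c : C) (x : R) : is_Cderive (fun _ => c) x 0.
Proof. split; [exact (is_derive_cst (Re c) x) | exact (is_derive_cst (Im c) x)]. Qed.

Lemma is_Cderive_scal (c : C) (f : R -> C) (x : R) (l : C) :
  is_Cderive f x l -> is_Cderive (fun u => (c * f u)%C) x (c * l)%C.
Proof.
  intros H. replace (c * l)%C with (0 * f x + c * l)%C by ring.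
  apply (is_Cderive_mult (fun _ => c) f x); [apply is_Cderive_const | exact H].
Qed.

Lemma is_Cderive_RtoC (f : R -> R) (x l : R) :
  is_derive f x l -> is_Cderive (fun u => RtoC (f u)) x (RtoC l).
Proof. intros H; split; [exact H | exact (is_derive_cst 0 x)]. Qed.

Lemma is_Cderive_ext f g x l : (forall u, f u = g u) -> is_Cderive f x l -> is_Cderive g x l.
Proof. intros H. replace g with f by (apply functional_extensionality, H). auto. Qed.

Lemma is_Cderive_comp_affine f a b x l :
  is_Cderive f (a * x + b) l -> is_Cderive (fun u => f (a * u + b)) x (RtoC a * l)%C.
Proof.
  assert (A : is_derive (fun u => a * u + b) x a) by (auto_derive; auto; ring).
  intros [H1 H2]; split.
  - replace (Re (RtoC a * l)%C) with (scal a (Re l)) by (simpl; unfold scal, Re; simpl; unfold mult; simpl; ring).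
    apply (is_derive_comp (fun v => Re (f v)) (fun u => a * u + b)); assumption.
  - replace (Im (RtoC a * l)%C) with (scal a (Im l)) by (simpl; unfold scal, Im; simpl; unfold mult; simpl; ring).
    apply (is_derive_comp (fun v => Im (f v)) (fun u => a * u + b)); assumption.
Qed.

Lemma is_Cderive_cis a b x :
  is_Cderive (fun u => cis (a * u + b)) x (RtoC a * Ci * cis (a * x + b))%C.
Proof.
  split; unfold cis; simpl; auto_derive; auto; unfold Re, Im; simpl; ring.
Qed.

Lemma Derive_n_S (f : R -> R) n x : Derive_n f (S n) x = Derive_n (Derive f) n x.
Proof. rewrite <- Nat.add_1_r, <- Derive_n_comp. reflexivity. Qed.

Lemma CDerive_n_S f n x : CDerive_n f (S n) x = CDerive_n (CD f) n x.
Proof. unfold CDerive_n. rewrite !Derive_n_S. reflexivity. Qed.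

Lemma CDerive_n_0 f x : CDerive_n f 0 x = f x.
Proof. unfold CDerive_n; simpl. destruct (f x); reflexivity. Qed.

Lemma ex_derive_n_S (f : R -> R) n x :
  ex_derive_n f (S (S n)) x <-> ex_derive_n (Derive f) (S n) x.
Proof.
  simpl. split; apply ex_derive_ext; intros u.
  - apply (Derive_n_S f n).
  - symmetry. apply (Derive_n_S f n).
Qed.

Lemma smooth_S f : smooth f <-> (forall x, is_Cderive f x (CD f x)) /\ smooth (CD f).
Proof.
  split.
  - intros H; split.
    + intros x. destruct (H 1%nat x) as [H1 H2]. split; apply Derive_correct; assumption.
    + intros n x. destruct n as [|n]; [simpl; auto|].
      destruct (H (S (S n)) x) as [H1 H2]. split.
      * exact (proj1 (ex_derive_n_S (fun u => Re (f u)) n x) H1).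
      * exact (proj1 (ex_derive_n_S (fun u => Im (f u)) n x) H2).
  - intros [H1 H2] n x. destruct n as [|[|n]]; [simpl; auto| |].
    + destruct (H1 x) as [A B]. split; eexists; eassumption.
    + destruct (H2 (S n) x) as [A B]. split.
      * exact (proj2 (ex_derive_n_S (fun u => Re (f u)) n x) A).
      * exact (proj2 (ex_derive_n_S (fun u => Im (f u)) n x) B).
Qed.

Lemma smooth_derive f x : smooth f -> is_Cderive f x (CD f x).
Proof. intros H. apply (proj1 (smooth_S f) H). Qed.

Lemma smooth_CD f : smooth f -> smooth (CD f).
Proof. intros H. apply (proj1 (smooth_S f) H). Qed.

Lemma smooth_continuous f x : smooth f -> continuous f x.
Proof. intros H. apply is_Cderive_continuous with (CD f x), smooth_derive, H. Qed.

(** Coinduction for smoothness: a class of differentiable functions closed under [CD] consists of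
    smooth functions. An invariant class thus replaces explicit formulas for higher derivatives of
    products, compositions and Fourier transforms. *)
Lemma smooth_coind (P : (R -> C) -> Prop) :
  (forall f, P f -> (forall x, is_Cderive f x (CD f x)) /\ P (CD f)) ->
  forall f, P f -> smooth f.
Proof.
  intros H f Hf n. revert f Hf. induction n as [|n IH]; intros f Hf x; [simpl; auto|].
  destruct (H f Hf) as [H1 H2]. destruct n as [|n].
  - destruct (H1 x) as [A B]. split; eexists; eassumption.
  - destruct (IH (CD f) H2 x) as [A B]. split.
    + exact (proj2 (ex_derive_n_S (fun u => Re (f u)) n x) A).
    + exact (proj2 (ex_derive_n_S (fun u => Im (f u)) n x) B).
Qed.

Lemma CD_eq (f g : R -> C) : (forall x, is_Cderive f x (g x)) -> CD f = g.
Proof. intros H. apply functional_extensionality. intros x. apply is_Cderive_unique, H. Qed.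

Lemma smooth_of_derive f g : (forall x, is_Cderive f x (g x)) -> smooth g -> smooth f.
Proof.
  intros H Hg. apply smooth_S. rewrite (CD_eq f g H). auto.
Qed.

Lemma CD_plus f g : smooth f -> smooth g -> CD (fun x => (f x + g x)%C) = (fun x => (CD f x + CD g x)%C).
Proof. intros Hf Hg. apply CD_eq. intros x. apply is_Cderive_plus; apply smooth_derive; assumption. Qed.

Lemma CD_mult f g : smooth f -> smooth g ->
  CD (fun x => (f x * g x)%C) = (fun x => (CD f x * g x + f x * CD g x)%C).
Proof. intros Hf Hg. apply CD_eq. intros x. apply is_Cderive_mult; apply smooth_derive; assumption. Qed.

Lemma smooth_plus f g : smooth f -> smooth g -> smooth (fun x => (f x + g x)%C).
Proof.
  intros Hf Hg.
  apply (smooth_coind (fun F => exists f g, smooth f /\ smooth g /\ F = fun x => (f x + g x)%C)).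
  - clear. intros F [f [g [Hf [Hg ->]]]].
    assert (H : forall x, is_Cderive (fun u => (f u + g u)%C) x (CD f x + CD g x)%C)
      by (intros x; apply is_Cderive_plus; apply smooth_derive; assumption).
    rewrite (CD_eq _ _ H). split; [exact H|]. exists (CD f), (CD g). auto using smooth_CD.
  - exists f, g. auto.
Qed.

(** The invariant class consists of the finite sums of products of smooth functions; differentiation
    doubles the number of summands. *)
Lemma smooth_mult f g : smooth f -> smooth g -> smooth (fun x => (f x * g x)%C).
Proof.
  intros Hf Hg.
  apply (smooth_coind (fun F => exists l : list ((R -> C) * (R -> C)),
    (forall p, In p l -> smooth (fst p) /\ smooth (snd p)) /\
    F = fun x => lsum (fun p => (fst p x * snd p x)%C) l)).
  - clear. intros F [l [Hl ->]].
    set (l' := flat_map (fun p => (CD (fst p), snd p) :: (fst p, CD (snd p)) :: nil) l).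
    assert (H : forall x, is_Cderive (fun u => lsum (fun p => (fst p u * snd p u)%C) l) x
      (lsum (fun p => (fst p x * snd p x)%C) l')).
    { intros x. unfold l'. clear l'. induction l as [|p l IH]; simpl.
      - apply is_Cderive_const.
      - destruct (Hl p (or_introl eq_refl)).
        rewrite Cplus_assoc. apply is_Cderive_plus.
        + apply is_Cderive_mult; apply smooth_derive; assumption.
        + apply IH. intros q Hq. apply Hl. right; exact Hq. }
    rewrite (CD_eq _ _ H). split; [exact H|]. exists l'. split; [|reflexivity].
    intros p Hp. apply in_flat_map in Hp. destruct Hp as [q [Hq Hp]].
    destruct (Hl q Hq). destruct Hp as [<-|[<-|[]]]; simpl; auto using smooth_CD.
  - exists ((f, g) :: nil). split.
    + intros p [<-|[]]; auto.
    + apply functional_extensionality. intros x. simpl. ring.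
Qed.

Lemma smooth_const c : smooth (fun _ => c).
Proof.
  apply (smooth_coind (fun f => exists c, f = fun _ => c)); [|eauto].
  intros f [a ->]. rewrite (CD_eq _ _ (is_Cderive_const a)).
  split; [apply is_Cderive_const | eauto].
Qed.

Lemma smooth_id : smooth RtoC.
Proof.
  apply smooth_of_derive with (fun _ => RtoC 1); [|apply smooth_const].
  intros x. apply is_Cderive_RtoC. apply (is_derive_id (K := R_AbsRing)).
Qed.

Lemma smooth_cis a b : smooth (fun x => cis (a * x + b)).
Proof.
  apply (smooth_coind (fun f => exists c, f = fun x => (c * cis (a * x + b))%C)).
  - intros f [c ->].
    assert (H : forall x, is_Cderive (fun x => (c * cis (a * x + b))%C) x
      ((c * (RtoC a * Ci)) * cis (a * x + b))%C).
    { intros x. rewrite <- Cmult_assoc. apply (is_Cderive_scal c (fun x => cis (a * x + b))), is_Cderive_cis. }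
    rewrite (CD_eq _ _ H). split; [exact H | eauto].
  - exists (RtoC 1). apply functional_extensionality. intros x. ring.
Qed.

Lemma CD_comp_affine f a b : smooth f ->
  CD (fun x => f (a * x + b)) = (fun x => (RtoC a * CD f (a * x + b))%C).
Proof. intros Hf. apply CD_eq. intros x. apply is_Cderive_comp_affine, smooth_derive, Hf. Qed.

Lemma smooth_comp_affine f a b : smooth f -> smooth (fun x => f (a * x + b)).
Proof.
  intros Hf.
  apply (smooth_coind (fun F => exists c f, smooth f /\ F = fun x => (c * f (a * x + b)%R)%C)).
  - clear. intros F [c [f [Hf ->]]].
    assert (H : forall x, is_Cderive (fun x => (c * f (a * x + b)%R)%C) x
      ((c * RtoC a) * CD f (a * x + b))%C).
    { intros x. rewrite <- Cmult_assoc. apply (is_Cderive_scal c (fun x => f (a * x + b))).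
      apply is_Cderive_comp_affine, smooth_derive, Hf. }
    rewrite (CD_eq _ _ H). split; [exact H|]. exists (c * RtoC a)%C, (CD f). auto using smooth_CD.
  - exists (RtoC 1), f. split; [exact Hf|]. apply functional_extensionality. intros x. ring.
Qed.

Lemma CDerive_n_plus f g n x : smooth f -> smooth g ->
  CDerive_n (fun x => (f x + g x)%C) n x = (CDerive_n f n x + CDerive_n g n x)%C.
Proof.
  revert f g. induction n as [|n IH]; intros f g Hf Hg.
  - rewrite !CDerive_n_0. reflexivity.
  - rewrite !CDerive_n_S, CD_plus, IH; auto using smooth_CD.
Qed.

Lemma CDerive_n_scal c f n x : smooth f ->
  CDerive_n (fun x => (c * f x)%C) n x = (c * CDerive_n f n x)%C.
Proof.
  revert f. induction n as [|n IH]; intros f Hf.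
  - rewrite !CDerive_n_0. reflexivity.
  - rewrite !CDerive_n_S, <- IH by auto using smooth_CD. f_equal.
    apply CD_eq. intros y. apply is_Cderive_scal, smooth_derive, Hf.
Qed.

Lemma smooth_CDerive_n f n : smooth f -> smooth (CDerive_n f n).
Proof.
  revert f. induction n as [|n IH]; intros f Hf.
  - replace (CDerive_n f 0) with f; [exact Hf|].
    apply functional_extensionality; intros; symmetry; apply CDerive_n_0.
  - replace (CDerive_n f (S n)) with (CDerive_n (CD f) n); [apply IH, smooth_CD, Hf|].
    apply functional_extensionality; intros; symmetry; apply CDerive_n_S.
Qed.

Lemma CDerive_n_comp_affine f a b n x : smooth f ->
  CDerive_n (fun x => f (a * x + b)) n x = (RtoC (a ^ n) * CDerive_n f n (a * x + b))%C.
Proof.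
  revert f. induction n as [|n IH]; intros f Hf.
  - rewrite !CDerive_n_0. simpl. ring.
  - rewrite CDerive_n_S, CD_comp_affine by assumption.
    rewrite (CDerive_n_scal (RtoC a) (fun x => CD f (a * x + b)))
      by (apply smooth_comp_affine, smooth_CD, Hf).
    rewrite IH by (apply smooth_CD, Hf). rewrite (CDerive_n_S f). simpl. rewrite RtoC_mult. ring.
Qed.

(** Each derivative splits a product into two products, whence the factor [2 ^ n]. *)
Lemma CDerive_n_mult_bound (h f : R -> C) (n : nat) (x H F : R) :
  smooth h -> smooth f ->
  (forall j, (j <= n)%nat -> Cmod (CDerive_n h j x) <= H) ->
  (forall j, (j <= n)%nat -> Cmod (CDerive_n f j x) <= F) ->
  Cmod (CDerive_n (fun u => (h u * f u)%C) n x) <= 2 ^ n * (H * F).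
Proof.
  revert h f. induction n as [|n IH]; intros h f Sh Sf Hh Hf.
  - rewrite CDerive_n_0, Cmod_mult, pow_O, Rmult_1_l.
    apply Rmult_le_compat; try apply Cmod_ge_0.
    + rewrite <- CDerive_n_0. apply Hh; lia.
    + rewrite <- CDerive_n_0. apply Hf; lia.
  - rewrite CDerive_n_S, CD_mult by assumption.
    rewrite (CDerive_n_plus (fun x => (CD h x * f x)%C) (fun x => (h x * CD f x)%C))
      by (apply smooth_mult; auto using smooth_CD).
    eapply Rle_trans; [apply Cmod_triangle|].
    assert (A1 : Cmod (CDerive_n (fun x => (CD h x * f x)%C) n x) <= 2 ^ n * (H * F)).
    { apply IH; auto using smooth_CD.
      intros j Hj. rewrite <- CDerive_n_S. apply Hh; lia. }
    assert (A2 : Cmod (CDerive_n (fun x => (h x * CD f x)%C) n x) <= 2 ^ n * (H * F)).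
    { apply IH; auto using smooth_CD.
      intros j Hj. rewrite <- CDerive_n_S. apply Hf; lia. }
    simpl. lra.
Qed.

(** * Schwartz functions *)

Lemma max_index (g : nat -> R) (n : nat) :
  exists m, (m <= n)%nat /\ forall j, (j <= n)%nat -> g j <= g m.
Proof.
  induction n as [|n [m [Hm H]]].
  - exists 0%nat. split; [lia|]. intros j Hj. replace j with 0%nat by lia. lra.
  - destruct (Rle_lt_dec (g (S n)) (g m)) as [E|E].
    + exists m. split; [lia|]. intros j Hj.
      destruct (Nat.eq_dec j (S n)) as [->|]; [exact E | apply H; lia].
    + exists (S n). split; [lia|]. intros j Hj.
      destruct (Nat.eq_dec j (S n)) as [->|]; [lra | specialize (H j ltac:(lia)); lra].
Qed.

(** The bound [w] on [h] may depend on the point, so the estimate serves multipliers of linear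
    growth as well as cut-offs that vanish on a long interval. At each [x] the largest derivative of
    [f] stands in for all of them. *)
Lemma schwartz_bound_mult (h f : R -> C) (w : R -> R) (N : nat) (K : R) :
  smooth h -> smooth f ->
  (forall j x, (j <= N)%nat -> Cmod (CDerive_n h j x) <= w x) ->
  (forall i j x, (i <= N)%nat -> (j <= N)%nat -> w x * (Rabs x ^ i * Cmod (CDerive_n f j x)) <= K) ->
  schwartz_bound N (2 ^ N * K) (fun x => (h x * f x)%C).
Proof.
  intros Sh Sf Hh Hf i j x Hi Hj.
  destruct (max_index (fun m => Cmod (CDerive_n f m x)) j) as [m [Hm Hmax]].
  assert (B := CDerive_n_mult_bound h f j x (w x) (Cmod (CDerive_n f m x)) Sh Sf
    ltac:(intros; apply Hh; lia) Hmax).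
  specialize (Hf i m x Hi ltac:(lia)).
  assert (P0 : 0 <= Rabs x ^ i) by (apply pow_le, Rabs_pos).
  assert (W0 : 0 <= w x) by (eapply Rle_trans; [apply Cmod_ge_0 | apply (Hh 0%nat x); lia]).
  assert (0 <= w x * (Rabs x ^ i * Cmod (CDerive_n f m x))).
  { apply Rmult_le_pos; [exact W0|]. apply Rmult_le_pos; [exact P0 | apply Cmod_ge_0]. }
  apply Rle_trans with (Rabs x ^ i * (2 ^ j * (w x * Cmod (CDerive_n f m x)))).
  - apply Rmult_le_compat_l; assumption.
  - replace (Rabs x ^ i * (2 ^ j * (w x * Cmod (CDerive_n f m x)))) with
      (2 ^ j * (w x * (Rabs x ^ i * Cmod (CDerive_n f m x)))) by ring.
    apply Rmult_le_compat; auto.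
    + apply pow_le; lra.
    + apply Rle_pow; [lra | exact Hj].
Qed.

Lemma schwartz_bound_nonneg N B f : schwartz_bound N B f -> 0 <= B.
Proof.
  intros H. eapply Rle_trans; [|apply (H 0%nat 0%nat 0); lia].
  rewrite pow_O, Rmult_1_l. apply Cmod_ge_0.
Qed.

Lemma schwartz_bound_mono N N' B B' f :
  (N <= N')%nat -> B <= B' -> schwartz_bound N' B f -> schwartz_bound N B' f.
Proof.
  intros HN HB H i j x Hi Hj. eapply Rle_trans; [apply H; lia | exact HB].
Qed.

Lemma schwartz_bound_mult_linear (h f : R -> C) (N : nat) (H B : R) :
  smooth h -> smooth f -> 0 <= H ->
  (forall j x, (j <= N)%nat -> Cmod (CDerive_n h j x) <= H * (1 + Rabs x)) ->
  schwartz_bound (S N) B f -> schwartz_bound N (2 ^ N * (2 * H * B)) (fun x => (h x * f x)%C).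
Proof.
  intros Sh Sf H0 Hh Hf.
  apply schwartz_bound_mult with (fun x => H * (1 + Rabs x)); auto.
  intros i j x Hi Hj.
  pose proof (Hf i j x ltac:(lia) ltac:(lia)) as B1.
  pose proof (Hf (S i) j x ltac:(lia) ltac:(lia)) as B2. simpl in B2.
  replace (H * (1 + Rabs x) * (Rabs x ^ i * Cmod (CDerive_n f j x))) with
    (H * (Rabs x ^ i * Cmod (CDerive_n f j x) + Rabs x * Rabs x ^ i * Cmod (CDerive_n f j x))) by ring.
  replace (2 * H * B) with (H * (B + B)) by ring. apply Rmult_le_compat_l; lra.
Qed.

(** Linear growth covers constants, characters and the coordinate [x], and costs exactly one order
    of decay. *)
Definition multiplier (h : R -> C) : Prop :=
  smooth h /\ forall N, exists H, 0 <= H /\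
    forall j x, (j <= N)%nat -> Cmod (CDerive_n h j x) <= H * (1 + Rabs x).

Lemma schwartz_mult (h f : R -> C) :
  multiplier h -> schwartz f -> schwartz (fun x => (h x * f x)%C).
Proof.
  intros [Sh Hh] [Sf Hf]. split; [apply smooth_mult; assumption|].
  intros N. destruct (Hh N) as [H [H0 HH]]. destruct (Hf (S N)) as [B HB].
  exists (2 ^ N * (2 * H * B)). apply schwartz_bound_mult_linear; auto.
Qed.

Lemma CDerive_n_const c n x : CDerive_n (fun _ => c) (S n) x = 0.
Proof.
  revert c. induction n as [|n IH]; intros c; rewrite CDerive_n_S, (CD_eq _ _ (is_Cderive_const c)).
  - rewrite CDerive_n_0. reflexivity.
  - apply IH.
Qed.

Lemma multiplier_const c : multiplier (fun _ => c).
Proof.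
  split; [apply smooth_const|]. intros N. exists (Cmod c). split; [apply Cmod_ge_0|].
  intros [|j] x _.
  - rewrite CDerive_n_0. pose proof (Rabs_pos x). pose proof (Cmod_ge_0 c). nra.
  - rewrite CDerive_n_const, Cmod_0. pose proof (Rabs_pos x). pose proof (Cmod_ge_0 c). nra.
Qed.

Lemma id_derivatives (j : nat) (x : R) : Cmod (CDerive_n RtoC j x) <= 1 * (1 + Rabs x).
Proof.
  pose proof (Rabs_pos x). destruct j as [|[|j]].
  - rewrite CDerive_n_0, Cmod_RtoC. lra.
  - rewrite CDerive_n_S, (CD_eq RtoC (fun _ => RtoC 1)).
    + rewrite CDerive_n_0, Cmod_1. lra.
    + intros y. apply is_Cderive_RtoC. apply (is_derive_id (K := R_AbsRing)).
  - rewrite CDerive_n_S, (CD_eq RtoC (fun _ => RtoC 1)).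
    + rewrite CDerive_n_const, Cmod_0. lra.
    + intros y. apply is_Cderive_RtoC. apply (is_derive_id (K := R_AbsRing)).
Qed.

Lemma multiplier_id : multiplier RtoC.
Proof.
  split; [apply smooth_id|]. intros N. exists 1. split; [lra|]. intros; apply id_derivatives.
Qed.

Lemma cis_derivatives a b j x : CDerive_n (fun x => cis (a * x + b)) j x = (Cpow (RtoC a * Ci) j * cis (a * x + b))%C.
Proof.
  induction j as [|j IH].
  - rewrite CDerive_n_0. simpl. ring.
  - rewrite CDerive_n_S, (CD_eq _ _ (is_Cderive_cis a b)), CDerive_n_scal, IH by apply smooth_cis.
    rewrite Cpow_S. ring.
Qed.

Lemma Cmod_Ci : Cmod Ci = 1.
Proof. unfold Cmod, Ci; simpl. replace (0 * (0 * 1) + 1 * (1 * 1)) with 1 by ring. apply sqrt_1. Qed.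

Lemma multiplier_cis a b : multiplier (fun x => cis (a * x + b)).
Proof.
  split; [apply smooth_cis|]. intros N. exists ((1 + Rabs a) ^ N).
  pose proof (Rabs_pos a). split; [apply pow_le; lra|].
  intros j x Hj. rewrite cis_derivatives, Cmod_mult, Cmod_cis, Rmult_1_r, Cmod_pow, Cmod_mult, Cmod_Ci, Rmult_1_r, Cmod_RtoC.
  apply Rle_trans with ((1 + Rabs a) ^ N).
  - apply Rle_trans with ((1 + Rabs a) ^ j).
    + apply pow_incr. lra.
    + apply Rle_pow; [lra | exact Hj].
  - assert (0 <= (1 + Rabs a) ^ N) by (apply pow_le; lra). pose proof (Rabs_pos x). nra.
Qed.

Lemma schwartz_scal c f : schwartz f -> schwartz (fun x => (c * f x)%C).
Proof. apply (schwartz_mult (fun _ => c)), multiplier_const. Qed.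

Lemma schwartz_bound_comb N B B' c d f g : smooth f -> smooth g ->
  schwartz_bound N B f -> schwartz_bound N B' g ->
  schwartz_bound N (Cmod c * B + Cmod d * B') (fun x => (c * f x + d * g x)%C).
Proof.
  intros Sf Sg Hf Hg i j x Hi Hj.
  rewrite CDerive_n_plus by (apply (smooth_mult (fun _ => _)); auto using smooth_const).
  rewrite !CDerive_n_scal by assumption.
  specialize (Hf i j x Hi Hj). specialize (Hg i j x Hi Hj).
  assert (P0 : 0 <= Rabs x ^ i) by (apply pow_le, Rabs_pos).
  pose proof (Cmod_ge_0 c). pose proof (Cmod_ge_0 d).
  apply Rle_trans with (Rabs x ^ i * (Cmod c * Cmod (CDerive_n f j x) + Cmod d * Cmod (CDerive_n g j x))).
  - apply Rmult_le_compat_l; [exact P0|].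
    eapply Rle_trans; [apply Cmod_triangle|]. rewrite !Cmod_mult. lra.
  - replace (Rabs x ^ i * (Cmod c * Cmod (CDerive_n f j x) + Cmod d * Cmod (CDerive_n g j x))) with
      (Cmod c * (Rabs x ^ i * Cmod (CDerive_n f j x)) + Cmod d * (Rabs x ^ i * Cmod (CDerive_n g j x))) by ring.
    apply Rplus_le_compat; apply Rmult_le_compat_l; assumption.
Qed.

Lemma schwartz_comb c d f g : schwartz f -> schwartz g -> schwartz (fun x => (c * f x + d * g x)%C).
Proof.
  intros [Sf Hf] [Sg Hg]. split.
  - apply smooth_plus; apply (smooth_mult (fun _ => _)); auto using smooth_const.
  - intros N. destruct (Hf N) as [B HB]. destruct (Hg N) as [B' HB']. eexists.
    apply schwartz_bound_comb; eassumption.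
Qed.

Lemma schwartz_bound_CD N B f : schwartz_bound (S N) B f -> schwartz_bound N B (CD f).
Proof. intros H i j x Hi Hj. rewrite <- CDerive_n_S. apply H; lia. Qed.

Lemma schwartz_CD f : schwartz f -> schwartz (CD f).
Proof.
  intros [Sf Hf]. split; [apply smooth_CD, Sf|].
  intros N. destruct (Hf (S N)) as [B HB]. exists B. apply schwartz_bound_CD, HB.
Qed.

Lemma pow_le_add (u v : R) (i N : nat) : 0 <= u -> 0 <= v -> (i <= N)%nat ->
  (u + v) ^ i <= (2 * (1 + v)) ^ N * (1 + u ^ i).
Proof.
  intros Hu Hv Hi.
  apply Rle_trans with ((2 * (1 + v)) ^ i * (1 + u ^ i)).
  - destruct (Rle_lt_dec u 1) as [E|E].
    + apply Rle_trans with ((2 * (1 + v)) ^ i * 1).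
      * rewrite Rmult_1_r. apply pow_incr. lra.
      * apply Rmult_le_compat_l; [apply pow_le; lra|]. pose proof (pow_le u i Hu). lra.
    + apply Rle_trans with ((2 * (1 + v)) ^ i * u ^ i).
      * rewrite <- Rpow_mult_distr. apply pow_incr. nra.
      * apply Rmult_le_compat_l; [apply pow_le; lra|]. lra.
  - apply Rmult_le_compat_r; [pose proof (pow_le u i Hu); lra|].
    apply Rle_pow; [lra | exact Hi].
Qed.

(** The Schwartz norms of a translate grow at most polynomially in the shift [b]. The failure of
    temperedness of the total variation is measured against this rate. *)
Lemma schwartz_bound_comp_affine N B f a b : Rabs a = 1 -> smooth f -> schwartz_bound N B f ->
  schwartz_bound N ((2 * (1 + Rabs b)) ^ N * (B + B)) (fun x => f (a * x + b)).
Proof.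
  intros Ha Sf HB.
  intros i j x Hi Hj. rewrite CDerive_n_comp_affine, Cmod_mult, Cmod_RtoC by assumption.
  rewrite <- RPow_abs, Ha, pow1, Rmult_1_l.
  pose proof (HB i j (a * x + b) Hi Hj) as B1.
  pose proof (HB 0%nat j (a * x + b) ltac:(lia) Hj) as B0. rewrite pow_O, Rmult_1_l in B0.
  set (c := Cmod (CDerive_n f j (a * x + b))) in *.
  assert (0 <= c) by apply Cmod_ge_0.
  assert (E : Rabs x <= Rabs (a * x + b) + Rabs b).
  { replace (Rabs x) with (Rabs (a * x)) by (rewrite Rabs_mult, Ha; ring).
    replace (a * x) with ((a * x + b) + - b) at 1 by ring.
    rewrite <- (Rabs_Ropp b). apply Rabs_triang. }
  apply Rle_trans with ((Rabs (a * x + b) + Rabs b) ^ i * c).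
  - apply Rmult_le_compat_r; [assumption|]. apply pow_incr. split; [apply Rabs_pos | exact E].
  - apply Rle_trans with ((2 * (1 + Rabs b)) ^ N * (1 + Rabs (a * x + b) ^ i) * c).
    + apply Rmult_le_compat_r; [assumption|]. apply pow_le_add; auto using Rabs_pos.
    + rewrite Rmult_assoc. apply Rmult_le_compat_l.
      * apply pow_le. pose proof (Rabs_pos b); lra.
      * lra.
Qed.

Lemma schwartz_comp_affine f a b : Rabs a = 1 -> schwartz f -> schwartz (fun x => f (a * x + b)).
Proof.
  intros Ha [Sf Hf]. split; [apply smooth_comp_affine, Sf|].
  intros N. destruct (Hf N) as [B HB]. eexists. apply schwartz_bound_comp_affine; eassumption.
Qed.

Lemma schwartz_translate f t : schwartz f -> schwartz (fun x => f (x - t)).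
Proof.
  intros H. replace (fun x => f (x - t)) with (fun x => f (1 * x + - t)).
  - apply schwartz_comp_affine; [apply Rabs_R1 | exact H].
  - apply functional_extensionality; intros x; f_equal; ring.
Qed.

Lemma continuous_bounded_on (f : R -> C) (a b : R) : (forall x, continuous f x) ->
  exists B, forall x, a <= x <= b -> Cmod (f x) <= B.
Proof.
  intros Hf. destruct (Rle_lt_dec a b) as [E|E].
  2: { exists 0. intros x Hx. lra. }
  assert (HR : forall g : R -> R, (forall x, continuous g x) -> exists B, forall x, a <= x <= b -> Rabs (g x) <= B).
  { intros g Hg. destruct (continuity_ab_maj (fun x => Rabs (g x)) a b E) as [m [Hm _]].
    - intros c _. apply continuity_pt_filterlim.
      apply (continuous_comp g Rabs); [apply Hg | apply continuous_Rabs].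
    - exists (Rabs (g m)). exact Hm. }
  destruct (HR (fun x => Re (f x))) as [B1 H1]; [intros x; apply (proj1 (continuous_C f x) (Hf x))|].
  destruct (HR (fun x => Im (f x))) as [B2 H2]; [intros x; apply (proj1 (continuous_C f x) (Hf x))|].
  exists (B1 + B2). intros x Hx. specialize (H1 x Hx). specialize (H2 x Hx).
  eapply Rle_trans; [apply Cmod_le_Re_Im|]. lra.
Qed.

Lemma finite_uniform_bound (P : nat -> R -> Prop) (N : nat) :
  (forall j B B', P j B -> B <= B' -> P j B') ->
  (forall j, exists B, P j B) -> exists B, forall j, (j <= N)%nat -> P j B.
Proof.
  intros Mono H. induction N as [|N [B IH]].
  - destruct (H 0%nat) as [B HB]. exists B. intros j Hj. replace j with 0%nat by lia. exact HB.
  - destruct (H (S N)) as [B' HB']. exists (Rmax B B'). intros j Hj.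
    destruct (Nat.eq_dec j (S N)) as [->|].
    + apply (Mono _ B'); [exact HB' | apply Rmax_r].
    + apply (Mono _ B); [apply IH; lia | apply Rmax_l].
Qed.

Lemma is_Cderive_locally_zero (f : R -> C) (x A : R) : A < Rabs x -> (forall u, A < Rabs u -> f u = 0) -> is_Cderive f x 0.
Proof.
  intros Hx HA.
  assert (L : locally x (fun u => f u = 0)).
  { assert (Hd : 0 < Rabs x - A) by lra. exists (mkposreal _ Hd).
    intros u Hu. apply HA. change (Rabs (u - x) < Rabs x - A) in Hu.
    pose proof (Rabs_triang_inv x u) as T. rewrite (Rabs_minus_sym x u) in T. lra. }
  split.
  - apply (is_derive_ext_loc (fun _ => 0)); [|exact (is_derive_cst 0 x)].
    apply filter_imp with (2 := L). intros u ->. reflexivity.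
  - apply (is_derive_ext_loc (fun _ => 0)); [|exact (is_derive_cst 0 x)].
    apply filter_imp with (2 := L). intros u ->. reflexivity.
Qed.

Lemma CDerive_n_outside (f : R -> C) (A : R) (n : nat) (x : R) : (forall u, A < Rabs u -> f u = 0) -> A < Rabs x -> CDerive_n f n x = 0.
Proof.
  revert f. induction n as [|n IH]; intros f HA Hx.
  - rewrite CDerive_n_0. auto.
  - rewrite CDerive_n_S. apply IH; auto. intros u Hu.
    apply is_Cderive_unique, (is_Cderive_locally_zero f u A); auto.
Qed.

Lemma Cc_infty_derivatives_bounded f n : Cc_infty f -> exists B, forall x, Cmod (CDerive_n f n x) <= B.
Proof.
  intros [Sf [A HA]].
  destruct (continuous_bounded_on (CDerive_n f n) (- A) A) as [B HB].
  { intros x. apply smooth_continuous, smooth_CDerive_n, Sf. }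
  exists (Rmax B 0). intros x. destruct (Rlt_le_dec A (Rabs x)) as [E|E].
  - rewrite (CDerive_n_outside f A) by assumption. rewrite Cmod_0. apply Rmax_r.
  - eapply Rle_trans; [apply HB | apply Rmax_l]. revert E; unfold Rabs; destruct Rcase_abs; lra.
Qed.

Lemma Cc_infty_schwartz f : Cc_infty f -> schwartz f.
Proof.
  intros H. pose proof H as [Sf [A HA]]. split; [exact Sf|]. intros N.
  destruct (finite_uniform_bound (fun j B => forall x, Cmod (CDerive_n f j x) <= B) N) as [B HB].
  - intros j B B' H1 H2 x. specialize (H1 x). lra.
  - intros j. apply Cc_infty_derivatives_bounded, H.
  - exists ((1 + Rabs A) ^ N * B). intros i j x Hi Hj.
    assert (B0 : 0 <= B) by (eapply Rle_trans; [apply Cmod_ge_0 | apply (HB 0%nat ltac:(lia) 0)]).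
    assert (P0 : 0 <= (1 + Rabs A) ^ N) by (apply pow_le; pose proof (Rabs_pos A); lra).
    destruct (Rlt_le_dec A (Rabs x)) as [E|E].
    + rewrite (CDerive_n_outside f A) by assumption. rewrite Cmod_0, Rmult_0_r. apply Rmult_le_pos; assumption.
    + apply Rmult_le_compat; auto using Cmod_ge_0, pow_le, Rabs_pos.
      apply Rle_trans with ((1 + Rabs A) ^ i).
      * apply pow_incr. split; [apply Rabs_pos|]. pose proof (Rle_abs A). lra.
      * apply Rle_pow; [pose proof (Rabs_pos A); lra | exact Hi].
Qed.

Lemma Cc_infty_Cc f : Cc_infty f -> Cc f.
Proof. intros [Sf Hf]. split; [intros x; apply smooth_continuous, Sf | exact Hf]. Qed.

Lemma Cc_infty_mult h f : smooth h -> Cc_infty f -> Cc_infty (fun x => (h x * f x)%C).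
Proof.
  intros Sh [Sf [A HA]]. split; [apply smooth_mult; assumption|].
  exists A. intros x Hx. rewrite HA by assumption. ring.
Qed.

Lemma Cc_infty_comp_affine f a b : Rabs a = 1 -> Cc_infty f -> Cc_infty (fun x => f (a * x + b)).
Proof.
  intros Ha [Sf [A HA]]. split; [apply smooth_comp_affine, Sf|].
  exists (A + Rabs b). intros x Hx. apply HA.
  assert (E : Rabs x <= Rabs (a * x + b) + Rabs b).
  { replace (Rabs x) with (Rabs (a * x)) by (rewrite Rabs_mult, Ha; ring).
    replace (a * x) with ((a * x + b) + - b) at 1 by ring.
    rewrite <- (Rabs_Ropp b). apply Rabs_triang. }
  lra.
Qed.

(** * Integrals over the line and the Fourier transform of Schwartz functions *)

Lemma primitive_exists (g : R -> R) : (forall x, continuous g x) ->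
  exists G : R -> R, forall x, is_derive G x (g x).
Proof.
  intros Hc. exists (fun x => RInt (V := R_CompleteNormedModule) g 0 x). intros x.
  apply (is_derive_RInt (V := R_NormedModule) g _ 0 x); [|apply Hc].
  apply filter_forall. intros y. apply (RInt_correct (V := R_CompleteNormedModule) g).
  apply (ex_RInt_continuous (V := R_CompleteNormedModule)). intros; apply Hc.
Qed.

(** For [s = 1] and [s = -1] the function [s * G x + B / x] is nonincreasing on the positive axis,
    since [s * g x <= B / x ^ 2]. Increments of [G] are therefore dominated by those of [B / x],
    which gives both the limit and its rate. *)
Lemma primitive_limit (G g : R -> R) (B : R) :
  (forall x, is_derive G x (g x)) -> (forall x, x ^ 2 * Rabs (g x) <= B) ->
  exists L, filterlim G (Rbar_locally p_infty) (locally L) /\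
    forall x, 0 < x -> Rabs (L - G x) <= B / x.
Proof.
  intros HG Hg.
  assert (B0 : 0 <= B).
  { eapply Rle_trans; [|apply (Hg 0)]. rewrite pow_ne_zero by lia. lra. }
  assert (Inc : forall u v, 0 < u -> u <= v -> Rabs (G v - G u) <= B / u - B / v).
  { intros u v Hu Hv.
    assert (Hs : forall s, Rabs s = 1 -> s * G u + B / u >= s * G v + B / v).
    { intros s Hs.
      destruct (Req_dec u v) as [->|E]; [lra|].
      destruct (MVT_gen (fun x => s * G x + B / x) u v (fun x => s * g x - B / x ^ 2)) as [c [Hc E']].
      - intros x Hx. rewrite Rmin_left, Rmax_right in Hx by lra.
        apply (is_derive_plus (fun x => s * G x) (fun x => B / x) x (s * g x) (- (B / x ^ 2))).
        + apply (is_derive_scal G x s (g x)), HG.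
        + auto_derive; [lra|]. field. lra.
      - intros x Hx. rewrite Rmin_left, Rmax_right in Hx by lra.
        apply continuity_pt_filterlim.
        apply (continuous_plus (V := R_NormedModule) (fun x => s * G x) (fun x => B / x)).
        + apply (continuous_scal_r (V := R_NormedModule) s G).
          apply (ex_derive_continuous (V := R_NormedModule)). eexists; apply HG.
        + apply (ex_derive_continuous (V := R_NormedModule)). auto_derive. lra.
      - rewrite Rmin_left, Rmax_right in Hc by lra.
        assert (s * g c - B / c ^ 2 <= 0).
        { assert (0 < c ^ 2) by (apply pow_lt; lra).
          apply Rmult_le_reg_l with (c ^ 2); [assumption|].
          replace (c ^ 2 * (s * g c - B / c ^ 2)) with (c ^ 2 * (s * g c) - B) by (field; lra).
          specialize (Hg c).
          assert (s * g c <= Rabs (g c)).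
          { apply Rle_trans with (1 := Rle_abs _). rewrite Rabs_mult, Hs. lra. }
          nra. }
        nra. }
    pose proof (Hs 1 Rabs_R1). pose proof (Hs (-1) ltac:(rewrite Rabs_left; lra)).
    apply Rabs_le. lra. }
  assert (Tail : forall u v, 0 < u -> u <= v -> Rabs (G v - G u) <= B / u).
  { intros u v Hu Hv. specialize (Inc u v Hu Hv).
    assert (0 <= B / v) by (apply Rmult_le_pos; [lra | left; apply Rinv_0_lt_compat; lra]). lra. }
  destruct (proj1 (filterlim_locally_cauchy (F := Rbar_locally p_infty) (U := R_CompleteSpace) G)) as [L HL].
  - intros eps.
    exists (fun x => B / eps + 1 < x). split; [exists (B / eps + 1); auto|].
    assert (Sym : forall u v, B / eps + 1 < u -> u <= v -> Rabs (G v - G u) < eps).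
    { intros u v Hu Hv. pose proof (cond_pos eps).
      assert (0 <= B / eps) by (apply Rmult_le_pos; [lra | left; apply Rinv_0_lt_compat; lra]).
      eapply Rle_lt_trans; [apply Tail; lra|].
      apply Rmult_lt_reg_r with u; [lra|]. unfold Rdiv. rewrite Rmult_assoc, Rinv_l, Rmult_1_r by lra.
      apply Rlt_le_trans with (eps * (B / eps + 1)); [|apply Rmult_le_compat_l; lra].
      replace (eps * (B / eps + 1)) with (B + eps) by (field; lra). lra. }
    intros u v Hu Hv. change (Rabs (G v - G u) < eps).
    destruct (Rle_lt_dec u v); [apply Sym; auto|]. rewrite Rabs_minus_sym. apply Sym; auto; lra.
  - exists L. split; [exact HL|]. intros x Hx.
    apply Rnot_lt_le. intros F.
    assert (He : 0 < Rabs (L - G x) - B / x) by lra.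
    destruct (HL _ (locally_ball L (mkposreal _ He))) as [M HM].
    set (v := Rmax (M + 1) x).
    assert (Hv : ball L (Rabs (L - G x) - B / x) (G v)).
    { apply HM. pose proof (Rmax_l (M + 1) x). unfold v. lra. }
    change (Rabs (G v - L) < Rabs (L - G x) - B / x) in Hv.
    pose proof (Tail x v Hx (Rmax_r _ _)).
    pose proof (Rabs_triang (L - G v) (G v - G x)). replace (L - G v + (G v - G x)) with (L - G x) in * by ring.
    rewrite (Rabs_minus_sym L (G v)) in *. lra.
Qed.

Lemma filterlim_comp_opp (f : R -> R) (L : R) :
  filterlim (fun x => f (- x)) (Rbar_locally p_infty) (locally L) ->
  filterlim f (Rbar_locally m_infty) (locally L).
Proof.
  intros H P HP. destruct (H P HP) as [M HM]. exists (- M). intros x Hx.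
  rewrite <- (Ropp_involutive x). apply HM. lra.
Qed.

Lemma filterlim_comp_shift (f : R -> R) (t L : R) :
  (filterlim f (Rbar_locally p_infty) (locally L) ->
   filterlim (fun x => f (x + t)) (Rbar_locally p_infty) (locally L)) /\
  (filterlim f (Rbar_locally m_infty) (locally L) ->
   filterlim (fun x => f (x + t)) (Rbar_locally m_infty) (locally L)).
Proof.
  split; intros H P HP; destruct (H P HP) as [M HM]; exists (M - t); intros x Hx; apply HM; lra.
Qed.

(** The weight [1 + x ^ 2] makes integrals over the line and sums over lattices converge absolutely,
    and multiplication by a wave preserves the bound. *)
Definition decays (B : R) (f : R -> C) : Prop :=
  (forall x, continuous f x) /\ forall x, (1 + x ^ 2) * Cmod (f x) <= B.

Lemma decays_nonneg B f : decays B f -> 0 <= B.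
Proof.
  intros [_ H]. eapply Rle_trans; [|apply (H 0)]. apply Rmult_le_pos; [nra | apply Cmod_ge_0].
Qed.

Lemma decays_mult_unimodular B f g :
  (forall x, continuous g x) -> (forall x, Cmod (g x) = 1) -> decays B f ->
  decays B (fun x => (g x * f x)%C).
Proof.
  intros Hg H1 [Hf H]. split; [intros x; apply continuous_Cmult; auto|].
  intros x. rewrite Cmod_mult, H1, Rmult_1_l. apply H.
Qed.

Lemma continuous_Ccomb (c d : C) (f g : R -> C) (x : R) :
  continuous f x -> continuous g x -> continuous (fun u => (c * f u + d * g u)%C) x.
Proof.
  intros Hf Hg.
  apply (continuous_Cplus (fun u => (c * f u)%C) (fun u => (d * g u)%C));
    apply (continuous_Cmult (fun _ => _)); auto using continuous_const.
Qed.

Definition has_integral (f : R -> C) (l : C) : Prop :=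
  is_RInt_gen (V := C_R_NormedModule) f (Rbar_locally m_infty) (Rbar_locally p_infty) l.

Lemma has_integral_iff f l : has_integral f l <->
  is_RInt_gen (fun x => Re (f x)) (Rbar_locally m_infty) (Rbar_locally p_infty) (Re l) /\
  is_RInt_gen (fun x => Im (f x)) (Rbar_locally m_infty) (Rbar_locally p_infty) (Im l).
Proof.
  split.
  - intros H; split; intros P [eps HP].
    + assert (HQ : locally l (fun z : C => P (Re z))).
      { exists eps. intros z [Hz _]. apply HP, Hz. }
      specialize (H _ HQ). unfold filtermapi in *.
      apply filter_imp with (2 := H). intros ab [y [Hy Py]].
      exists (Re y). split; [|exact Py].
      apply (is_RInt_fct_extend_fst (U := R_NormedModule) (V := R_NormedModule) f _ _ y Hy).
    + assert (HQ : locally l (fun z : C => P (Im z))).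
      { exists eps. intros z [_ Hz]. apply HP, Hz. }
      specialize (H _ HQ). unfold filtermapi in *.
      apply filter_imp with (2 := H). intros ab [y [Hy Py]].
      exists (Im y). split; [|exact Py].
      apply (is_RInt_fct_extend_snd (U := R_NormedModule) (V := R_NormedModule) f _ _ y Hy).
  - intros [H1 H2] P [eps HP].
    specialize (H1 _ (locally_ball (Re l) eps)). specialize (H2 _ (locally_ball (Im l) eps)).
    unfold filtermapi in *.
    apply filter_imp with (2 := filter_and _ _ H1 H2).
    intros ab [[y [Hy Py]] [z [Hz Pz]]].
    exists (y, z). split.
    + apply (is_RInt_fct_extend_pair (U := R_NormedModule) (V := R_NormedModule) f); assumption.
    + apply HP. split; assumption.
Qed.

Lemma has_integral_unique f l : has_integral f l ->
  RInt_gen (V := C_R_CompleteNormedModule) f (Rbar_locally m_infty) (Rbar_locally p_infty) = l.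
Proof. intros H. exact (is_RInt_gen_unique (V := C_R_CompleteNormedModule) f l H). Qed.

Lemma has_integral_eq f l m : has_integral f l -> has_integral f m -> l = m.
Proof. intros H H'. rewrite <- (has_integral_unique f l H). apply has_integral_unique, H'. Qed.

Lemma has_integral_comb c d f g l m : has_integral f l -> has_integral g m ->
  has_integral (fun x => (c * f x + d * g x)%C) (c * l + d * m)%C.
Proof.
  rewrite !has_integral_iff. intros [F1 F2] [G1 G2].
  assert (S : forall (h : R -> R) (k v : R),
    is_RInt_gen h (Rbar_locally m_infty) (Rbar_locally p_infty) v ->
    is_RInt_gen (fun x => k * h x) (Rbar_locally m_infty) (Rbar_locally p_infty) (k * v)).
  { intros h k v H. apply (is_RInt_gen_scal (V := R_NormedModule) h k v H). }
  assert (P : forall (h h' : R -> R) (v v' : R),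
    is_RInt_gen h (Rbar_locally m_infty) (Rbar_locally p_infty) v ->
    is_RInt_gen h' (Rbar_locally m_infty) (Rbar_locally p_infty) v' ->
    is_RInt_gen (fun x => h x + h' x) (Rbar_locally m_infty) (Rbar_locally p_infty) (v + v')).
  { intros h h' v v' H H'. apply (is_RInt_gen_plus (V := R_NormedModule) h h' v v' H H'). }
  assert (M : forall (h h' : R -> R) (v v' : R),
    is_RInt_gen h (Rbar_locally m_infty) (Rbar_locally p_infty) v ->
    is_RInt_gen h' (Rbar_locally m_infty) (Rbar_locally p_infty) v' ->
    is_RInt_gen (fun x => h x - h' x) (Rbar_locally m_infty) (Rbar_locally p_infty) (v - v')).
  { intros h h' v v' H H'. apply (is_RInt_gen_minus (V := R_NormedModule) h h' v v' H H'). }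
  split.
  - apply (P (fun x => Re c * Re (f x) - Im c * Im (f x)) (fun x => Re d * Re (g x) - Im d * Im (g x)));
      apply M; apply S; assumption.
  - apply (P (fun x => Re c * Im (f x) + Im c * Re (f x)) (fun x => Re d * Im (g x) + Im d * Re (g x)));
      apply P; apply S; assumption.
Qed.

Lemma real_integral_primitive (G g : R -> R) (la lb : R) :
  (forall x, is_derive G x (g x)) -> (forall x, continuous g x) ->
  filterlim G (Rbar_locally m_infty) (locally la) ->
  filterlim G (Rbar_locally p_infty) (locally lb) ->
  is_RInt_gen g (Rbar_locally m_infty) (Rbar_locally p_infty) (lb - la).
Proof.
  intros HG Hg Ha Hb.
  replace g with (Derive G) in * by (apply functional_extensionality; intros x; apply is_derive_unique, HG).
  apply is_RInt_gen_Derive; auto.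
  - apply filter_forall. intros ab x _. eexists; apply HG.
  - apply filter_forall. intros ab x _. apply Hg.
Qed.

(** A single primitive yields the integrals of all translates and of the reflection, in place of a
    change of variables. The constant 4 is 1 for each tail beyond distance 1 and 2 for the interval
    [[-1, 1]]. *)
Lemma real_integral_exists (g : R -> R) (B : R) :
  (forall x, continuous g x) -> (forall x, (1 + x ^ 2) * Rabs (g x) <= B) ->
  exists I, Rabs I <= 4 * B /\ (forall t,
    is_RInt_gen (fun x => g (x + t)) (Rbar_locally m_infty) (Rbar_locally p_infty) I) /\
    is_RInt_gen (fun x => g (- x)) (Rbar_locally m_infty) (Rbar_locally p_infty) I.
Proof.
  intros Hc Hg.
  destruct (primitive_exists g Hc) as [G HG].
  assert (Hg2 : forall x, x ^ 2 * Rabs (g x) <= B).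
  { intros x. specialize (Hg x). pose proof (Rabs_pos (g x)). nra. }
  assert (Hg0 : forall x, Rabs (g x) <= B).
  { intros x. specialize (Hg x). pose proof (Rabs_pos (g x)). nra. }
  destruct (primitive_limit G g B HG Hg2) as [lb [Hb Bb]].
  assert (Hr : forall x, is_derive (fun x => - G (- x)) x (g (- x))).
  { intros x. specialize (HG (- x)).
    replace (g (- x)) with (- ((-1) * g (- x))) by ring.
    apply (is_derive_opp (fun x => G (- x))).
    apply (is_derive_comp G (fun x => - x)); [exact HG|]. auto_derive; auto. }
  destruct (primitive_limit (fun x => - G (- x)) (fun x => g (- x)) B Hr) as [la [Ha Ba]].
  { intros x. replace (x ^ 2) with ((- x) ^ 2) by ring. apply Hg2. }
  assert (Ha' : filterlim G (Rbar_locally m_infty) (locally (- la))).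
  { apply filterlim_comp_opp.
    apply (filterlim_ext (fun x => - - G (- x))); [intros; ring|].
    apply (filterlim_comp _ _ _ (fun x => - G (- x)) Ropp _ _ _ Ha).
    apply (filterlim_opp (V := R_NormedModule) la). }
  exists (lb - - la). split; [|split].
  - specialize (Bb 1 Rlt_0_1). specialize (Ba 1 Rlt_0_1). replace (- (1)) with (-1) in Ba by lra.
    destruct (MVT_gen G (-1) 1 g) as [c [Hc1 Hc2]].
    + intros; apply HG.
    + intros x _. apply continuity_pt_filterlim.
      apply (ex_derive_continuous (V := R_NormedModule)). eexists; apply HG.
    + specialize (Hg0 c).
      replace (lb - - la) with ((lb - G 1) + (la - - G (-1)) + (G 1 - G (-1))) by ring.
      rewrite Hc2. replace (g c * (1 - -1)) with (2 * g c) by ring.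
      eapply Rle_trans; [apply Rabs_triang|].
      pose proof (Rabs_triang (lb - G 1) (la - - G (-1))).
      rewrite (Rabs_mult 2), (Rabs_right 2) by lra. lra.
  - intros t. apply real_integral_primitive with (fun x => G (x + t)).
    + intros x. replace (g (x + t)) with (1 * g (x + t)) by ring.
      apply (is_derive_comp G (fun x => x + t)); [apply HG|]. auto_derive; auto.
    + intros x. apply (continuous_comp (fun x => x + t) g); [|apply Hc].
      apply (ex_derive_continuous (V := R_NormedModule)). auto_derive; auto.
    + apply filterlim_comp_shift, Ha'.
    + apply filterlim_comp_shift, Hb.
  - replace (lb - - la) with (la - - lb) by ring.
    apply real_integral_primitive with (fun x => - G (- x)); [exact Hr | | | exact Ha].
    + intros x. apply (continuous_comp (fun x => - x) g); [|apply Hc].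
      apply (ex_derive_continuous (V := R_NormedModule)). auto_derive; auto.
    + apply filterlim_comp_opp.
      apply (filterlim_ext (fun x => - G x)); [intros; rewrite Ropp_involutive; reflexivity|].
      apply (filterlim_comp _ _ _ G Ropp _ _ _ Hb).
      apply (filterlim_opp (V := R_NormedModule) lb).
Qed.

Lemma has_integral_exists f B : decays B f ->
  exists l, Cmod l <= 8 * B /\ (forall t, has_integral (fun x => f (x + t)) l) /\
    has_integral (fun x => f (- x)) l.
Proof.
  intros [Hc Hf].
  destruct (real_integral_exists (fun x => Re (f x)) B) as [I1 [B1 [H1 R1]]].
  - intros x. apply (proj1 (continuous_C f x)), Hc.
  - intros x. eapply Rle_trans; [|apply Hf]. apply Rmult_le_compat_l; [nra | apply Rabs_Re_le].
  - destruct (real_integral_exists (fun x => Im (f x)) B) as [I2 [B2 [H2 R2]]].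
    + intros x. apply (proj1 (continuous_C f x)), Hc.
    + intros x. eapply Rle_trans; [|apply Hf]. apply Rmult_le_compat_l; [nra | apply Rabs_Im_le].
    + exists (I1, I2). split; [|split].
      * eapply Rle_trans; [apply Cmod_le_Re_Im|]. simpl. lra.
      * intros t. apply has_integral_iff. split; simpl; auto.
      * apply has_integral_iff. split; simpl; auto.
Qed.

Definition wave (k x : R) : C := cis (- (2 * PI * k * x)).

Lemma wave_affine k x : wave k x = cis (- (2 * PI * k) * x + 0).
Proof. unfold wave. f_equal. ring. Qed.

Lemma continuous_wave k x : continuous (wave k) x.
Proof.
  apply (continuous_ext (fun x => cis (- (2 * PI * k) * x + 0))).
  - intros; symmetry; apply wave_affine.
  - apply continuous_cis.
Qed.

Lemma decays_wave B k f : decays B f -> decays B (fun x => (wave k x * f x)%C).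
Proof.
  apply decays_mult_unimodular; [apply continuous_wave | intros; apply Cmod_cis].
Qed.

Lemma fourier_integral B f k : decays B f -> has_integral (fun x => (wave k x * f x)%C) (fourier f k).
Proof.
  intros H. destruct (has_integral_exists _ _ (decays_wave B k f H)) as [l [_ [Hl _]]].
  specialize (Hl 0).
  replace (fun x => (wave k (x + 0) * f (x + 0)%R)%C) with (fun x => (wave k x * f x)%C) in Hl
    by (apply functional_extensionality; intros; rewrite Rplus_0_r; reflexivity).
  unfold fourier. fold (wave k). erewrite has_integral_unique; exact Hl.
Qed.

Lemma fourier_unique f k l : has_integral (fun x => (wave k x * f x)%C) l -> fourier f k = l.
Proof. apply has_integral_unique. Qed.

Lemma fourier_bound B f k : decays B f -> Cmod (fourier f k) <= 8 * B.
Proof.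
  intros H. destruct (has_integral_exists _ _ (decays_wave B k f H)) as [l [Bl [Hl _]]].
  specialize (Hl 0).
  replace (fun x => (wave k (x + 0) * f (x + 0)%R)%C) with (fun x => (wave k x * f x)%C) in Hl
    by (apply functional_extensionality; intros; rewrite Rplus_0_r; reflexivity).
  rewrite (fourier_unique f k l Hl). exact Bl.
Qed.

Lemma fourier_comb B B' c d f g k : decays B f -> decays B' g ->
  fourier (fun x => (c * f x + d * g x)%C) k = (c * fourier f k + d * fourier g k)%C.
Proof.
  intros Hf Hg. apply fourier_unique.
  replace (fun x => (wave k x * (c * f x + d * g x))%C) with
    (fun x => (c * (wave k x * f x) + d * (wave k x * g x))%C)
    by (apply functional_extensionality; intros; ring).
  apply has_integral_comb; eapply fourier_integral; eassumption.
Qed.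

Lemma fourier_shift f k a : fourier f (k - a) = fourier (fun x => (cis (2 * PI * a * x) * f x)%C) k.
Proof.
  unfold fourier. f_equal. apply functional_extensionality. intros x.
  rewrite Cmult_assoc, <- cis_plus. do 2 f_equal. ring.
Qed.

Lemma fourier_modulate B f k b : decays B f ->
  (cis (2 * PI * b * k) * fourier f k)%C = fourier (fun x => f (x + b)) k.
Proof.
  intros H. symmetry. apply fourier_unique.
  destruct (has_integral_exists _ _ (decays_wave B k f H)) as [l [_ [Hl _]]].
  pose proof (Hl 0) as H0.
  replace (fun x => (wave k (x + 0) * f (x + 0)%R)%C) with (fun x => (wave k x * f x)%C) in H0
    by (apply functional_extensionality; intros; rewrite Rplus_0_r; reflexivity).
  rewrite (fourier_unique f k l H0).
  replace (fun x => (wave k x * f (x + b)%R)%C) with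
    (fun x => (cis (2 * PI * b * k) * (wave k (x + b) * f (x + b)%R) + 0 * (wave k (x + b) * f (x + b)%R))%C).
  - replace (cis (2 * PI * b * k) * l)%C with (cis (2 * PI * b * k) * l + 0 * l)%C by ring.
    apply has_integral_comb; apply Hl.
  - apply functional_extensionality. intros x. rewrite Cmult_assoc. unfold wave. rewrite <- cis_plus.
    replace (2 * PI * b * k + - (2 * PI * k * (x + b))) with (- (2 * PI * k * x)) by ring. ring.
Qed.

Lemma fourier_reflect B f k : decays B f -> fourier (fun x => f (- x)) k = fourier f (- k).
Proof.
  intros H. apply fourier_unique.
  destruct (has_integral_exists _ _ (decays_wave B (- k) f H)) as [l [_ [Ht Hl]]]. specialize (Ht 0).
  replace (fun x => (wave (- k) (x + 0) * f (x + 0)%R)%C) with (fun x => (wave (- k) x * f x)%C) in Ht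
    by (apply functional_extensionality; intros; rewrite Rplus_0_r; reflexivity).
  rewrite (fourier_unique f (- k) l Ht).
  replace (fun x => (wave k x * f (- x)%R)%C) with (fun x => (wave (- k) (- x) * f (- x)%R)%C); [exact Hl|].
  apply functional_extensionality. intros x. unfold wave. do 3 f_equal. ring.
Qed.

Lemma is_derive_quadratic (g : R -> R) (x l K : R) :
  (forall h, Rabs (g (x + h) - g x - h * l) <= K * h ^ 2) -> is_derive g x l.
Proof.
  intros H. apply is_derive_Reals. intros eps Heps.
  assert (K0 : 0 < Rabs K + 1) by (pose proof (Rabs_pos K); lra).
  assert (Hd : 0 < eps / (Rabs K + 1)) by (apply Rdiv_lt_0_compat; lra).
  exists (mkposreal _ Hd). intros h Hh Hlt. simpl in Hlt.
  replace ((g (x + h) - g x) / h - l) with ((g (x + h) - g x - h * l) / h) by (field; exact Hh).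
  unfold Rdiv. rewrite Rabs_mult, Rabs_inv.
  assert (P : 0 < Rabs h) by (apply Rabs_pos_lt, Hh).
  apply Rmult_lt_reg_r with (Rabs h); [exact P|].
  rewrite Rmult_assoc, Rinv_l, Rmult_1_r by lra.
  eapply Rle_lt_trans; [apply H|].
  rewrite <- (pow2_abs h). simpl.
  assert (Rabs h * (Rabs K + 1) < eps).
  { apply Rmult_lt_compat_r with (r := Rabs K + 1) in Hlt; [|lra].
    unfold Rdiv in Hlt. rewrite Rmult_assoc, Rinv_l in Hlt; lra. }
  pose proof (Rle_abs K). nra.
Qed.

Lemma sin_le_abs u : Rabs (sin u) <= Rabs u.
Proof.
  destruct (MVT_gen sin 0 u cos) as [c [_ E]].
  - intros; apply is_derive_Reals, derivable_pt_lim_sin.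
  - intros; apply continuity_sin.
  - rewrite sin_0, !Rminus_0_r in E. rewrite E, Rabs_mult.
    rewrite <- (Rmult_1_l (Rabs u)) at 2. apply Rmult_le_compat_r; [apply Rabs_pos|].
    apply Rabs_le, COS_bound.
Qed.

Lemma cos_quadratic u : Rabs (cos u - 1) <= u ^ 2.
Proof.
  replace (cos u) with (1 - 2 * sin (u / 2) * sin (u / 2)).
  - pose proof (sin_le_abs (u / 2)) as S.
    assert (E : sin (u / 2) ^ 2 <= (u / 2) ^ 2).
    { rewrite <- (pow2_abs (sin (u / 2))), <- (pow2_abs (u / 2)).
      apply pow_incr. split; [apply Rabs_pos | exact S]. }
    replace (1 - 2 * sin (u / 2) * sin (u / 2) - 1) with (- (2 * sin (u / 2) ^ 2)) by ring.
    rewrite Rabs_Ropp, Rabs_right; nra.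
  - replace (cos u) with (cos (2 * (u / 2))) by (f_equal; field).
    rewrite cos_2a_sin. ring.
Qed.

Lemma sin_quadratic u : Rabs (sin u - u) <= u ^ 2.
Proof.
  destruct (MVT_gen (fun x => sin x - x) 0 u (fun x => cos x - 1)) as [c [Hc E]].
  - intros x _. auto_derive; auto. ring.
  - intros x _. apply continuity_pt_filterlim.
    apply (ex_derive_continuous (V := R_NormedModule) (fun x => sin x - x)). auto_derive; auto.
  - rewrite sin_0, !Rminus_0_r in E. rewrite E, Rabs_mult, <- (pow2_abs u). simpl. rewrite Rmult_1_r.
    apply Rmult_le_compat_r; [apply Rabs_pos|].
    destruct (MVT_gen cos 0 c (fun x => - sin x)) as [d [Hd E']].
    + intros; apply is_derive_Reals, derivable_pt_lim_cos.
    + intros; apply continuity_cos.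
    + rewrite cos_0, Rminus_0_r in E'. rewrite E', Rabs_mult, Rabs_Ropp.
      apply Rle_trans with (1 * Rabs c).
      * apply Rmult_le_compat_r; [apply Rabs_pos | apply Rabs_le, SIN_bound].
      * rewrite Rmult_1_l. unfold Rmin, Rmax in Hc.
        destruct (Rle_dec 0 u); [rewrite !Rabs_right by lra | rewrite !Rabs_left1 by lra]; lra.
Qed.

Lemma cis_quadratic u : Cmod (cis u - 1 - RtoC u * Ci)%C <= 2 * u ^ 2.
Proof.
  eapply Rle_trans; [apply Cmod_le_Re_Im|].
  replace (Re (cis u - 1 - RtoC u * Ci)%C) with (cos u - 1) by (unfold cis; simpl; ring).
  replace (Im (cis u - 1 - RtoC u * Ci)%C) with (sin u - u) by (unfold cis; simpl; ring).
  pose proof (cos_quadratic u). pose proof (sin_quadratic u). lra.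
Qed.

Lemma cis_linear u : Cmod (cis u - 1)%C <= 2 * Rabs u.
Proof.
  eapply Rle_trans; [apply Cmod_le_Re_Im|].
  replace (Re (cis u - 1)%C) with (cos u - 1) by (unfold cis; simpl; ring).
  replace (Im (cis u - 1)%C) with (sin u) by (unfold cis; simpl; ring).
  assert (Rabs (cos u - 1) <= Rabs u).
  { destruct (MVT_gen cos 0 u (fun x => - sin x)) as [d [Hd E']].
    - intros; apply is_derive_Reals, derivable_pt_lim_cos.
    - intros; apply continuity_cos.
    - rewrite cos_0, Rminus_0_r in E'. rewrite E', Rabs_mult, Rabs_Ropp.
      rewrite <- (Rmult_1_l (Rabs u)) at 2.
      apply Rmult_le_compat_r; [apply Rabs_pos | apply Rabs_le, SIN_bound]. }
  pose proof (sin_le_abs u). lra.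
Qed.

(** The function [- 2 pi i x f(x)], whose transform is the derivative of the transform of [f]. *)
Definition freq_mult (f : R -> C) (x : R) : C := (RtoC (- (2 * PI)) * Ci * (RtoC x * f x))%C.

(** Differentiation under the integral with an explicit error: the remainder has the integrand
    [(cis v - 1 - i v) f] with [v = - 2 pi h x], up to a unimodular factor. It is quadratic in
    [h x], and the factor [x ^ 2] is paid for by [B2]. *)
Lemma fourier_derive B B1 B2 f k :
  decays B f -> decays B1 (freq_mult f) -> (forall x, (1 + x ^ 2) * (x ^ 2 * Cmod (f x)) <= B2) ->
  is_Cderive (fourier f) k (fourier (freq_mult f) k).
Proof.
  intros H H1 H2.
  assert (Q : forall h, Cmod (fourier f (k + h) - fourier f k - RtoC h * fourier (freq_mult f) k)%C
    <= (8 * (2 * (2 * PI) ^ 2 * B2)) * h ^ 2).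
  { intros h.
    set (g := fun x => (1 * (1 * (wave (k + h) x * f x) + RtoC (-1) * (wave k x * f x)) + RtoC (- h) * (wave k x * freq_mult f x))%C).
    assert (Hg : has_integral g (1 * (1 * fourier f (k + h) + RtoC (-1) * fourier f k) + RtoC (- h) * fourier (freq_mult f) k)%C).
    { apply has_integral_comb; [apply has_integral_comb|]; eapply fourier_integral; eassumption. }
    assert (Dg : decays (2 * (2 * PI) ^ 2 * B2 * h ^ 2) g).
    { split.
      - intros x.
        apply (continuous_Ccomb 1 (RtoC (- h)) (fun x => (1 * (wave (k + h) x * f x) + RtoC (-1) * (wave k x * f x))%C)
          (fun x => (wave k x * freq_mult f x)%C)).
        + apply (continuous_Ccomb 1 (RtoC (-1)) (fun x => (wave (k + h) x * f x)%C) (fun x => (wave k x * f x)%C)).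
          * apply (proj1 (decays_wave B (k + h) f H)).
          * apply (proj1 (decays_wave B k f H)).
        + apply (proj1 (decays_wave B1 k _ H1)).
      - intros x.
        set (v := - (2 * PI * h * x)).
        assert (E : g x = (wave k x * ((cis v - 1 - RtoC v * Ci) * f x))%C).
        { unfold g, freq_mult. replace (wave (k + h) x) with (wave k x * cis v)%C.
          - unfold v. rewrite !RtoC_opp, !RtoC_mult. ring.
          - unfold wave, v. rewrite <- cis_plus. f_equal. ring. }
        rewrite E, !Cmod_mult. unfold wave at 1. rewrite Cmod_cis, Rmult_1_l.
        pose proof (cis_quadratic v) as Qv. specialize (H2 x).
        replace (v ^ 2) with ((2 * PI) ^ 2 * h ^ 2 * x ^ 2) in Qv by (unfold v; ring).
        pose proof (Cmod_ge_0 (f x)). assert (0 <= 1 + x ^ 2) by nra.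
        assert (0 <= 2 * ((2 * PI) ^ 2 * h ^ 2)) by nra.
        apply Rle_trans with ((1 + x ^ 2) * (2 * ((2 * PI) ^ 2 * h ^ 2 * x ^ 2) * Cmod (f x))).
        + apply Rmult_le_compat_l; [assumption|]. apply Rmult_le_compat_r; assumption.
        + replace ((1 + x ^ 2) * (2 * ((2 * PI) ^ 2 * h ^ 2 * x ^ 2) * Cmod (f x))) with
            (2 * ((2 * PI) ^ 2 * h ^ 2) * ((1 + x ^ 2) * (x ^ 2 * Cmod (f x)))) by ring.
          replace (2 * (2 * PI) ^ 2 * B2 * h ^ 2) with (2 * ((2 * PI) ^ 2 * h ^ 2) * B2) by ring.
          apply Rmult_le_compat_l; assumption. }
    destruct (has_integral_exists _ _ Dg) as [l [Bl [Hl _]]]. specialize (Hl 0).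
    replace (fun x => g (x + 0)) with g in Hl
      by (apply functional_extensionality; intros; rewrite Rplus_0_r; reflexivity).
    pose proof (has_integral_eq _ _ _ Hg Hl) as E.
    replace (fourier f (k + h) - fourier f k - RtoC h * fourier (freq_mult f) k)%C with l
      by (rewrite <- E, RtoC_opp; ring).
    lra. }
  split.
  - apply is_derive_quadratic with (8 * (2 * (2 * PI) ^ 2 * B2)). intros h.
    eapply Rle_trans; [|apply Q]. eapply Rle_trans; [|apply Rabs_Re_le].
    right. f_equal. simpl. unfold Re. ring.
  - apply is_derive_quadratic with (8 * (2 * (2 * PI) ^ 2 * B2)). intros h.
    eapply Rle_trans; [|apply Q]. eapply Rle_trans; [|apply Rabs_Im_le].
    right. f_equal. simpl. unfold Im. ring.
Qed.

Lemma decays_limits B f : decays B f ->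
  filterlim (fun x => Re (f x)) (Rbar_locally m_infty) (locally 0) /\
  filterlim (fun x => Re (f x)) (Rbar_locally p_infty) (locally 0) /\
  filterlim (fun x => Im (f x)) (Rbar_locally m_infty) (locally 0) /\
  filterlim (fun x => Im (f x)) (Rbar_locally p_infty) (locally 0).
Proof.
  intros H. pose proof (decays_nonneg B f H) as B0. destruct H as [_ H].
  assert (E : forall eps : posreal, forall x, B / eps + 1 < Rabs x -> Cmod (f x) < eps).
  { intros eps x Hx. specialize (H x). pose proof (cond_pos eps).
    assert (0 <= B / eps) by (apply Rmult_le_pos; [lra | left; apply Rinv_0_lt_compat; lra]).
    apply Rnot_le_lt. intros F.
    assert (X : Rabs x <= 1 + x ^ 2) by (rewrite <- (pow2_abs x); nra).
    assert (eps * (B / eps + 1) = B + eps) by (field; lra).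
    assert (eps * (B / eps + 1) < eps * Rabs x) by (apply Rmult_lt_compat_l; lra).
    assert (eps * Rabs x <= (1 + x ^ 2) * Cmod (f x)) by (rewrite (Rmult_comm eps); apply Rmult_le_compat; lra || apply Rabs_pos).
    lra. }
  repeat split; apply filterlim_locally; intros eps.
  - exists (- (B / eps + 1)). intros x Hx. change (Rabs (Re (f x) - 0) < eps). rewrite Rminus_0_r.
    eapply Rle_lt_trans; [apply Rabs_Re_le | apply E]. rewrite Rabs_left1; [lra|].
    assert (0 <= B / eps) by (apply Rmult_le_pos; [lra | left; apply Rinv_0_lt_compat, cond_pos]). lra.
  - exists (B / eps + 1). intros x Hx. change (Rabs (Re (f x) - 0) < eps). rewrite Rminus_0_r.
    eapply Rle_lt_trans; [apply Rabs_Re_le | apply E]. eapply Rlt_le_trans; [exact Hx | apply Rle_abs].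
  - exists (- (B / eps + 1)). intros x Hx. change (Rabs (Im (f x) - 0) < eps). rewrite Rminus_0_r.
    eapply Rle_lt_trans; [apply Rabs_Im_le | apply E]. rewrite Rabs_left1; [lra|].
    assert (0 <= B / eps) by (apply Rmult_le_pos; [lra | left; apply Rinv_0_lt_compat, cond_pos]). lra.
  - exists (B / eps + 1). intros x Hx. change (Rabs (Im (f x) - 0) < eps). rewrite Rminus_0_r.
    eapply Rle_lt_trans; [apply Rabs_Im_le | apply E]. eapply Rlt_le_trans; [exact Hx | apply Rle_abs].
Qed.

(** Integration by parts: [g] is the derivative of [wave k * f], which tends to 0 at both ends, so
    the integral of [g] is 0. *)
Lemma fourier_of_derivative B B' f k : smooth f -> decays B f -> decays B' (CD f) ->
  fourier (CD f) k = (RtoC (2 * PI * k) * Ci * fourier f k)%C.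
Proof.
  intros Sf H H'.
  set (g := fun x => (RtoC (- (2 * PI * k)) * Ci * (wave k x * f x) + 1 * (wave k x * CD f x))%C).
  assert (Hg : has_integral g (RtoC (- (2 * PI * k)) * Ci * fourier f k + 1 * fourier (CD f) k)%C).
  { apply has_integral_comb; eapply fourier_integral; eassumption. }
  assert (Hd : forall x, is_Cderive (fun x => (wave k x * f x)%C) x (g x)).
  { intros x. unfold g.
    replace (RtoC (- (2 * PI * k)) * Ci * (wave k x * f x) + 1 * (wave k x * CD f x))%C with
      (RtoC (- (2 * PI * k)) * Ci * wave k x * f x + wave k x * CD f x)%C by ring.
    apply (is_Cderive_mult (wave k) f); [|apply smooth_derive, Sf].
    rewrite wave_affine. apply (is_Cderive_ext (fun x => cis (- (2 * PI * k) * x + 0))).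
    - intros u; symmetry; apply wave_affine.
    - apply is_Cderive_cis. }
  assert (Hgc : forall x, continuous g x).
  { intros x.
    apply (continuous_Ccomb _ 1 (fun x => (wave k x * f x)%C) (fun x => (wave k x * CD f x)%C)).
    - apply (proj1 (decays_wave B k f H)).
    - apply (proj1 (decays_wave B' k _ H')). }
  destruct (decays_limits _ _ (decays_wave B k f H)) as [L1 [L2 [L3 L4]]].
  assert (Z : has_integral g 0).
  { apply has_integral_iff. split.
    - replace (Re 0) with (0 - 0) by (simpl; ring).
      apply (real_integral_primitive (fun x => Re (wave k x * f x)%C)); auto.
      + intros x; apply Hd.
      + intros x; apply (proj1 (continuous_C g x)), Hgc.
    - replace (Im 0) with (0 - 0) by (simpl; ring).
      apply (real_integral_primitive (fun x => Im (wave k x * f x)%C)); auto.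
      + intros x; apply Hd.
      + intros x; apply (proj1 (continuous_C g x)), Hgc. }
  pose proof (has_integral_eq _ _ _ Hg Z) as E. rewrite RtoC_opp in E.
  replace (fourier (CD f) k) with
    ((- RtoC (2 * PI * k) * Ci * fourier f k + 1 * fourier (CD f) k) + RtoC (2 * PI * k) * Ci * fourier f k)%C by ring.
  rewrite E. ring.
Qed.

Lemma schwartz_bound_decays N B f : (2 <= N)%nat -> smooth f -> schwartz_bound N B f -> decays (2 * B) f.
Proof.
  intros HN Sf H. split; [intros x; apply smooth_continuous, Sf|].
  intros x. pose proof (H 0%nat 0%nat x ltac:(lia) ltac:(lia)) as H0.
  pose proof (H 2%nat 0%nat x ltac:(lia) ltac:(lia)) as H2.
  rewrite CDerive_n_0 in *. rewrite pow2_abs in H2. simpl in *. lra.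
Qed.

Lemma schwartz_decays f : schwartz f -> exists B, decays B f.
Proof.
  intros [Sf H]. destruct (H 2%nat) as [B HB]. exists (2 * B).
  apply schwartz_bound_decays with 2%nat; auto.
Qed.

Lemma schwartz_freq_mult f : schwartz f -> schwartz (freq_mult f).
Proof.
  intros H. apply (schwartz_scal _ (fun x => (RtoC x * f x)%C)). apply schwartz_mult; [apply multiplier_id | exact H].
Qed.

Lemma freq_mult_bound N : exists K, 0 <= K /\ forall f B, smooth f -> schwartz_bound (S N) B f ->
  schwartz_bound N (K * B) (freq_mult f).
Proof.
  exists (2 * PI * (2 ^ N * 2)). pose proof PI_RGT_0. assert (0 < 2 ^ N) by (apply pow_lt; lra).
  split; [nra|]. intros f B Sf Hf i j x Hi Hj.
  pose proof (schwartz_bound_mult_linear RtoC f N 1 B smooth_id Sf ltac:(lra)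
    (fun j x _ => id_derivatives j x) Hf i j x Hi Hj) as E.
  unfold freq_mult. rewrite (CDerive_n_scal _ (fun x => (RtoC x * f x)%C)) by (apply smooth_mult; auto using smooth_id).
  rewrite !Cmod_mult, Cmod_Ci, Cmod_RtoC, Rmult_1_r, Rabs_Ropp, (Rabs_right (2 * PI)) by lra.
  replace (2 * PI * (2 ^ N * 2) * B) with (2 * PI * (2 ^ N * (2 * 1 * B))) by ring.
  replace (Rabs x ^ i * (2 * PI * Cmod (CDerive_n (fun x0 => (RtoC x0 * f x0)%C) j x))) with
    (2 * PI * (Rabs x ^ i * Cmod (CDerive_n (fun x0 => (RtoC x0 * f x0)%C) j x))) by ring.
  apply Rmult_le_compat_l; [lra | exact E].
Qed.

Lemma fourier_schwartz_derive f k : schwartz f -> is_Cderive (fourier f) k (fourier (freq_mult f) k).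
Proof.
  intros H. destruct (schwartz_decays f H) as [B HB].
  destruct (schwartz_decays _ (schwartz_freq_mult f H)) as [B1 HB1].
  destruct (proj2 H 4%nat) as [B2 HB2].
  apply fourier_derive with B B1 (2 * B2); auto.
  intros x. pose proof (HB2 2%nat 0%nat x ltac:(lia) ltac:(lia)) as E2.
  pose proof (HB2 4%nat 0%nat x ltac:(lia) ltac:(lia)) as E4.
  rewrite CDerive_n_0 in *. replace (Rabs x ^ 4) with ((Rabs x ^ 2) ^ 2) in E4 by ring.
  rewrite pow2_abs in *. nra.
Qed.

Lemma fourier_smooth f : schwartz f -> smooth (fourier f).
Proof.
  intros H. apply (smooth_coind (fun F => exists f, schwartz f /\ F = fourier f)); [|eauto].
  clear. intros F [f [H ->]].
  assert (E : CD (fourier f) = fourier (freq_mult f)) by (apply CD_eq; intros; apply fourier_schwartz_derive, H).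
  split.
  - intros x. rewrite E. apply fourier_schwartz_derive, H.
  - rewrite E. eauto using schwartz_freq_mult.
Qed.

(** A factor [|x|] is traded for a derivative of [f], and the resulting [2 pi] is simply dropped as
    it exceeds 1. The constant 16 combines the 8 of the integral bound with the 2 from passing to
    quadratic decay. *)
Lemma fourier_weight_bound (i : nat) f B x : schwartz f -> schwartz_bound (2 + i) B f ->
  Rabs x ^ i * Cmod (fourier f x) <= 16 * B.
Proof.
  revert f. induction i as [|i IH]; intros f Sf Hf.
  - simpl. rewrite Rmult_1_l.
    pose proof (fourier_bound _ f x (schwartz_bound_decays _ _ _ ltac:(auto) (proj1 Sf) Hf)). lra.
  - pose proof (IH (CD f) (schwartz_CD f Sf) (schwartz_bound_CD _ _ _ Hf)) as E.
    destruct (schwartz_decays f Sf) as [B1 D1]. destruct (schwartz_decays _ (schwartz_CD f Sf)) as [B2 D2].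
    rewrite (fourier_of_derivative _ _ _ _ (proj1 Sf) D1 D2), !Cmod_mult, Cmod_Ci, Cmod_RtoC, Rmult_1_r in E.
    rewrite !Rabs_mult, (Rabs_right 2), (Rabs_right PI) in E by (pose proof PI_RGT_0; lra).
    eapply Rle_trans; [|exact E]. simpl.
    assert (0 <= Rabs x ^ i * (Rabs x * Cmod (fourier f x))).
    { apply Rmult_le_pos; [apply pow_le, Rabs_pos|]. apply Rmult_le_pos; [apply Rabs_pos | apply Cmod_ge_0]. }
    assert (1 <= 2 * PI) by (pose proof PI2_1; lra).
    replace (Rabs x * Rabs x ^ i * Cmod (fourier f x)) with (1 * (Rabs x ^ i * (Rabs x * Cmod (fourier f x)))) by ring.
    replace (Rabs x ^ i * (2 * PI * Rabs x * Cmod (fourier f x))) with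
      (2 * PI * (Rabs x ^ i * (Rabs x * Cmod (fourier f x)))) by ring.
    apply Rmult_le_compat_r; assumption.
Qed.

Lemma fourier_derivative_bound (i j : nat) : exists K, 0 <= K /\
  forall f B x, schwartz f -> schwartz_bound (2 + i + j) B f ->
    Rabs x ^ i * Cmod (CDerive_n (fourier f) j x) <= K * B.
Proof.
  induction j as [|j [K [K0 IH]]].
  - exists 16. split; [lra|]. intros f B x Sf Hf. rewrite CDerive_n_0.
    apply fourier_weight_bound; [exact Sf|]. rewrite Nat.add_0_r in Hf. exact Hf.
  - destruct (freq_mult_bound (2 + i + j)) as [K' [K0' H']].
    exists (K * K'). split; [nra|]. intros f B x Sf Hf.
    rewrite CDerive_n_S, (CD_eq (fourier f) (fourier (freq_mult f)))
      by (intros; apply fourier_schwartz_derive, Sf).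
    rewrite Rmult_assoc. apply IH; [apply schwartz_freq_mult, Sf|].
    apply H'; [apply Sf|]. replace (S (2 + i + j)) with (2 + i + S j)%nat by lia. exact Hf.
Qed.

Lemma fourier_schwartz_bound (N : nat) : exists (M : nat) (K : R), 0 <= K /\
  forall f B, schwartz f -> schwartz_bound M B f -> schwartz_bound N (K * B) (fourier f).
Proof.
  exists (2 + N + N)%nat.
  destruct (finite_uniform_bound (fun i K => 0 <= K /\ forall j, (j <= N)%nat ->
    forall f B x, schwartz f -> schwartz_bound (2 + i + j) B f ->
      Rabs x ^ i * Cmod (CDerive_n (fourier f) j x) <= K * B) N) as [K HK].
  - intros i K K' [K0 H] L. split; [lra|]. intros j Hj f B x Sf Hf.
    eapply Rle_trans; [apply H; eauto|]. apply Rmult_le_compat_r; [|exact L].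
    eapply schwartz_bound_nonneg; eassumption.
  - intros i.
    destruct (finite_uniform_bound (fun j K => 0 <= K /\ forall f B x, schwartz f -> schwartz_bound (2 + i + j) B f ->
      Rabs x ^ i * Cmod (CDerive_n (fourier f) j x) <= K * B) N) as [K HK].
    + intros j K K' [K0 H] L. split; [lra|]. intros f B x Sf Hf.
      eapply Rle_trans; [apply H; eauto|]. apply Rmult_le_compat_r; [|exact L].
      eapply schwartz_bound_nonneg; eassumption.
    + intros j. apply fourier_derivative_bound.
    + exists K. split; [apply (HK 0%nat); lia|]. intros j Hj. apply HK, Hj.
  - exists K. split; [apply (HK 0%nat); lia|].
    intros f B Sf Hf i j x Hi Hj. apply (proj2 (HK i Hi) j Hj); [exact Sf|].
    apply schwartz_bound_mono with (3 := Hf); [lia | lra].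
Qed.

Lemma fourier_schwartz f : schwartz f -> schwartz (fourier f).
Proof.
  intros H. split; [apply fourier_smooth, H|].
  intros N. destruct (fourier_schwartz_bound N) as [M [K [_ HK]]].
  destruct (proj2 H M) as [B HB]. exists (K * B). apply HK; assumption.
Qed.

(** * Density of test functions *)

Lemma smooth_Re f : smooth f -> smooth (fun x => RtoC (Re (f x))).
Proof.
  intros H n x. split; [exact (proj1 (H n x))|].
  exact (proj1 (smooth_const 0 n x)).
Qed.

Lemma smooth_Im f : smooth f -> smooth (fun x => RtoC (Im (f x))).
Proof.
  intros H n x. split; [exact (proj2 (H n x))|].
  exact (proj1 (smooth_const 0 n x)).
Qed.

(** The squared modulus: unlike the modulus it stays smooth at the zeros of [f]. *)
Definition sqmod (f : R -> C) (x : R) : R := Re (f x) * Re (f x) + Im (f x) * Im (f x).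

Lemma sqmod_nonneg f x : 0 <= sqmod f x.
Proof. unfold sqmod. nra. Qed.

Lemma sqmod_pos (f : R -> C) (x : R) : f x <> 0 -> 0 < sqmod f x.
Proof.
  intros H. destruct (Rle_lt_or_eq_dec _ _ (sqmod_nonneg f x)) as [L|E]; [exact L|].
  exfalso. apply H. unfold sqmod in E. apply C_ext; simpl; nra.
Qed.

Lemma sqmod_Cc_infty f : Cc_infty f -> Cc_infty (fun x => RtoC (sqmod f x)).
Proof.
  intros [Sf [A HA]].
  replace (fun x => RtoC (sqmod f x)) with
    (fun x => (RtoC (Re (f x)) * RtoC (Re (f x)) + RtoC (Im (f x)) * RtoC (Im (f x)))%C)
    by (apply functional_extensionality; intros; unfold sqmod; rewrite RtoC_plus, !RtoC_mult; reflexivity).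
  split.
  - apply smooth_plus; apply smooth_mult; auto using smooth_Re, smooth_Im.
  - exists A. intros x Hx. rewrite HA by assumption. simpl. ring.
Qed.

Lemma is_derive_constant (G : R -> R) (a b : R) : a <= b ->
  (forall x, a <= x <= b -> is_derive G x 0) -> G b = G a.
Proof.
  intros Hab H. destruct (MVT_gen G a b (fun _ => 0)) as [c [_ E]].
  - intros x. rewrite Rmin_left, Rmax_right by lra. intros Hx. apply H. lra.
  - intros x. rewrite Rmin_left, Rmax_right by lra. intros Hx. apply continuity_pt_filterlim.
    apply (ex_derive_continuous (V := R_NormedModule)). eexists; apply H. lra.
  - lra.
Qed.

Lemma is_derive_nondecreasing (G g : R -> R) (a b : R) : a <= b ->
  (forall x, is_derive G x (g x)) -> (forall x, 0 <= g x) -> G a <= G b.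
Proof.
  intros Hab H Hg. destruct (MVT_gen G a b g) as [c [_ E]].
  - intros; apply H.
  - intros x _. apply continuity_pt_filterlim.
    apply (ex_derive_continuous (V := R_NormedModule)). eexists; apply H.
  - specialize (Hg c). nra.
Qed.

(** The step is the normalized primitive of the squared modulus of the given test function, so no
    explicit bump function has to be constructed. *)
Lemma smooth_step (phi : R -> C) : Cc_infty phi -> (exists x, phi x <> 0) ->
  exists (A : R) (theta rho : R -> R),
    0 < A /\ (forall x, 0 <= theta x <= 1) /\
    (forall x, x <= - A -> theta x = 0) /\ (forall x, A <= x -> theta x = 1) /\
    Cc_infty (fun x => RtoC (rho x)) /\ (forall x, A < Rabs x -> rho x = 0) /\
    (forall x, is_derive theta x (rho x)).
Proof.
  intros Hphi [x0 Hx0].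
  pose proof (sqmod_Cc_infty phi Hphi) as Hr.
  set (r := sqmod phi) in *.
  destruct (proj2 Hphi) as [A0 HA0].
  set (A := Rabs A0 + Rabs x0 + 1).
  pose proof (Rabs_pos A0). pose proof (Rabs_pos x0).
  assert (HrA : forall x, A <= Rabs x -> r x = 0).
  { intros x Hx. unfold r, sqmod. rewrite HA0; [simpl; ring|]. pose proof (Rle_abs A0). unfold A in Hx. lra. }
  assert (Hc : forall x, continuous r x).
  { intros x. apply (proj1 (continuous_C (fun x => RtoC (r x)) x)). apply smooth_continuous, Hr. }
  destruct (primitive_exists r Hc) as [G HG].
  assert (Mono : forall a b, a <= b -> G a <= G b).
  { intros a b Hab. apply is_derive_nondecreasing with r; auto. intros; apply sqmod_nonneg. }
  assert (R1 : forall x, A <= x -> G x = G A).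
  { intros x Hx. apply is_derive_constant; [exact Hx|]. intros u Hu.
    rewrite <- (HrA u); [apply HG|]. rewrite Rabs_right; unfold A in *; lra. }
  assert (R0 : forall x, x <= - A -> G x = G (- A)).
  { intros x Hx. symmetry. apply is_derive_constant; [exact Hx|]. intros u Hu.
    rewrite <- (HrA u); [apply HG|]. rewrite Rabs_left; unfold A in *; lra. }
  assert (Hx0A : - A < x0 < A).
  { assert (E : Rabs x0 < A) by (unfold A; lra). apply Rabs_def2 in E. lra. }
  set (c := G A - G (- A)).
  (* If the total integral were 0, the monotone primitive would be constant around [x0], and its
     derivative there, the squared modulus of [phi x0], would vanish. *)
  assert (c0 : 0 < c).
  { assert (G (- A) <= G A) by (apply Mono; unfold A; lra).
    destruct (Req_dec (G A) (G (- A))) as [E|E]; [|unfold c; lra]. exfalso.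
    assert (Z : is_derive G x0 0).
    { apply (is_derive_ext_loc (fun _ => G A)); [|exact (is_derive_cst (G A) x0)].
      assert (Hd : 0 < Rmin (x0 - - A) (A - x0)) by (apply Rmin_glb_lt; lra).
      exists (mkposreal _ Hd). intros u Hu. change (Rabs (u - x0) < Rmin (x0 - - A) (A - x0)) in Hu.
      pose proof (Rmin_l (x0 - - A) (A - x0)). pose proof (Rmin_r (x0 - - A) (A - x0)).
      apply Rabs_def2 in Hu.
      pose proof (Mono (- A) u ltac:(lra)). pose proof (Mono u A ltac:(lra)). lra. }
    pose proof (is_derive_unique _ _ _ (HG x0)) as U. rewrite (is_derive_unique _ _ _ Z) in U.
    pose proof (sqmod_pos phi x0 Hx0). fold r in H2. lra. }
  exists A, (fun x => / c * (G x - G (- A))), (fun x => / c * r x).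
  assert (ic : 0 < / c) by (apply Rinv_0_lt_compat, c0).
  split; [unfold A; lra|]. split; [|split; [|split; [|split; [|split]]]].
  - intros x. assert (0 <= G x - G (- A) <= c).
    { destruct (Rle_lt_dec x (- A)) as [L|L]; [rewrite (R0 x L); lra|].
      destruct (Rle_lt_dec A x) as [L'|L']; [rewrite (R1 x L'); unfold c in *; lra|].
      pose proof (Mono (- A) x ltac:(lra)). pose proof (Mono x A ltac:(lra)). unfold c in *; lra. }
    assert (/ c * c = 1) by (apply Rinv_l; lra). nra.
  - intros x Hx. rewrite (R0 x Hx). ring.
  - intros x Hx. rewrite (R1 x Hx). apply Rinv_l. fold c. lra.
  - replace (fun x => RtoC (/ c * r x)) with (fun x => (RtoC (/ c) * RtoC (r x))%C)
      by (apply functional_extensionality; intros; symmetry; apply RtoC_mult).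
    apply (Cc_infty_mult (fun _ => RtoC (/ c))); [apply smooth_const | exact Hr].
  - intros x Hx. rewrite HrA by lra. ring.
  - intros x. apply (is_derive_scal (fun x => G x - G (- A)) x (/ c) (r x)).
    replace (r x) with (r x - 0) by ring.
    apply (is_derive_minus G (fun _ => G (- A)) x (r x) 0); [apply HG | exact (is_derive_cst _ x)].
Qed.

(** Fulfilled by the given [phi]; it is the source of all cut-offs. *)
Definition has_test_function : Prop := exists phi, Cc_infty phi /\ exists x, phi x <> 0.

(** Cutting off at distance [L] leaves the remainder [h * f], where [h] vanishes on [|x| < L] and
    has derivatives bounded independently of [L]. There one surplus power of [|x|] in the norm of
    [f] is worth a factor [1 / L]. *)
Lemma schwartz_density (f : R -> C) (N : nat) (eps : R) :
  has_test_function -> schwartz f -> 0 < eps ->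
  exists g, Cc_infty g /\ schwartz_bound N eps (fun x => (RtoC 1 * f x + RtoC (-1) * g x)%C).
Proof.
  intros [phi [Hphi Hx]] [Sf Hf] Heps.
  destruct (smooth_step phi Hphi Hx) as [A [theta [rho [HA [H01 [Hl [Hr [Crho [Zrho Hd]]]]]]]]].
  set (th := fun x => RtoC (theta x)).
  assert (Dth : forall x, is_Cderive th x (RtoC (rho x))) by (intros; apply is_Cderive_RtoC, Hd).
  assert (Sth : smooth th) by (apply smooth_of_derive with (2 := proj1 Crho); exact Dth).
  destruct (Hf (S N)) as [B HB].
  assert (B0 : 0 <= B) by (eapply schwartz_bound_nonneg; eassumption).
  destruct (finite_uniform_bound (fun j H => forall x, Cmod (CDerive_n th j x) <= H) N) as [H HH].
  { intros j H H' H1 H2 x. specialize (H1 x). lra. }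
  { intros [|j].
    - exists 1. intros x. rewrite CDerive_n_0. unfold th. rewrite Cmod_RtoC, Rabs_right; specialize (H01 x); lra.
    - destruct (Cc_infty_derivatives_bounded _ j Crho) as [H HH]. exists H. intros x.
      rewrite CDerive_n_S, (CD_eq th _ Dth). apply HH. }
  assert (H0 : 0 <= H) by (eapply Rle_trans; [apply Cmod_ge_0 | apply (HH 0%nat ltac:(lia) 0)]).
  set (L := 2 ^ N * ((1 + 2 * H) * B) / eps + 1).
  assert (P2 : 0 < 2 ^ N) by (apply pow_lt; lra).
  assert (L1 : 0 <= 2 ^ N * ((1 + 2 * H) * B) / eps).
  { apply Rmult_le_pos; [|left; apply Rinv_0_lt_compat, Heps].
    apply Rmult_le_pos; [lra|]. apply Rmult_le_pos; lra. }
  assert (HL : 1 <= L) by (unfold L; lra).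
  set (Rr := L + A).
  (* [1 - h] is a difference of two shifted steps: it equals 1 on [|x| < L] and vanishes beyond
     [L + 2 * A]. *)
  set (h := fun x => ((RtoC 1 + RtoC (-1) * th (1 * x + Rr)%R) + th (1 * x + - Rr)%R)%C).
  assert (Sh : smooth h).
  { apply smooth_plus; [apply smooth_plus|].
    - apply smooth_const.
    - apply (smooth_mult (fun _ => RtoC (-1)) (fun x => th (1 * x + Rr))); [apply smooth_const | apply smooth_comp_affine, Sth].
    - apply smooth_comp_affine, Sth. }
  assert (Dh : forall j x, CDerive_n h j x = (CDerive_n (fun _ => RtoC 1) j x +
     RtoC (-1) * CDerive_n th j (1 * x + Rr)%R + CDerive_n th j (1 * x + - Rr)%R)%C).
  { intros j x. unfold h.
    rewrite (CDerive_n_plus (fun x => (RtoC 1 + RtoC (-1) * th (1 * x + Rr)%R)%C) (fun x => th (1 * x + - Rr))).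
    - rewrite (CDerive_n_plus (fun _ => RtoC 1) (fun x => (RtoC (-1) * th (1 * x + Rr)%R)%C)).
      + rewrite (CDerive_n_scal _ (fun x => th (1 * x + Rr))) by (apply smooth_comp_affine, Sth).
        rewrite !CDerive_n_comp_affine, !pow1 by exact Sth. ring.
      + apply smooth_const.
      + apply (smooth_mult (fun _ => RtoC (-1)) (fun x => th (1 * x + Rr))); [apply smooth_const | apply smooth_comp_affine, Sth].
    - apply smooth_plus; [apply smooth_const|].
      apply (smooth_mult (fun _ => RtoC (-1)) (fun x => th (1 * x + Rr))); [apply smooth_const | apply smooth_comp_affine, Sth].
    - apply smooth_comp_affine, Sth. }
  exists (fun x => ((RtoC 1 + RtoC (-1) * h x) * f x)%C). split.
  - split.
    + apply (smooth_mult (fun x => (RtoC 1 + RtoC (-1) * h x)%C)); [|exact Sf].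
      apply smooth_plus; [apply smooth_const|]. apply (smooth_mult (fun _ => RtoC (-1))); [apply smooth_const | exact Sh].
    + exists (Rr + A). intros x Hx'. unfold h, th.
      destruct (Rle_lt_dec 0 x) as [E|E].
      * rewrite Rabs_right in Hx' by lra. rewrite !Hr by (unfold Rr in *; lra). ring.
      * rewrite Rabs_left in Hx' by lra. rewrite !Hl by (unfold Rr in *; lra). ring.
  - replace (fun x => (RtoC 1 * f x + RtoC (-1) * ((RtoC 1 + RtoC (-1) * h x) * f x))%C) with (fun x => (h x * f x)%C)
      by (apply functional_extensionality; intros; ring).
    apply schwartz_bound_mono with (N' := N) (B := 2 ^ N * ((1 + 2 * H) * B / L)); [lia| |].
    { assert (EX : 2 ^ N * ((1 + 2 * H) * B) = (L - 1) * eps) by (unfold L; field; lra).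
      unfold Rdiv. rewrite <- Rmult_assoc, EX.
      apply Rmult_le_reg_r with L; [lra|]. rewrite Rmult_assoc, Rinv_l by lra. nra. }
    apply schwartz_bound_mult with (fun x => if Rlt_dec (Rabs x) L then 0 else 1 + 2 * H); auto.
    + intros j x Hj. rewrite Dh. destruct (Rlt_dec (Rabs x) L) as [E|E].
      * apply Rabs_def2 in E.
        assert (E1 : A < 1 * x + Rr) by (unfold Rr; lra).
        assert (E2 : 1 * x + - Rr < - A) by (unfold Rr; lra).
        destruct j as [|j].
        -- rewrite !CDerive_n_0. unfold th. rewrite Hr, Hl by lra.
           replace (RtoC 1 + RtoC (-1) * RtoC 1 + RtoC 0)%C with (RtoC 0) by ring. rewrite Cmod_0. lra.
        -- rewrite CDerive_n_const, !CDerive_n_S, (CD_eq th _ Dth).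
           rewrite !(CDerive_n_outside (fun x => RtoC (rho x)) A).
           ++ replace (RtoC 0 + RtoC (-1) * RtoC 0 + RtoC 0)%C with (RtoC 0) by ring. rewrite Cmod_0. lra.
           ++ intros u Hu. rewrite Zrho by exact Hu. reflexivity.
           ++ rewrite Rabs_left; lra.
           ++ intros u Hu. rewrite Zrho by exact Hu. reflexivity.
           ++ rewrite Rabs_right; lra.
      * eapply Rle_trans; [apply Cmod_triangle|].
        eapply Rle_trans; [apply Rplus_le_compat_r, Cmod_triangle|].
        rewrite Cmod_mult, Cmod_RtoC, Rabs_left by lra.
        pose proof (HH j Hj (1 * x + Rr)). pose proof (HH j Hj (1 * x + - Rr)).
        assert (Cmod (CDerive_n (fun _ => RtoC 1) j x) <= 1).
        { destruct j as [|j]; [rewrite CDerive_n_0, Cmod_1; lra | rewrite CDerive_n_const, Cmod_0; lra]. }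
        lra.
    + intros i j x Hi Hj. destruct (Rlt_dec (Rabs x) L) as [E|E].
      * rewrite Rmult_0_l. apply Rmult_le_pos; [apply Rmult_le_pos; lra|].
        left; apply Rinv_0_lt_compat; unfold L; lra.
      * assert (LL : 0 < L) by (unfold L; lra).
        unfold Rdiv. rewrite Rmult_assoc. apply Rmult_le_compat_l; [lra|].
        apply Rmult_le_reg_r with L; [exact LL|]. replace (B * / L * L) with B by (field; lra).
        pose proof (HB (S i) j x ltac:(lia) ltac:(lia)) as Q. simpl in Q.
        assert (0 <= Rabs x ^ i * Cmod (CDerive_n f j x)).
        { apply Rmult_le_pos; [apply pow_le, Rabs_pos | apply Cmod_ge_0]. }
        nra.
Qed.

(** On [f - g], with [g] a close test function, both functionals are small, and on [g] they agree.
    Identities known only on test functions thereby reach the Schwartz space, where the Fourier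
    transform acts. *)
Lemma tempered_unique (T T' : functional) :
  has_test_function -> tempered_distribution T -> tempered_distribution T' ->
  agree_on Cc_infty T T' -> agree_on schwartz T T'.
Proof.
  intros Ht [L [N [M HM]]] [L' [N' [M' HM']]] H f Hf.
  cut (T f - T' f = 0)%C.
  { intros E. replace (T f) with ((T f - T' f) + T' f)%C by ring. rewrite E. ring. }
  apply Cmod_zero, Rnot_lt_le. intros F.
  set (e := Cmod (T f - T' f)) in *.
  set (eps := e / (2 * (Rabs M + Rabs M' + 1))).
  pose proof (Rabs_pos M). pose proof (Rabs_pos M').
  assert (Heps : 0 < eps) by (apply Rdiv_lt_0_compat; lra).
  destruct (schwartz_density f (Nat.max N N') eps Ht Hf Heps) as [g [Hg Hb]].
  pose proof (Cc_infty_schwartz g Hg) as Sg.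
  pose proof (schwartz_comb 1 (RtoC (-1)) f g Hf Sg) as Sd.
  pose proof (HM _ eps Sd (schwartz_bound_mono _ _ _ _ _ (Nat.le_max_l _ _) (Rle_refl _) Hb)) as E1.
  pose proof (HM' _ eps Sd (schwartz_bound_mono _ _ _ _ _ (Nat.le_max_r _ _) (Rle_refl _) Hb)) as E2.
  rewrite L in E1 by assumption. rewrite L', <- (H g Hg) in E2 by assumption.
  assert (E : e <= M * eps + M' * eps).
  { unfold e.
    replace (T f - T' f)%C with ((1 * T f + RtoC (-1) * T g) - (1 * T' f + RtoC (-1) * T g))%C by ring.
    eapply Rle_trans; [apply Cmod_triangle|]. rewrite Cmod_opp. lra. }
  assert (M * eps + M' * eps <= (Rabs M + Rabs M' + 1) * eps).
  { pose proof (Rle_abs M). pose proof (Rle_abs M'). nra. }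
  replace ((Rabs M + Rabs M' + 1) * eps) with (e / 2) in * by (unfold eps; field; lra).
  lra.
Qed.

Lemma tempered_agree (T T' : functional) :
  agree_on schwartz T T' -> tempered_distribution T -> tempered_distribution T'.
Proof.
  intros H [L [N [M HM]]]. split.
  - intros c d f g Hf Hg. rewrite <- !H; auto using schwartz_comb.
  - exists N, M. intros f B Hf Hb. rewrite <- H by assumption. auto.
Qed.

Lemma fourier_comb_fun c d f g : schwartz f -> schwartz g ->
  fourier (fun x => (c * f x + d * g x)%C) = (fun k => (c * fourier f k + d * fourier g k)%C).
Proof.
  intros Hf Hg. destruct (schwartz_decays f Hf) as [B HB]. destruct (schwartz_decays g Hg) as [B' HB'].
  apply functional_extensionality. intros k. apply fourier_comb with B B'; assumption.
Qed.

Lemma FT_tempered (T : functional) : tempered_distribution T -> tempered_distribution (FT T).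
Proof.
  intros [L [N [M HM]]]. destruct (fourier_schwartz_bound N) as [N' [K [K0 HK]]].
  split.
  - intros c d f g Hf Hg. unfold FT. rewrite fourier_comb_fun by assumption.
    apply L; apply fourier_schwartz; assumption.
  - exists N', (M * K). intros f B Hf Hb. unfold FT. rewrite Rmult_assoc.
    apply HM; [apply fourier_schwartz, Hf | apply HK; assumption].
Qed.

(** * Sums over lattices *)

(** Lists the integers as [0, -1, 1, -2, 2, ...], so that lattice sums become series over the
    natural numbers with [|zenum j|] comparable to [j]. *)
Definition zenum (j : nat) : Z :=
  if Nat.even j then Z.of_nat (Nat.div2 j) else (- Z.of_nat (S (Nat.div2 j)))%Z.

Lemma zenum_even i : zenum (2 * i) = Z.of_nat i.
Proof. unfold zenum. rewrite Nat.even_mul, Nat.div2_double. reflexivity. Qed.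

Lemma zenum_odd i : zenum (2 * i + 1) = (- Z.of_nat (S i))%Z.
Proof.
  unfold zenum. rewrite Nat.add_1_r, Nat.even_succ, Nat.div2_succ_double.
  rewrite <- Nat.negb_even, Nat.even_mul. reflexivity.
Qed.

Lemma zenum_cases j : exists i, (j = 2 * i /\ zenum j = Z.of_nat i)%nat \/
  (j = 2 * i + 1 /\ zenum j = (- Z.of_nat (S i))%Z)%nat.
Proof.
  destruct (Nat.Even_or_Odd j) as [[i ->]|[i ->]]; exists i; [left | right].
  - split; [reflexivity | apply zenum_even].
  - split; [reflexivity | apply zenum_odd].
Qed.

Lemma zenum_injective i j : zenum i = zenum j -> i = j.
Proof.
  destruct (zenum_cases i) as [i' [[-> ->]|[-> ->]]]; destruct (zenum_cases j) as [j' [[-> ->]|[-> ->]]]; lia.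
Qed.

Lemma zenum_surjective z : exists j, zenum j = z.
Proof.
  destruct (Z.le_gt_cases 0 z) as [H|H].
  - exists (2 * Z.to_nat z)%nat. rewrite zenum_even. lia.
  - exists (2 * (Z.to_nat (- z) - 1) + 1)%nat. rewrite zenum_odd. lia.
Qed.

Lemma zenum_large j : INR (S j) <= 2 * (1 + Rabs (IZR (zenum j))).
Proof.
  rewrite <- abs_IZR, INR_IZR_INZ, <- plus_IZR, <- mult_IZR. apply IZR_le.
  destruct (zenum_cases j) as [i [[-> ->]|[-> ->]]]; lia.
Qed.

Definition lat (m j : nat) : R := IZR (zenum j) / INR m.

Lemma lat_injective m i j : (0 < m)%nat -> lat m i = lat m j -> i = j.
Proof.
  intros Hm H. apply zenum_injective, eq_IZR.
  apply Rmult_eq_reg_r with (/ INR m); [exact H|].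
  apply Rinv_neq_0_compat, not_0_INR. lia.
Qed.

Lemma lat_surjective m (z : Z) : exists j, lat m j = IZR z / INR m.
Proof. destruct (zenum_surjective z) as [j <-]. exists j. reflexivity. Qed.

(** Comparison with a telescoping series. *)
Lemma ex_series_inv_square : ex_series (fun j => / INR (S j) ^ 2).
Proof.
  apply (ex_series_le (V := R_CompleteNormedModule) (fun j => / INR (S j) ^ 2)
    (fun j => 2 * (/ INR (S j) - / INR (S (S j))))).
  - intros j. change (Rabs (/ INR (S j) ^ 2) <= 2 * (/ INR (S j) - / INR (S (S j)))).
    pose proof (pos_INR j). rewrite !S_INR.
    set (x := INR j) in *.
    rewrite Rabs_right by (apply Rle_ge; left; apply Rinv_0_lt_compat, pow_lt; lra).
    replace (2 * (/ (x + 1) - / (x + 1 + 1))) with (2 / ((x + 1) * (x + 1 + 1))) by (field; lra).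
    apply Rmult_le_reg_r with ((x + 1) ^ 2 * (x + 1 + 1)); [nra|].
    replace (/ (x + 1) ^ 2 * ((x + 1) ^ 2 * (x + 1 + 1))) with (x + 1 + 1) by (field; lra).
    replace (2 / ((x + 1) * (x + 1 + 1)) * ((x + 1) ^ 2 * (x + 1 + 1))) with (2 * (x + 1)) by (field; lra).
    lra.
  - apply (ex_series_scal (V := R_NormedModule) 2).
    exists 1. apply (filterlim_ext (fun n => 1 - / INR (S (S n)))).
    + intros n. induction n as [|n IH].
      * rewrite sum_O. simpl. field.
      * rewrite sum_Sn, <- IH. change plus with Rplus. ring.
    + assert (L : is_lim_seq (fun n => 1 - / INR (S (S n))) (1 - 0)).
      { apply (is_lim_seq_minus' (fun _ => 1) (fun n => / INR (S (S n))) 1 0); [apply is_lim_seq_const|].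
        apply is_lim_seq_spec. intros eps.
        destruct (inv_INR_S_lt eps (cond_pos eps)) as [N HN]. exists N. intros n Hn.
        rewrite Rminus_0_r, Rabs_right.
        - apply HN. lia.
        - apply Rle_ge; left; apply Rinv_0_lt_compat, lt_0_INR; lia. }
      rewrite Rminus_0_r in L. exact L.
Qed.

Definition lat_weight (m j : nat) : R := / (1 + lat m j ^ 2).

Lemma lat_weight_pos m j : 0 < lat_weight m j.
Proof. apply Rinv_0_lt_compat. nra. Qed.

(** The constant 8 comes from [(2 * (1 + w)) ^ 2 <= 8 * (1 + w ^ 2)], with [w] the absolute value of
    the enumerated integer. *)
Lemma ex_series_lat_weight m : (0 < m)%nat -> ex_series (lat_weight m).
Proof.
  intros Hm.
  apply (ex_series_le (V := R_CompleteNormedModule) (lat_weight m) (fun j => 8 * INR m ^ 2 * / INR (S j) ^ 2)).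
  - intros j. change (Rabs (lat_weight m j) <= 8 * INR m ^ 2 * / INR (S j) ^ 2).
    rewrite Rabs_right by (apply Rle_ge; left; apply lat_weight_pos).
    assert (Hm1 : 1 <= INR m) by (apply (le_INR 1); lia).
    pose proof (zenum_large j) as HZ. unfold lat_weight, lat.
    set (z := IZR (zenum j)) in *. set (k := INR m) in *.
    assert (K : 1 <= INR (S j)) by (apply (le_INR 1); lia). set (x := INR (S j)) in *.
    replace (/ (1 + (z / k) ^ 2)) with (k ^ 2 / (k ^ 2 + z ^ 2)) by (field; split; nra).
    apply Rmult_le_reg_r with (x ^ 2 * (k ^ 2 + z ^ 2)); [apply Rmult_lt_0_compat; nra|].
    replace (k ^ 2 / (k ^ 2 + z ^ 2) * (x ^ 2 * (k ^ 2 + z ^ 2))) with (k ^ 2 * x ^ 2) by (field; nra).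
    replace (8 * k ^ 2 * / x ^ 2 * (x ^ 2 * (k ^ 2 + z ^ 2))) with (k ^ 2 * (8 * (k ^ 2 + z ^ 2))) by (field; nra).
    apply Rmult_le_compat_l; [nra|].
    rewrite <- (pow2_abs z). pose proof (Rabs_pos z). set (w := Rabs z) in *.
    apply Rle_trans with ((2 * (1 + w)) ^ 2); [apply pow_incr; lra|].
    assert (1 <= k ^ 2) by nra. pose proof (pow2_ge_0 (w - 1)). nra.
  - apply (ex_series_scal (V := R_NormedModule) (8 * INR m ^ 2)), ex_series_inv_square.
Qed.

Definition lat_mass (m : nat) : R := Series (lat_weight m).

Lemma lat_mass_nonneg m : (0 < m)%nat -> 0 <= lat_mass m.
Proof.
  intros Hm. replace 0 with (Series (fun j => 0 * lat_weight m j)) by (rewrite Series_scal_l; ring).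
  apply Series_le; [|apply ex_series_lat_weight, Hm].
  intros j. pose proof (lat_weight_pos m j). lra.
Qed.

(** The comb with coefficients [c] on the lattice of mesh [1 / m]. Unlike the functional it comes
    from, it has a definite value on every function of quadratic decay, in particular on Fourier
    transforms of test functions. *)
Definition lattice_sum (c : R -> C) (m : nat) (f : R -> C) : C :=
  CSeries (fun j => (c (lat m j) * f (lat m j))%C).

Section LatticeSum.
Variables (c : R -> C) (m : nat).
Hypotheses (Hm : (0 < m)%nat) (Hc : forall x, Cmod (c x) <= 1).

Lemma lattice_term_bound f B j : (forall x, (1 + x ^ 2) * Cmod (f x) <= B) ->
  Cmod (c (lat m j) * f (lat m j))%C <= B * lat_weight m j.
Proof.
  intros H. rewrite Cmod_mult. specialize (H (lat m j)). specialize (Hc (lat m j)).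
  pose proof (Cmod_ge_0 (f (lat m j))). pose proof (Cmod_ge_0 (c (lat m j))).
  apply Rle_trans with (Cmod (f (lat m j))); [nra|].
  unfold lat_weight. apply Rmult_le_reg_l with (1 + lat m j ^ 2); [nra|].
  replace ((1 + lat m j ^ 2) * (B * / (1 + lat m j ^ 2))) with B by (field; nra). exact H.
Qed.

Lemma lattice_summable f B : (forall x, (1 + x ^ 2) * Cmod (f x) <= B) ->
  Csummable (fun j => (c (lat m j) * f (lat m j))%C).
Proof.
  intros H. apply Csummable_le with (fun j => B * lat_weight m j).
  - intros j. apply lattice_term_bound, H.
  - apply (ex_series_scal (V := R_NormedModule) B), ex_series_lat_weight, Hm.
Qed.

Lemma lattice_sum_bound f B : (forall x, (1 + x ^ 2) * Cmod (f x) <= B) ->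
  Cmod (lattice_sum c m f) <= B * lat_mass m.
Proof.
  intros H. unfold lat_mass. rewrite <- Series_scal_l. apply CSeries_bound.
  - intros j. apply lattice_term_bound, H.
  - apply (ex_series_scal (V := R_NormedModule) B), ex_series_lat_weight, Hm.
Qed.

Lemma lattice_sum_comb a b f g B B' :
  (forall x, (1 + x ^ 2) * Cmod (f x) <= B) -> (forall x, (1 + x ^ 2) * Cmod (g x) <= B') ->
  lattice_sum c m (fun x => (a * f x + b * g x)%C) = (a * lattice_sum c m f + b * lattice_sum c m g)%C.
Proof.
  intros Hf Hg. unfold lattice_sum.
  pose proof (lattice_summable f B Hf) as Sf. pose proof (lattice_summable g B' Hg) as Sg.
  rewrite <- (CSeries_scal a), <- (CSeries_scal b), <- CSeries_plus by auto using Csummable_scal.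
  apply CSeries_ext. intros j. ring.
Qed.

Lemma lattice_sum_measure (mu : functional) f :
  (forall x, c x <> 0 -> exists z : Z, x = IZR z / INR m) ->
  discrete c mu -> Cc f -> lattice_sum c m f = mu f.
Proof.
  intros HL D Hf. destruct (proj2 Hf) as [A HA].
  assert (Hm0 : 0 < INR m) by (apply lt_0_INR, Hm).
  destruct (nfloor_ex (2 * (1 + INR m * Rabs A))) as [J [_ HJ]].
  { pose proof (Rabs_pos A). nra. }
  assert (Far : forall j, (J < j)%nat -> A < Rabs (lat m j)).
  { intros j Hj. apply (le_INR (S J)) in Hj. rewrite S_INR in Hj.
    pose proof (zenum_large j) as HZ. rewrite S_INR in HZ.
    unfold lat, Rdiv. rewrite Rabs_mult, Rabs_inv, (Rabs_right (INR m)) by lra.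
    apply Rmult_lt_reg_r with (INR m); [exact Hm0|]. rewrite Rmult_assoc, Rinv_l, Rmult_1_r by lra.
    pose proof (Rle_abs A). nra. }
  unfold lattice_sum. rewrite (CSeries_finite _ (S J)).
  - rewrite (proj2 D f (map (lat m) (seq 0 (S J))) Hf).
    + rewrite lsum_map. reflexivity.
    + apply FinFun.Injective_map_NoDup; [|apply seq_NoDup].
      intros i j. apply lat_injective, Hm.
    + intros x Hx. destruct (HL x (Cmult_neq_0_l _ _ Hx)) as [z ->].
      destruct (lat_surjective m z) as [j Ej]. apply in_map_iff. exists j. split; [exact Ej|].
      apply in_seq. split; [lia|]. apply Nat.nle_gt. intros F.
      apply (Cmult_neq_0_r _ _ Hx). rewrite <- Ej. apply HA, Far. lia.
  - intros j Hj. rewrite HA; [ring|]. apply Far. lia.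
Qed.

End LatticeSum.

(** * Phase-space shifts *)

Definition weyl (a b : R) (f : R -> C) (x : R) : C := (cis (2 * PI * b * x) * f (x - a)%R)%C.

Lemma continuous_modulation b x : continuous (fun x => cis (2 * PI * b * x)) x.
Proof.
  apply (continuous_ext (fun x => cis (2 * PI * b * x + 0))).
  - intros; f_equal; ring.
  - apply continuous_cis.
Qed.

Lemma multiplier_modulation b : multiplier (fun x => cis (2 * PI * b * x)).
Proof.
  replace (fun x => cis (2 * PI * b * x)) with (fun x => cis (2 * PI * b * x + 0)).
  - apply multiplier_cis.
  - apply functional_extensionality. intros; f_equal; ring.
Qed.

Lemma weyl_schwartz a b f : schwartz f -> schwartz (weyl a b f).
Proof.
  intros H. apply schwartz_mult; [apply multiplier_modulation | apply schwartz_translate, H].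
Qed.

Lemma weyl_Cc a b f : Cc f -> Cc (weyl a b f).
Proof.
  intros H. apply Cc_mult; [intros; apply continuous_modulation | apply Cc_translate, H].
Qed.

Lemma shift_weight (x a : R) : Rabs a <= 1 -> 1 + x ^ 2 <= 3 * (1 + (x - a) ^ 2).
Proof. intros H. apply Rabs_le_between in H. assert (a ^ 2 <= 1) by nra.
  pose proof (pow2_ge_0 (x - a - a)). pose proof (pow2_ge_0 (x - a)). nra. Qed.

Lemma weyl_decay B a b f : Rabs a <= 1 -> (forall x, (1 + x ^ 2) * Cmod (f x) <= B) ->
  forall x, (1 + x ^ 2) * Cmod (weyl a b f x) <= 3 * B.
Proof.
  intros Ha H x. unfold weyl. rewrite Cmod_mult, Cmod_cis, Rmult_1_l.
  specialize (H (x - a)). pose proof (shift_weight x a Ha). pose proof (Cmod_ge_0 (f (x - a))). nra.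
Qed.

(** Translation by [b] and modulation by [a] commute up to the phase [e^{2 pi i a b}], which is 1
    because [a b = 0]. *)
Lemma fourier_weyl (a b : R) (f : R -> C) : a * b = 0 -> schwartz f ->
  weyl a b (fourier f) = fourier (weyl (- b) a f).
Proof.
  intros Hab Hf. apply functional_extensionality. intros x. unfold weyl at 1.
  rewrite fourier_shift.
  pose proof (schwartz_mult _ _ (multiplier_modulation a) Hf) as S.
  destruct (schwartz_decays _ S) as [B HB]. rewrite (fourier_modulate B) by exact HB.
  f_equal. apply functional_extensionality. intros u. unfold weyl.
  replace (2 * PI * a * (u + b)) with (2 * PI * a * u + 2 * PI * (a * b)) by ring.
  rewrite Hab, Rmult_0_r, Rplus_0_r. replace (u - - b) with (u + b) by ring. reflexivity.
Qed.

(** Mean value theorem for each component. The intermediate point is within distance 1 of [x], so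
    moving the weight costs a factor 3; two components give 6. *)
Lemma translate_difference (f : R -> C) (B a x : R) : smooth f -> Rabs a <= 1 ->
  (forall y, (1 + y ^ 2) * Cmod (CD f y) <= B) ->
  (1 + x ^ 2) * Cmod (f (x - a)%R - f x)%C <= 6 * B * Rabs a.
Proof.
  intros Sf Ha HB.
  assert (HR : forall g g' : R -> R, (forall y, is_derive g y (g' y)) ->
    (forall y, Rabs (g' y) <= Cmod (CD f y)) -> (1 + x ^ 2) * Rabs (g (x - a) - g x) <= 3 * B * Rabs a).
  { intros g g' Hg Hb.
    destruct (MVT_gen g x (x - a) g') as [c [Hc E]].
    - intros; apply Hg.
    - intros y _. apply continuity_pt_filterlim, (ex_derive_continuous (V := R_NormedModule) g).
      eexists; apply Hg.
    - rewrite E, Rabs_mult. replace (x - a - x) with (- a) by ring. rewrite Rabs_Ropp, <- Rmult_assoc.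
      apply Rmult_le_compat_r; [apply Rabs_pos|].
      assert (Hxc : Rabs (x - c) <= 1).
      { apply Rabs_le. apply Rabs_le_between in Ha. unfold Rmin, Rmax in Hc.
        destruct (Rle_dec x (x - a)); lra. }
      pose proof (shift_weight x (x - c) Hxc) as W. replace (x - (x - c)) with c in W by ring.
      specialize (Hb c). specialize (HB c). pose proof (Rabs_pos (g' c)). nra. }
  assert (H1 := HR (fun y => Re (f y)) (fun y => Re (CD f y)) (fun y => proj1 (smooth_derive f y Sf))
    (fun y => Rabs_Re_le _)).
  assert (H2 := HR (fun y => Im (f y)) (fun y => Im (CD f y)) (fun y => proj2 (smooth_derive f y Sf))
    (fun y => Rabs_Im_le _)).
  cbv beta in H1, H2.
  apply Rle_trans with ((1 + x ^ 2) * (Rabs (Re (f (x - a)%R) - Re (f x)) + Rabs (Im (f (x - a)%R) - Im (f x)))).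
  - apply Rmult_le_compat_l; [nra|]. apply (Cmod_le_Re_Im (f (x - a)%R - f x)%C).
  - rewrite Rmult_plus_distr_l. lra.
Qed.

(** The 12 is the cost of the translation: 6 from the mean value estimate times 2 for the decay of
    the derivative. The [8 * PI] is the cost of the modulation. *)
Definition weyl_const : R := 12 + 8 * PI.

Lemma weyl_const_pos : 0 < weyl_const.
Proof. unfold weyl_const. pose proof PI_RGT_0. lra. Qed.

(** Order 3 is needed because the modulation differs from 1 by at most [4 pi |b x|], which adds one
    power of [x] to the weight [1 + x ^ 2]. *)
Lemma weyl_difference (f : R -> C) (B a b t x : R) : smooth f -> schwartz_bound 3 B f ->
  Rabs a <= t -> Rabs b <= t -> t <= 1 ->
  (1 + x ^ 2) * Cmod (weyl a b f x - f x)%C <= weyl_const * t * B.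
Proof.
  intros Sf HB Ha Hb Ht.
  assert (B0 : 0 <= B) by (eapply schwartz_bound_nonneg; eassumption).
  assert (t0 : 0 <= t) by (pose proof (Rabs_pos a); lra).
  assert (E1 := translate_difference f (2 * B) a x Sf ltac:(lra)
    (proj2 (schwartz_bound_decays 2 B (CD f) ltac:(lia) (smooth_CD f Sf) (schwartz_bound_CD 2 B f HB)))).
  pose proof (HB 1%nat 0%nat x ltac:(lia) ltac:(lia)) as B1.
  pose proof (HB 3%nat 0%nat x ltac:(lia) ltac:(lia)) as B3.
  rewrite CDerive_n_0 in B1, B3.
  replace (Rabs x ^ 3) with (Rabs x * x ^ 2) in B3 by (rewrite <- (pow2_abs x); ring). rewrite pow_1 in B1.
  assert (E2 : (1 + x ^ 2) * (Cmod (cis (2 * PI * b * x) - 1)%C * Cmod (f x)) <= 8 * PI * t * B).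
  { pose proof (cis_linear (2 * PI * b * x)) as L. pose proof PI_RGT_0 as P.
    rewrite !Rabs_mult, (Rabs_right 2), (Rabs_right PI) in L by lra.
    pose proof (Cmod_ge_0 (f x)) as F0. pose proof (Rabs_pos x) as X0. pose proof (Rabs_pos b) as b0.
    apply Rle_trans with ((1 + x ^ 2) * (2 * (2 * PI * Rabs b * Rabs x) * Cmod (f x))).
    - apply Rmult_le_compat_l; [nra|]. apply Rmult_le_compat_r; assumption.
    - replace ((1 + x ^ 2) * (2 * (2 * PI * Rabs b * Rabs x) * Cmod (f x))) with
        (4 * PI * Rabs b * (Rabs x * Cmod (f x) + Rabs x * x ^ 2 * Cmod (f x))) by ring.
      replace (8 * PI * t * B) with (4 * PI * t * (B + B)) by ring.
      apply Rmult_le_compat; try lra.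
      + apply Rmult_le_pos; lra.
      + apply Rplus_le_le_0_compat; apply Rmult_le_pos; nra.
      + apply Rmult_le_compat_l; lra. }
  replace (weyl a b f x - f x)%C with
    (cis (2 * PI * b * x) * (f (x - a)%R - f x) + (cis (2 * PI * b * x) - 1) * f x)%C
    by (unfold weyl; ring).
  apply Rle_trans with ((1 + x ^ 2) * (Cmod (f (x - a)%R - f x)%C + Cmod (cis (2 * PI * b * x) - 1)%C * Cmod (f x))).
  - apply Rmult_le_compat_l; [nra|]. eapply Rle_trans; [apply Cmod_triangle|].
    rewrite !Cmod_mult, Cmod_cis, Rmult_1_l. lra.
  - rewrite Rmult_plus_distr_l. unfold weyl_const.
    assert (6 * (2 * B) * Rabs a <= 12 * t * B) by nra. lra.
Qed.

Definition shift_diff (c : R -> C) (m : nat) (a b : R) (f : R -> C) : C :=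
  (lattice_sum c m (weyl a b f) - lattice_sum c m f)%C.

(* The shifts tau_t, multiplication by e^{2 pi i t x}, tau_{-t}, multiplication by
   e^{-2 pi i t x}, which the Fourier transform permutes cyclically. *)
Definition dir_a (i : nat) (t : R) : R := match i with 0%nat => t | 2%nat => - t | _ => 0 end.
Definition dir_b (i : nat) (t : R) : R := match i with 1%nat => t | 3%nat => - t | _ => 0 end.

Lemma dir_a_le i t : 0 <= t -> Rabs (dir_a i t) <= t.
Proof.
  intros H. destruct i as [|[|[|i]]]; simpl; rewrite ?Rabs_Ropp, ?Rabs_R0, ?(Rabs_right t); lra.
Qed.

Lemma dir_b_le i t : 0 <= t -> Rabs (dir_b i t) <= t.
Proof.
  intros H. destruct i as [|[|[|[|i]]]]; simpl; rewrite ?Rabs_Ropp, ?Rabs_R0, ?(Rabs_right t); lra.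
Qed.

Definition four : list nat := (0 :: 1 :: 2 :: 3 :: nil)%nat.

(** The weights [q] on the four directions let one formula cover a summand of sigma, of each of its
    transforms, and of eta; only [q] changes. *)
Definition block (c : R -> C) (m : nat) (a t : R) (q : nat -> C) (f : R -> C) : C :=
  (RtoC a * lsum (fun i => (q i * shift_diff c m (dir_a i t) (dir_b i t) f)%C) four)%C.

Definition block_mass (c : R -> C) (a t : R) (q : nat -> C) (x : R) : C :=
  (RtoC a * lsum (fun i => (q i * (c (x + dir_a i t)%R * cis (2 * PI * dir_b i t * (x + dir_a i t)) - c x))%C) four)%C.

Definition qnorm (q : nat -> C) : R := Cmod (q 0%nat) + Cmod (q 1%nat) + Cmod (q 2%nat) + Cmod (q 3%nat).

Lemma qnorm_nonneg q : 0 <= qnorm q.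
Proof.
  unfold qnorm. pose proof (Cmod_ge_0 (q 0%nat)). pose proof (Cmod_ge_0 (q 1%nat)).
  pose proof (Cmod_ge_0 (q 2%nat)). pose proof (Cmod_ge_0 (q 3%nat)). lra.
Qed.

(** The action of the Fourier transform on the weights: a cyclic shift times [lambda]. *)
Definition qshift (lambda : C) (q : nat -> C) (i : nat) : C :=
  match i with O => lambda * q 3%nat | S j => lambda * q j end%C.

Lemma four_bound (q g : nat -> C) (B : R) : (forall i, Cmod (g i) <= B) ->
  Cmod (lsum (fun i => (q i * g i)%C) four) <= qnorm q * B.
Proof.
  intros H. eapply Rle_trans.
  - apply lsum_bound with (b := fun i => Cmod (q i) * B).
    intros i _. rewrite Cmod_mult. apply Rmult_le_compat_l; [apply Cmod_ge_0 | apply H].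
  - right. simpl. unfold qnorm. ring.
Qed.

Section Block.
Variables (c : R -> C) (m : nat) (a t : R).
Hypotheses (Hm : (0 < m)%nat) (Hc : forall x, Cmod (c x) <= 1) (Ht : 0 < t <= 1) (Ha : 0 <= a).

(** Gains a factor [t] at the cost of three derivatives of [f]. It yields the convergence of the
    series and the harmlessness of later blocks. *)
Lemma block_small q f B : smooth f -> schwartz_bound 3 B f ->
  Cmod (block c m a t q f) <= a * t * lat_mass m * (qnorm q * weyl_const * B).
Proof.
  intros Sf HB. unfold block. rewrite Cmod_mult, Cmod_RtoC, Rabs_right by lra.
  rewrite !Rmult_assoc. apply Rmult_le_compat_l; [exact Ha|].
  replace (t * (lat_mass m * (qnorm q * (weyl_const * B)))) with
    (qnorm q * (weyl_const * t * B * lat_mass m)) by ring.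
  apply four_bound. intros i. unfold shift_diff.
  assert (D := proj2 (schwartz_bound_decays 3 B f ltac:(lia) Sf HB)).
  pose proof (dir_a_le i t ltac:(lra)) as Ai. pose proof (dir_b_le i t ltac:(lra)) as Bi.
  replace (lattice_sum c m (weyl (dir_a i t) (dir_b i t) f) - lattice_sum c m f)%C with
    (1 * lattice_sum c m (weyl (dir_a i t) (dir_b i t) f) + RtoC (-1) * lattice_sum c m f)%C by ring.
  rewrite <- (lattice_sum_comb c m Hm Hc 1 (RtoC (-1)) _ _ _ _
    (weyl_decay _ (dir_a i t) (dir_b i t) f ltac:(lra) D) D).
  apply lattice_sum_bound; auto. intros x.
  replace (1 * weyl (dir_a i t) (dir_b i t) f x + RtoC (-1) * f x)%C with
    (weyl (dir_a i t) (dir_b i t) f x - f x)%C by ring.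
  apply weyl_difference; auto; lra.
Qed.

(** No gain from [t], but only the decay of [f] enters, so the bound is the same for all waves times
    a fixed function and for all shifts. The 4 is 3 for the shifted comb and 1 for the unshifted
    one. *)
Lemma block_bound q f B : (forall x, (1 + x ^ 2) * Cmod (f x) <= B) ->
  Cmod (block c m a t q f) <= a * lat_mass m * (qnorm q * 4 * B).
Proof.
  intros D. unfold block. rewrite Cmod_mult, Cmod_RtoC, Rabs_right by lra.
  rewrite !Rmult_assoc. apply Rmult_le_compat_l; [exact Ha|].
  replace (lat_mass m * (qnorm q * (4 * B))) with (qnorm q * (3 * B * lat_mass m + B * lat_mass m)) by ring.
  apply four_bound. intros i. unfold shift_diff.
  pose proof (dir_a_le i t ltac:(lra)) as Ai.
  eapply Rle_trans; [apply Cmod_triangle|]. rewrite Cmod_opp.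
  apply Rplus_le_compat; apply lattice_sum_bound; auto. apply weyl_decay; auto; lra.
Qed.

Lemma shift_diff_comb d e f g B B' i :
  (forall x, (1 + x ^ 2) * Cmod (f x) <= B) -> (forall x, (1 + x ^ 2) * Cmod (g x) <= B') ->
  shift_diff c m (dir_a i t) (dir_b i t) (fun x => (d * f x + e * g x)%C) =
    (d * shift_diff c m (dir_a i t) (dir_b i t) f + e * shift_diff c m (dir_a i t) (dir_b i t) g)%C.
Proof.
  intros Hf Hg. unfold shift_diff. pose proof (dir_a_le i t ltac:(lra)) as Ai.
  rewrite (lattice_sum_comb c m Hm Hc d e f g B B') by assumption.
  replace (weyl (dir_a i t) (dir_b i t) (fun x => (d * f x + e * g x)%C)) with
    (fun x => (d * weyl (dir_a i t) (dir_b i t) f x + e * weyl (dir_a i t) (dir_b i t) g x)%C)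
    by (apply functional_extensionality; intros; unfold weyl; ring).
  rewrite (lattice_sum_comb c m Hm Hc d e _ _ (3 * B) (3 * B')) by (apply weyl_decay; auto; lra).
  ring.
Qed.

Lemma block_comb q d e f g B B' :
  (forall x, (1 + x ^ 2) * Cmod (f x) <= B) -> (forall x, (1 + x ^ 2) * Cmod (g x) <= B') ->
  block c m a t q (fun x => (d * f x + e * g x)%C) = (d * block c m a t q f + e * block c m a t q g)%C.
Proof.
  intros Hf Hg. unfold block.
  rewrite (lsum_ext _ (fun i => (d * (q i * shift_diff c m (dir_a i t) (dir_b i t) f) +
     e * (q i * shift_diff c m (dir_a i t) (dir_b i t) g))%C)).
  - rewrite lsum_plus, !lsum_scal. ring.
  - intros i _. rewrite (shift_diff_comb d e f g B B') by assumption. ring.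
Qed.

(** The transform sends the shift by [(u, v)] to the one by [(- v, u)], that is [(t, 0)] to
    [(0, t)], then to [(- t, 0)], [(0, - t)] and back, each time with a factor [lambda]. *)
Lemma block_fourier lambda q f :
  (forall g, schwartz g -> lattice_sum c m (fourier g) = (lambda * lattice_sum c m g)%C) ->
  schwartz f -> block c m a t q (fourier f) = block c m a t (qshift lambda q) f.
Proof.
  intros HF Hf.
  assert (E : forall u v, u * v = 0 ->
    shift_diff c m u v (fourier f) = (lambda * shift_diff c m (- v) u f)%C).
  { intros u v Huv. unfold shift_diff. rewrite fourier_weyl by assumption.
    rewrite !HF by (auto using weyl_schwartz). ring. }
  unfold block. simpl. rewrite !E by ring. rewrite Ropp_0, Ropp_involutive. ring.
Qed.

Lemma block_discrete (mu : functional) q :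
  (forall x, c x <> 0 -> exists z : Z, x = IZR z / INR m) ->
  discrete c mu -> discrete (block_mass c a t q) (block c m a t q).
Proof.
  intros HL D.
  assert (Di : forall i, discrete
    (fun x => (c (x + dir_a i t)%R * cis (2 * PI * dir_b i t * (x + dir_a i t)) - c x)%C)
    (shift_diff c m (dir_a i t) (dir_b i t))).
  { intros i.
    pose proof (discrete_translate _ _ (dir_a i t)
      (discrete_density c mu _ (continuous_modulation (dir_b i t)) D)) as D1.
    pose proof (discrete_comb _ _ _ _ 1 (RtoC (-1)) D1 D) as D2.
    eapply discrete_ext; [|eapply discrete_agree; [|exact D2]].
    - intros x. simpl. ring.
    - intros f Hf. unfold shift_diff.
      rewrite (lattice_sum_measure c m Hm mu), (lattice_sum_measure c m Hm mu); auto using weyl_Cc.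
      unfold mtranslate, mdens, weyl. ring. }
  pose proof (discrete_comb _ _ _ _ (RtoC a * q 0%nat) (RtoC a * q 1%nat) (Di 0%nat) (Di 1%nat)) as D01.
  pose proof (discrete_comb _ _ _ _ (RtoC a * q 2%nat) (RtoC a * q 3%nat) (Di 2%nat) (Di 3%nat)) as D23.
  pose proof (discrete_comb _ _ _ _ 1 1 D01 D23) as DD.
  eapply discrete_ext; [|eapply discrete_agree; [|exact DD]].
  - intros x. unfold block_mass. simpl. ring.
  - intros f Hf. unfold block. simpl. ring.
Qed.

End Block.

Lemma block_comb_q c m a t (z z' : C) (q q' : nat -> C) f :
  block c m a t (fun i => (z * q i + z' * q' i)%C) f = (z * block c m a t q f + z' * block c m a t q' f)%C.
Proof. unfold block. simpl. ring. Qed.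

Lemma block_ext_q c m a t (q q' : nat -> C) f :
  (forall i, In i four -> q i = q' i) -> block c m a t q f = block c m a t q' f.
Proof. intros H. unfold block. f_equal. apply lsum_ext. intros i Hi. rewrite H; auto. Qed.

(** * The series of all blocks: temperedness, Fourier transform, crystallinity *)

Lemma ex_series_half : ex_series (fun n => (1 / 2) ^ n).
Proof. apply ex_series_geom. rewrite Rabs_right; lra. Qed.

Lemma Series_half : Series (fun n => (1 / 2) ^ n) = 2.
Proof. rewrite Series_geom by (rewrite Rabs_right; lra). field. Qed.

Section Theta.
Variables (c : nat -> R -> C) (m : nat -> nat) (mu : nat -> functional) (a t : nat -> R) (lambda : C).
Hypotheses
  (Hm : forall n, (0 < m n)%nat)
  (Hc : forall n x, Cmod (c n x) <= 1)
  (HL : forall n x, c n x <> 0 -> exists z : Z, x = IZR z / INR (m n))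
  (HD : forall n, discrete (c n) (mu n))
  (Hgap : forall n x, c n x <> 0 -> INR n <= Rabs x)
  (HF : forall n g, schwartz g -> lattice_sum (c n) (m n) (fourier g) = (lambda * lattice_sum (c n) (m n) g)%C)
  (Ht : forall n, 0 < t n <= 1)
  (Ha : forall n, 0 <= a n)
  (Hat : forall n, a n * t n * lat_mass (m n) <= (1 / 2) ^ n).

(** Sigma, its iterated transforms and eta are all members of this family, which is linear in [q]
    and mapped to itself by the Fourier transform. *)
Definition Theta (q : nat -> C) : functional :=
  fun f => CSeries (fun n => block (c n) (m n) (a n) (t n) q f).

Definition Theta_mass (q : nat -> C) (x : R) : C :=
  CSeries (fun n => block_mass (c n) (a n) (t n) q x).

Lemma Theta_term_bound q f B n : smooth f -> schwartz_bound 3 B f ->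
  Cmod (block (c n) (m n) (a n) (t n) q f) <= qnorm q * weyl_const * B * (1 / 2) ^ n.
Proof.
  intros Sf HB. eapply Rle_trans; [apply (block_small _ _ _ _ (Hm n) (Hc n) (Ht n) (Ha n) q f B Sf HB)|].
  rewrite (Rmult_comm _ ((1 / 2) ^ n)). apply Rmult_le_compat_r; [|apply Hat].
  apply Rmult_le_pos; [|eapply schwartz_bound_nonneg; eassumption].
  apply Rmult_le_pos; [apply qnorm_nonneg | left; apply weyl_const_pos].
Qed.

Lemma Theta_summable q f : schwartz f -> Csummable (fun n => block (c n) (m n) (a n) (t n) q f).
Proof.
  intros [Sf Hf]. destruct (Hf 3%nat) as [B HB].
  apply Csummable_le with (fun n => qnorm q * weyl_const * B * (1 / 2) ^ n).
  - intros n. apply Theta_term_bound; assumption.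
  - apply (ex_series_scal (V := R_NormedModule) (qnorm q * weyl_const * B)), ex_series_half.
Qed.

Lemma Theta_comb_q z z' q q' f : schwartz f ->
  Theta (fun i => (z * q i + z' * q' i)%C) f = (z * Theta q f + z' * Theta q' f)%C.
Proof.
  intros Hf. unfold Theta.
  rewrite <- (CSeries_scal z), <- (CSeries_scal z'), <- CSeries_plus
    by auto using Csummable_scal, Theta_summable.
  apply CSeries_ext. intros n. apply block_comb_q.
Qed.

Lemma Theta_ext_q q q' : (forall i, In i four -> q i = q' i) -> Theta q = Theta q'.
Proof.
  intros H. apply functional_extensionality. intros f. apply CSeries_ext. intros n.
  apply block_ext_q, H.
Qed.

Lemma Theta_tempered q : tempered_distribution (Theta q).
Proof.
  split.
  - intros d e f g Hf Hg. unfold Theta.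
    destruct (schwartz_decays f Hf) as [B [_ HB]]. destruct (schwartz_decays g Hg) as [B' [_ HB']].
    rewrite <- (CSeries_scal d), <- (CSeries_scal e), <- CSeries_plus
      by auto using Csummable_scal, Theta_summable.
    apply CSeries_ext. intros n.
    apply (block_comb _ _ _ _ (Hm n) (Hc n) (Ht n) q d e f g B B' HB HB').
  - exists 3%nat, (qnorm q * weyl_const * 2). intros f B [Sf _] HB.
    replace (qnorm q * weyl_const * 2 * B) with (Series (fun n => qnorm q * weyl_const * B * (1 / 2) ^ n)).
    + apply CSeries_bound.
      * intros n. apply Theta_term_bound; assumption.
      * apply (ex_series_scal (V := R_NormedModule) (qnorm q * weyl_const * B)), ex_series_half.
    + rewrite (Series_scal_l _ (fun n => (1 / 2) ^ n)), Series_half. ring.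
Qed.

Lemma Theta_fourier q f : schwartz f -> Theta q (fourier f) = Theta (qshift lambda q) f.
Proof.
  intros Hf. apply CSeries_ext. intros n. apply block_fourier; auto.
Qed.

(** The gap around the origin grows with [n], and a shift by at most 1 cannot bring an atom back
    into the window. *)
Lemma block_mass_far q n x : Rabs x + 1 < INR n -> block_mass (c n) (a n) (t n) q x = 0.
Proof.
  intros H.
  assert (Z : forall y, Rabs y < INR n -> c n y = 0).
  { intros y Hy. apply NNPP. intros F. specialize (Hgap n y F). lra. }
  unfold block_mass. rewrite lsum_zero; [ring|]. intros i _.
  rewrite (Z x) by (pose proof (Rabs_pos x); lra). rewrite Z; [ring|].
  eapply Rle_lt_trans; [apply Rabs_triang|].
  specialize (Ht n). pose proof (dir_a_le i (t n) ltac:(lra)). lra.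
Qed.

Lemma Theta_discrete q : discrete (Theta_mass q) (Theta q).
Proof.
  apply discrete_CSeries with (nu := fun n => block (c n) (m n) (a n) (t n) q).
  - intros n. apply block_discrete with (mu n); auto.
  - intros A. destruct (nfloor_ex (Rabs A + 1)) as [N [_ HN]]; [pose proof (Rabs_pos A); lra|].
    exists (S N). intros n x Hn Hx. apply block_mass_far.
    apply le_INR in Hn. rewrite S_INR in Hn. pose proof (Rle_abs A). lra.
  - reflexivity.
Qed.

(** A merely continuous [f] does not profit from small shifts; summability comes instead from the
    gaps, which leave only finitely many nonzero terms. *)
Lemma Theta_summable_Cc q f : Cc f -> Csummable (fun n => block (c n) (m n) (a n) (t n) q f).
Proof.
  intros Hf. destruct (proj2 Hf) as [A HA].
  destruct (nfloor_ex (Rabs A + 1)) as [N [_ HN]]; [pose proof (Rabs_pos A); lra|].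
  apply Csummable_finite with (S N). intros n Hn.
  rewrite (proj2 (block_discrete _ _ _ _ (Hm n) (mu n) q (HL n) (HD n)) f nil Hf).
  - reflexivity.
  - constructor.
  - intros x Hx. exfalso. apply (Cmult_neq_0_l _ _ Hx), block_mass_far.
    assert (Rabs x <= A).
    { apply Rnot_lt_le. intros F. apply (Cmult_neq_0_r _ _ Hx), HA, F. }
    apply le_INR in Hn. rewrite S_INR in Hn. pose proof (Rle_abs A). lra.
Qed.

Lemma Theta_represents q : represents (Theta q) (Theta q).
Proof. split; [apply Theta_tempered | intros f _; reflexivity]. Qed.

Lemma Theta_has_fourier q : has_fourier (Theta q) (Theta (qshift lambda q)).
Proof.
  exists (Theta q). split; [apply Theta_represents|]. split.
  - apply FT_tempered, Theta_tempered.
  - intros f Hf. apply Theta_fourier, Cc_infty_schwartz, Hf.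
Qed.

Lemma Theta_crystalline q : crystalline (Theta q).
Proof.
  split; [apply discrete_measure with (1 := Theta_discrete q)|].
  split; [exists (Theta q); apply Theta_represents|].
  split; [apply discrete_pure_point with (1 := Theta_discrete q)|].
  split; [apply discrete_support_locally_finite with (1 := Theta_discrete q)|].
  exists (Theta (qshift lambda q)).
  split; [apply discrete_measure with (1 := Theta_discrete _)|].
  split; [apply Theta_has_fourier|].
  split; [apply discrete_pure_point with (1 := Theta_discrete _)|].
  apply discrete_support_locally_finite with (1 := Theta_discrete _).
Qed.

End Theta.

(** * Means of trigonometric series *)

Definition trig_sum (l : list (R * C)) (s : R) : C := lsum (fun p => (snd p * cis (fst p * s))%C) l.

(** [z] is the mean value of [u], expressed without integrals: [u - z] is a uniform limit of
    trigonometric polynomials with no constant term. *)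
Definition approx_mean (u : R -> C) (z : C) : Prop :=
  forall eps, 0 < eps -> exists l : list (R * C),
    (forall p, In p l -> fst p <> 0) /\
    forall s, Cmod (u s - z - trig_sum l s)%C <= eps.

Lemma cis_PI : cis PI = RtoC (-1).
Proof. unfold cis. rewrite cos_PI, sin_PI. reflexivity. Qed.

(* Replacing u by (u(s) + u(s+h))/2 with e^{i theta h} = -1 kills the frequency theta,
   keeps the constant term and increases no norm. *)
Lemma trig_mean_bound (l : list (R * C)) (u : R -> C) (z : C) (M e : R) :
  (forall p, In p l -> fst p <> 0) -> (forall s, Cmod (u s) <= M) ->
  (forall s, Cmod (u s - z - trig_sum l s)%C <= e) -> Cmod z <= M + e.
Proof.
  revert u. remember (length l) as k eqn:Ek. revert l Ek.
  induction k as [|k IH]; intros l Ek u Hl Hu He.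
  - destruct l; [|discriminate]. specialize (Hu 0). specialize (He 0).
    unfold trig_sum in He. simpl in He.
    replace z with (u 0 - (u 0 - z - 0))%C by ring.
    eapply Rle_trans; [apply Cmod_triangle|]. rewrite Cmod_opp. lra.
  - destruct l as [|[th d] l]; [discriminate|].
    assert (Hth : th <> 0) by (apply (Hl (th, d)); left; reflexivity).
    set (h := PI / th).
    apply (IH (map (fun p => (fst p, (RtoC (/ 2) * (snd p * (1 + cis (fst p * h)%R)))%C)) l)) with
      (u := fun s => (RtoC (/ 2) * (u s + u (s + h)%R))%C).
    + rewrite length_map. simpl in Ek. lia.
    + intros p Hp. apply in_map_iff in Hp. destruct Hp as [p' [<- Hp]]. simpl. apply Hl. right; exact Hp.
    + intros s. rewrite Cmod_mult, Cmod_RtoC, Rabs_right by lra.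
      pose proof (Cmod_triangle (u s) (u (s + h))). pose proof (Hu s). pose proof (Hu (s + h)). lra.
    + intros s.
      assert (E : trig_sum (map (fun p => (fst p, (RtoC (/ 2) * (snd p * (1 + cis (fst p * h)%R)))%C)) l) s =
        (RtoC (/ 2) * (trig_sum ((th, d) :: l) s + trig_sum ((th, d) :: l) (s + h)))%C).
      { unfold trig_sum. rewrite lsum_map. simpl.
        rewrite (Rmult_plus_distr_l th s h), cis_plus.
        replace (th * h) with PI by (unfold h; field; exact Hth). rewrite cis_PI.
        rewrite (lsum_ext _ (fun p => (RtoC (/ 2) * (snd p * cis (fst p * s) + snd p * cis (fst p * (s + h))))%C)).
        - rewrite lsum_scal, lsum_plus. ring.
        - intros p _. rewrite Rmult_plus_distr_l, cis_plus. ring. }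
      rewrite E.
      replace (RtoC (/ 2) * (u s + u (s + h)%R) - z -
        RtoC (/ 2) * (trig_sum ((th, d) :: l) s + trig_sum ((th, d) :: l) (s + h)))%C with
        (RtoC (/ 2) * ((u s - z - trig_sum ((th, d) :: l) s) +
                       (u (s + h)%R - z - trig_sum ((th, d) :: l) (s + h))))%C.
      * rewrite Cmod_mult, Cmod_RtoC, Rabs_right by lra.
        pose proof (Cmod_triangle (u s - z - trig_sum ((th, d) :: l) s)
          (u (s + h)%R - z - trig_sum ((th, d) :: l) (s + h))) as T.
        pose proof (He s). pose proof (He (s + h)). lra.
      * assert (Half : (RtoC (/ 2) * z + RtoC (/ 2) * z = z)%C).
        { rewrite <- Cmult_plus_distr_r, <- RtoC_plus. replace (/ 2 + / 2) with 1 by field. ring. }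
        rewrite <- Half at 3. ring.
Qed.

Lemma approx_mean_bound u z M : approx_mean u z -> (forall s, Cmod (u s) <= M) -> Cmod z <= M.
Proof.
  intros H Hu. apply Rnot_lt_le. intros F.
  destruct (H ((Cmod z - M) / 2)) as [l [Hl He]]; [lra|].
  pose proof (trig_mean_bound l u z M _ Hl Hu He). lra.
Qed.

Lemma approx_mean_comb u z u' z' (d e : C) : approx_mean u z -> approx_mean u' z' ->
  approx_mean (fun s => (d * u s + e * u' s)%C) (d * z + e * z')%C.
Proof.
  intros H H' eps Heps.
  set (K := Cmod d + Cmod e + 1).
  pose proof (Cmod_ge_0 d). pose proof (Cmod_ge_0 e).
  assert (HK : 0 < eps / K) by (apply Rdiv_lt_0_compat; unfold K; lra).
  destruct (H _ HK) as [l [Hl He]]. destruct (H' _ HK) as [l' [Hl' He']].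
  exists (map (fun p => (fst p, (d * snd p)%C)) l ++ map (fun p => (fst p, (e * snd p)%C)) l').
  split.
  - intros p Hp. apply in_app_or in Hp.
    destruct Hp as [Hp|Hp]; apply in_map_iff in Hp; destruct Hp as [p' [<- Hp]]; simpl; auto.
  - intros s.
    assert (E : trig_sum (map (fun p => (fst p, (d * snd p)%C)) l ++ map (fun p => (fst p, (e * snd p)%C)) l') s =
      (d * trig_sum l s + e * trig_sum l' s)%C).
    { unfold trig_sum. rewrite lsum_app, !lsum_map, <- !lsum_scal. simpl. f_equal;
        apply lsum_ext; intros p _; ring. }
    rewrite E.
    replace (d * u s + e * u' s - (d * z + e * z') - (d * trig_sum l s + e * trig_sum l' s))%C with
      (d * (u s - z - trig_sum l s) + e * (u' s - z' - trig_sum l' s))%C by ring.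
    eapply Rle_trans; [apply Cmod_triangle|]. rewrite !Cmod_mult.
    specialize (He s). specialize (He' s).
    apply Rle_trans with (Cmod d * (eps / K) + Cmod e * (eps / K)).
    + apply Rplus_le_compat; apply Rmult_le_compat_l; assumption.
    + apply Rle_trans with (K * (eps / K)); [unfold K at 3; lra|].
      right. field. unfold K; lra.
Qed.

Lemma ex_series_tail (b : nat -> R) (eps : R) : (forall n, 0 <= b n) -> ex_series b -> 0 < eps ->
  exists N : nat, Series (fun n => if Nat.ltb n N then 0 else b n) <= eps /\
    ex_series (fun n => if Nat.ltb n N then 0 else b n).
Proof.
  intros Hb Hs Heps.
  assert (L : is_lim_seq (sum_n b) (Series b)) by apply (Series_correct b Hs).
  apply is_lim_seq_spec in L. destruct (L (mkposreal eps Heps)) as [N HN].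
  specialize (HN N (Nat.le_refl N)). simpl in HN.
  exists (S N).
  set (g := fun n => if Nat.ltb n (S N) then b n else 0).
  assert (Fin : is_series g (sum_n b N)).
  { apply (filterlim_ext_loc (fun _ => sum_n b N)); [|apply filterlim_const].
    exists N. intros n Hn. induction Hn as [|n Hn IH].
    - apply sum_n_ext_loc. intros k Hk. unfold g. replace (Nat.ltb k (S N)) with true; [reflexivity|].
      symmetry. apply Nat.ltb_lt. lia.
    - rewrite sum_Sn, <- IH. unfold g. replace (Nat.ltb (S n) (S N)) with false.
      + exact (eq_sym (Rplus_0_r _)).
      + symmetry. apply Nat.ltb_ge. lia. }
  assert (Ex : ex_series g) by (eexists; exact Fin).
  assert (EE : forall n, (if Nat.ltb n (S N) then 0 else b n) = b n - g n).
  { intros n. unfold g. destruct (Nat.ltb n (S N)); ring. }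
  split.
  - rewrite (Series_ext _ _ EE), (Series_minus b g) by assumption.
    rewrite (is_series_unique g _ Fin). apply Rabs_def2 in HN. lra.
  - apply ex_series_ext with (fun n => b n - g n); [intros; symmetry; apply EE|].
    apply (ex_series_minus (V := R_NormedModule) b g); assumption.
Qed.

(** All terms of frequency 0, however late, go into the mean; of the others those before [N] form
    the trigonometric polynomial, and the rest is dominated by the tail of the coefficients. *)
Lemma approx_mean_series (d : nat -> C) (th : nat -> R) : Csummable d ->
  approx_mean (fun s => CSeries (fun j => (d j * cis (th j * s))%C))
    (CSeries (fun j => if Req_EM_T (th j) 0 then d j else RtoC 0)).
Proof.
  intros Hd eps Heps.
  destruct (ex_series_tail (fun j => Cmod (d j)) eps (fun j => Cmod_ge_0 (d j)) Hd Heps) as [N [HN HN']].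
  set (l := map (fun j => (th j, d j)) (filter (fun j => if Req_EM_T (th j) 0 then false else true) (seq 0 N))).
  exists l. split.
  - intros p Hp. apply in_map_iff in Hp. destruct Hp as [j [<- Hj]]. apply filter_In in Hj. simpl.
    destruct (Req_EM_T (th j) 0); [destruct Hj; discriminate | assumption].
  - intros s.
    set (z := fun j => if Req_EM_T (th j) 0 then d j else RtoC 0).
    set (g := fun j => if Nat.ltb j N then (if Req_EM_T (th j) 0 then RtoC 0 else d j * cis (th j * s))%C else RtoC 0).
    assert (Eg : trig_sum l s = CSeries g).
    { unfold trig_sum, l. rewrite lsum_map. simpl.
      rewrite (CSeries_finite g N).
      - rewrite <- (lsum_filter_zero g (fun j => if Req_EM_T (th j) 0 then false else true)).
        + apply lsum_ext. intros j Hj. apply filter_In in Hj. destruct Hj as [Hj1 Hj2]. apply in_seq in Hj1.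
          unfold g. destruct (Req_EM_T (th j) 0); [discriminate|].
          replace (Nat.ltb j N) with true; [reflexivity|]. symmetry. apply Nat.ltb_lt. lia.
        + intros j Hj. unfold g. destruct (Req_EM_T (th j) 0); [|discriminate].
          destruct (Nat.ltb j N); reflexivity.
      - intros j Hj. unfold g. replace (Nat.ltb j N) with false; [reflexivity|].
        symmetry. apply Nat.ltb_ge, Hj. }
    rewrite Eg.
    assert (S1 : Csummable (fun j => (d j * cis (th j * s))%C)).
    { apply Csummable_le with (2 := Hd). intros j. rewrite Cmod_mult, Cmod_cis. lra. }
    assert (S2 : Csummable z).
    { apply Csummable_le with (2 := Hd). intros j. unfold z. destruct (Req_EM_T (th j) 0).
      - lra.
      - rewrite Cmod_0. apply Cmod_ge_0. }
    assert (S3 : Csummable g).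
    { apply Csummable_le with (2 := Hd). intros j. unfold g.
      destruct (Nat.ltb j N); [destruct (Req_EM_T (th j) 0)|]; rewrite ?Cmod_0; try apply Cmod_ge_0.
      rewrite Cmod_mult, Cmod_cis. lra. }
    replace (CSeries (fun j => (d j * cis (th j * s))%C) - CSeries z - CSeries g)%C with
      (CSeries (fun j => ((d j * cis (th j * s) + RtoC (-1) * z j) + RtoC (-1) * g j)%C)).
    + eapply Rle_trans; [|exact HN]. apply CSeries_bound; [|exact HN'].
      intros j. unfold z, g. destruct (Req_EM_T (th j) 0) as [E|E].
      * rewrite E, Rmult_0_l, cis_0.
        replace (d j * 1 + RtoC (-1) * d j + RtoC (-1) * (if Nat.ltb j N then RtoC 0 else RtoC 0))%C with (RtoC 0).
        -- rewrite Cmod_0. destruct (Nat.ltb j N); [lra | apply Cmod_ge_0].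
        -- destruct (Nat.ltb j N); ring.
      * destruct (Nat.ltb j N).
        -- replace (d j * cis (th j * s) + RtoC (-1) * 0 + RtoC (-1) * (d j * cis (th j * s)))%C with (RtoC 0) by ring.
           rewrite Cmod_0; lra.
        -- replace (d j * cis (th j * s) + RtoC (-1) * 0 + RtoC (-1) * 0)%C with (d j * cis (th j * s))%C by ring.
           rewrite Cmod_mult, Cmod_cis. lra.
    + rewrite CSeries_plus, CSeries_plus, !CSeries_scal by auto using Csummable_scal, Csummable_plus. ring.
Qed.

Section BlockMean.
Variables (c : R -> C) (m : nat).
Hypotheses (Hm : (0 < m)%nat) (Hc : forall x, Cmod (c x) <= 1)
  (HL : forall x, c x <> 0 -> exists z : Z, x = IZR z / INR m).
Variables (v : R -> C) (B : R).
Hypothesis Hv : decays B v.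

(** As a function of [s], the lattice point [x] contributes a wave of frequency proportional to
    [p + a - x]. The mean therefore picks the coefficient at [x = p + a], which occurs at most once
    in the enumeration. *)
Lemma lattice_mean (a b p : R) : Rabs a <= 1 ->
  approx_mean (fun s => (cis (2 * PI * p * s) * lattice_sum c m (weyl a b (fun x => wave s x * v x)))%C)
    (c (p + a)%R * cis (2 * PI * b * (p + a)) * v p)%C.
Proof.
  intros Ha.
  set (d := fun j => (c (lat m j) * weyl a b v (lat m j))%C).
  set (th := fun j => 2 * PI * (p + a - lat m j)).
  assert (Hd : Csummable d).
  { apply lattice_summable with (3 * B); auto. apply weyl_decay; [exact Ha | apply Hv]. }
  assert (Eu : (fun s => (cis (2 * PI * p * s) * lattice_sum c m (weyl a b (fun x => wave s x * v x)))%C) =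
    (fun s => CSeries (fun j => (d j * cis (th j * s))%C))).
  { apply functional_extensionality. intros s. unfold lattice_sum.
    rewrite <- CSeries_scal.
    - apply CSeries_ext. intros j. unfold d, th, weyl, wave.
      replace (2 * PI * (p + a - lat m j) * s) with
        (2 * PI * p * s + - (2 * PI * s * (lat m j - a))) by ring.
      rewrite cis_plus. ring.
    - apply lattice_summable with (3 * B); auto. apply weyl_decay; [exact Ha|].
      apply (decays_wave B s v Hv). }
  assert (Ez : (c (p + a)%R * cis (2 * PI * b * (p + a)) * v p)%C =
    CSeries (fun j => if Req_EM_T (th j) 0 then d j else RtoC 0)).
  { assert (Hth : forall j, th j = 0 -> lat m j = p + a).
    { intros j E. unfold th in E. pose proof PI_RGT_0.
      apply Rmult_integral in E. destruct E as [E|E]; lra. }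
    assert (Ed : forall j, lat m j = p + a -> d j = (c (p + a)%R * cis (2 * PI * b * (p + a)) * v p)%C).
    { intros j E. unfold d, weyl. rewrite E. replace (p + a - a) with p by ring. ring. }
    destruct (classic (exists j, lat m j = p + a)) as [[j Ej]|N].
    - rewrite (CSeries_single _ j).
      + destruct (Req_EM_T (th j) 0) as [E|E].
        * symmetry. apply Ed, Ej.
        * exfalso. apply E. unfold th. rewrite Ej. ring.
      + intros i Hi. destruct (Req_EM_T (th i) 0) as [E|E]; [|reflexivity].
        exfalso. apply Hi, (lat_injective m); auto. rewrite Ej. apply Hth, E.
    - rewrite (CSeries_finite _ 0).
      + simpl. assert (c (p + a) = 0) as ->; [|ring].
        apply NNPP. intros F. destruct (HL _ F) as [z Ez]. apply N.
        destruct (lat_surjective m z) as [j Ej]. exists j. rewrite Ej. symmetry. exact Ez.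
      + intros j _. destruct (Req_EM_T (th j) 0) as [E|E]; [|reflexivity].
        exfalso. apply N. exists j. apply Hth, E. }
  rewrite Eu, Ez. apply approx_mean_series, Hd.
Qed.

Lemma block_mean (a t : R) (q : nat -> C) (p : R) : 0 < t <= 1 ->
  approx_mean (fun s => (cis (2 * PI * p * s) * block c m a t q (fun x => wave s x * v x)%C)%C)
    (block_mass c a t q p * v p)%C.
Proof.
  intros Ht.
  assert (Di : forall i, approx_mean
    (fun s => (cis (2 * PI * p * s) * shift_diff c m (dir_a i t) (dir_b i t) (fun x => wave s x * v x)%C)%C)
    ((c (p + dir_a i t)%R * cis (2 * PI * dir_b i t * (p + dir_a i t)) - c p) * v p)%C).
  { intros i. pose proof (dir_a_le i t ltac:(lra)) as Ai.
    pose proof (lattice_mean (dir_a i t) (dir_b i t) p ltac:(lra)) as M1.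
    pose proof (lattice_mean 0 0 p ltac:(rewrite Rabs_R0; lra)) as M0.
    pose proof (approx_mean_comb _ _ _ _ 1 (RtoC (-1)) M1 M0) as M.
    match type of M with approx_mean ?u ?z => match goal with |- approx_mean ?u' ?z' =>
      replace u' with u; [replace z' with z; [exact M|]|] end end.
    - rewrite Rplus_0_r. replace (2 * PI * 0 * p) with 0 by ring. rewrite cis_0. ring.
    - apply functional_extensionality. intros s. unfold shift_diff.
      replace (weyl 0 0 (fun x => (wave s x * v x)%C)) with (fun x => (wave s x * v x)%C).
      + ring.
      + apply functional_extensionality. intros x. unfold weyl.
        replace (2 * PI * 0 * x) with 0 by ring. rewrite cis_0, Rminus_0_r. ring. }
  pose proof (approx_mean_comb _ _ _ _ (RtoC a * q 0%nat) (RtoC a * q 1%nat) (Di 0%nat) (Di 1%nat)) as M01.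
  pose proof (approx_mean_comb _ _ _ _ (RtoC a * q 2%nat) (RtoC a * q 3%nat) (Di 2%nat) (Di 3%nat)) as M23.
  pose proof (approx_mean_comb _ _ _ _ 1 1 M01 M23) as M.
  match type of M with approx_mean ?u ?z => match goal with |- approx_mean ?u' ?z' =>
    replace u' with u; [replace z' with z; [exact M|]|] end end.
  - unfold block_mass. simpl. ring.
  - apply functional_extensionality. intros s. unfold block. simpl. ring.
Qed.

(** If the block stayed below the stated value for all [s], its mean, which is the coefficient at
    [p], would be smaller than itself. The slack 1 is there because the supremum need not be
    attained. *)
Lemma block_large (a t : R) (q : nat -> C) (p : R) : 0 < t <= 1 ->
  exists s, Cmod (block_mass c a t q p) * Cmod (v p) - 1 <=
    Cmod (block c m a t q (fun x => wave s x * v x)%C).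
Proof.
  intros Ht. apply NNPP. intros F.
  pose proof (approx_mean_bound _ _ (Cmod (block_mass c a t q p) * Cmod (v p) - 1) (block_mean a t q p Ht)) as E.
  rewrite Cmod_mult in E.
  assert (Cmod (block_mass c a t q p) * Cmod (v p) <= Cmod (block_mass c a t q p) * Cmod (v p) - 1); [|lra].
  apply E. intros s. rewrite Cmod_mult, Cmod_cis, Rmult_1_l.
  apply Rnot_lt_le. intros L. apply F. exists s. lra.
Qed.

End BlockMean.

(** * Zeros of the Fourier transform of a test function *)

Lemma increment_ge (G g : R -> R) (a b K : R) : a <= b ->
  (forall x, is_derive G x (g x)) -> (forall x, a <= x <= b -> K <= g x) -> K * (b - a) <= G b - G a.
Proof.
  intros Hab H HK. destruct (MVT_gen G a b g) as [c [Hc E]].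
  - intros; apply H.
  - intros x _. apply continuity_pt_filterlim.
    apply (ex_derive_continuous (V := R_NormedModule)). eexists; apply H.
  - rewrite Rmin_left, Rmax_right in Hc by lra. rewrite E.
    apply Rmult_le_compat_r; [lra | auto].
Qed.

Lemma real_integral_compact (g : R -> R) (A I : R) :
  (forall x, continuous g x) -> 0 <= A -> (forall x, A <= Rabs x -> g x = 0) ->
  is_RInt_gen g (Rbar_locally m_infty) (Rbar_locally p_infty) I ->
  exists G, (forall x, is_derive G x (g x)) /\ G A - G (- A) = I.
Proof.
  intros Hc HA Hz HI.
  destruct (primitive_exists g Hc) as [G HG].
  exists G. split; [exact HG|].
  assert (H : is_RInt_gen g (Rbar_locally m_infty) (Rbar_locally p_infty) (G A - G (- A))).
  { apply real_integral_primitive with G; auto.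
    - apply (filterlim_ext_loc (fun _ => G (- A))); [|apply filterlim_const].
      exists (- A). intros x Hx. apply is_derive_constant; [lra|].
      intros u Hu. rewrite <- (Hz u); [apply HG|]. rewrite Rabs_left1; lra.
    - apply (filterlim_ext_loc (fun _ => G A)); [|apply filterlim_const].
      exists A. intros x Hx. symmetry. apply is_derive_constant; [lra|].
      intros u Hu. rewrite <- (Hz u); [apply HG|]. rewrite Rabs_right; lra. }
  rewrite <- (is_RInt_gen_unique (V := R_CompleteNormedModule) _ _ HI).
  symmetry. exact (is_RInt_gen_unique (V := R_CompleteNormedModule) _ _ H).
Qed.

(* The moments of a nonzero continuous function of compact support cannot all vanish: the
   polynomials (1 - (x - x0)^2 / L^2)^n concentrate at x0. *)
Lemma peak_integral_nonzero (h : R -> R) (A x0 L : R) :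
  (forall x, continuous h x) -> (forall x, A <= Rabs x -> h x = 0) ->
  0 < h x0 -> 2 * (A + Rabs x0 + 1) <= L -> Rabs x0 + 1 <= A ->
  exists n, ~ is_RInt_gen (fun x => (1 - ((x - x0) / L) ^ 2) ^ n * h x)
    (Rbar_locally m_infty) (Rbar_locally p_infty) 0.
Proof.
  intros Hc Hz H0 HL HA.
  pose proof (Rabs_pos x0) as X0.
  assert (L0 : 0 < L) by lra.
  assert (Loc : locally x0 (fun u => h x0 / 2 <= h u)).
  { assert (P : 0 < h x0 / 2) by lra.
    apply filter_imp with (2 := proj1 (filterlim_locally _ _) (Hc x0) (mkposreal _ P)).
    intros u Hu. change (Rabs (h u - h x0) < h x0 / 2) in Hu. apply Rabs_def2 in Hu. lra. }
  destruct Loc as [d0 Hd0].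
  set (d := Rmin (d0 / 2) 1).
  assert (dp : 0 < d) by (apply Rmin_glb_lt; [pose proof (cond_pos d0); lra | lra]).
  assert (d1 : d <= 1) by apply Rmin_r.
  assert (Near : forall u, x0 - d <= u <= x0 + d -> h x0 / 2 <= h u).
  { intros u Hu. apply Hd0. change (Rabs (u - x0) < d0).
    pose proof (Rmin_l (d0 / 2) 1). pose proof (cond_pos d0). fold d in H.
    apply Rle_lt_trans with d; [apply Rabs_le; lra | lra]. }
  destruct (continuous_bounded_on (fun x => RtoC (h x)) (- A) A) as [M HM].
  { intros x. apply continuous_R_C, Hc. }
  set (ell := fun x => 1 - ((x - x0) / L) ^ 2).
  (* The polynomial base is at least [r2] within [d / 2] of [x0] and at most [r1 < r2] beyond
     distance [d], so high powers single out the peak. The size of [L] keeps the base nonnegative on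
     [[- A, A]]. *)
  set (r1 := 1 - (d / L) ^ 2). set (r2 := 1 - (d / (2 * L)) ^ 2).
  assert (dL : 0 < d / L <= 1 / 2).
  { split; [apply Rdiv_lt_0_compat; lra|]. apply Rmult_le_reg_r with L; [lra|].
    unfold Rdiv. rewrite Rmult_assoc, Rinv_l by lra. lra. }
  assert (dL2 : d / (2 * L) = d / L / 2) by (field; lra).
  assert (r1p : 0 < r1) by (unfold r1; nra).
  assert (r12 : r1 < r2) by (unfold r1, r2; rewrite dL2; nra).
  assert (Hsq : forall u e, 0 <= e -> (Rabs (u - x0) <= e -> ell u >= 1 - (e / L) ^ 2) /\
    (e <= Rabs (u - x0) -> ell u <= 1 - (e / L) ^ 2)).
  { intros u e He. unfold ell, Rdiv. rewrite !Rpow_mult_distr.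
    assert (0 < (/ L) ^ 2) by (apply pow_lt, Rinv_0_lt_compat, L0).
    rewrite <- (pow2_abs (u - x0)). pose proof (Rabs_pos (u - x0)).
    split; intros Hu.
    - assert (Rabs (u - x0) ^ 2 <= e ^ 2) by (apply pow_incr; lra). nra.
    - assert (e ^ 2 <= Rabs (u - x0) ^ 2) by (apply pow_incr; lra). nra. }
  assert (Dist : forall u, - A <= u <= A -> Rabs (u - x0) <= L / 2).
  { intros u Hu. apply Rle_trans with (Rabs u + Rabs x0).
    - unfold Rminus. eapply Rle_trans; [apply Rabs_triang|]. rewrite Rabs_Ropp. lra.
    - assert (Rabs u <= A) by (apply Rabs_le; lra). lra. }
  assert (ell0 : forall u, - A <= u <= A -> 0 <= ell u).
  { intros u Hu. pose proof (proj1 (Hsq u (L / 2) ltac:(lra)) (Dist u Hu)) as E.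
    replace (L / 2 / L) with (1 / 2) in E by (field; lra). lra. }
  assert (M0 : 0 <= M).
  { eapply Rle_trans; [apply Cmod_ge_0 | apply (HM 0); lra]. }
  apply NNPP. intros F.
  assert (Ineq : forall n, d * (h x0 / 2) * r2 ^ n <= 2 * (2 * A) * M * r1 ^ n).
  { intros n.
    destruct (real_integral_compact (fun x => ell x ^ n * h x) A 0) as [G [HG E]].
    - intros x. apply (continuous_mult (K := R_AbsRing)); [|apply Hc].
      apply (ex_derive_continuous (V := R_NormedModule)). unfold ell. auto_derive; lra.
    - lra.
    - intros x Hx. rewrite Hz by exact Hx. ring.
    - apply NNPP. intros F'. apply F. exists n. exact F'.
    - assert (R1n : 0 <= r1 ^ n) by (apply pow_le; lra).
      assert (R2n : 0 <= r2 ^ n) by (apply pow_le; lra).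

      assert (X1 : - A <= x0 - d /\ x0 + d <= A).
      { pose proof (Rle_abs x0). pose proof (Rle_abs (- x0)). rewrite Rabs_Ropp in *. lra. }
      assert (Far : forall u, - A <= u <= A -> d <= Rabs (u - x0) -> - (M * r1 ^ n) <= ell u ^ n * h u).
      { intros u Hu Hd. pose proof (proj2 (Hsq u d ltac:(lra)) Hd) as El. fold r1 in El.
        pose proof (ell0 u Hu). assert (ell u ^ n <= r1 ^ n) by (apply pow_incr; lra).
        assert (0 <= ell u ^ n) by (apply pow_le; lra).
        specialize (HM u Hu). rewrite Cmod_RtoC in HM. apply Rabs_le_between in HM. nra. }
      (* The interval is cut into five pieces: two far ones where only the small power [r1 ^ n] is
         available, two intermediate ones where the integrand is nonnegative, and the core with the
         lower bound from [r2 ^ n]. *)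
      assert (P1 := increment_ge G _ (- A) (x0 - d) (- (M * r1 ^ n)) ltac:(lra) HG).
      assert (P2 := increment_ge G _ (x0 - d) (x0 - d / 2) 0 ltac:(lra) HG).
      assert (P3 := increment_ge G _ (x0 - d / 2) (x0 + d / 2) (r2 ^ n * (h x0 / 2)) ltac:(lra) HG).
      assert (P4 := increment_ge G _ (x0 + d / 2) (x0 + d) 0 ltac:(lra) HG).
      assert (P5 := increment_ge G _ (x0 + d) A (- (M * r1 ^ n)) ltac:(lra) HG).
      cbv beta in P1, P2, P3, P4, P5.
      assert (Q1 : - (M * r1 ^ n) * (x0 - d - - A) <= G (x0 - d) - G (- A)).
      { apply P1. intros u Hu. apply Far; [lra|]. rewrite Rabs_left; lra. }
      assert (Q5 : - (M * r1 ^ n) * (A - (x0 + d)) <= G A - G (x0 + d)).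
      { apply P5. intros u Hu. apply Far; [lra|]. rewrite Rabs_right; lra. }
      assert (Pos : forall u, x0 - d <= u <= x0 + d -> 0 <= ell u ^ n * h u).
      { intros u Hu. apply Rmult_le_pos; [apply pow_le, ell0; lra|].
        specialize (Near u Hu). lra. }
      assert (Q2 := P2 ltac:(intros; apply Pos; lra)).
      assert (Q4 := P4 ltac:(intros; apply Pos; lra)).
      assert (Q3 : r2 ^ n * (h x0 / 2) * (x0 + d / 2 - (x0 - d / 2)) <= G (x0 + d / 2) - G (x0 - d / 2)).
      { apply P3. intros u Hu. apply Rmult_le_compat; [assumption | lra | | apply Near; lra].
        apply pow_incr. split; [lra|].
        assert (Hd2 : Rabs (u - x0) <= d / 2) by (apply Rabs_le; lra).
        pose proof (proj1 (Hsq u (d / 2) ltac:(lra)) Hd2) as El.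
        replace (d / 2 / L) with (d / (2 * L)) in El by (field; lra). fold r2 in El. lra. }
      assert (M * r1 ^ n * (x0 - d - - A) <= M * r1 ^ n * (2 * A)).
      { apply Rmult_le_compat_l; [apply Rmult_le_pos; lra | lra]. }
      assert (M * r1 ^ n * (A - (x0 + d)) <= M * r1 ^ n * (2 * A)).
      { apply Rmult_le_compat_l; [apply Rmult_le_pos; lra | lra]. }
      lra. }
  assert (Q : Rabs (r1 / r2) < 1).
  { rewrite Rabs_right.
    - apply Rmult_lt_reg_r with r2; [lra|]. unfold Rdiv. rewrite Rmult_assoc, Rinv_l; lra.
    - apply Rle_ge, Rmult_le_pos; [lra | left; apply Rinv_0_lt_compat; lra]. }
  set (K := 2 * (2 * A) * M + 1).
  assert (K0 : 0 < K) by (unfold K; assert (0 <= 2 * (2 * A) * M) by (apply Rmult_le_pos; lra); lra).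
  assert (Y : 0 < d * (h x0 / 2) / K) by (apply Rdiv_lt_0_compat; [apply Rmult_lt_0_compat|]; lra).
  destruct (pow_lt_1_zero _ Q _ Y) as [n Hn]. specialize (Hn n (Nat.le_refl n)). specialize (Ineq n).
  rewrite Rabs_right in Hn.
  2: { apply Rle_ge, pow_le, Rmult_le_pos; [lra | left; apply Rinv_0_lt_compat; lra]. }
  assert (R2n : 0 < r2 ^ n) by (apply pow_lt; lra).
  assert (E1 : r1 ^ n = (r1 / r2) ^ n * r2 ^ n).
  { rewrite <- Rpow_mult_distr. f_equal. field. lra. }
  assert (Rn : 0 < r1 ^ n) by (apply pow_lt; lra).
  assert (K * r1 ^ n < d * (h x0 / 2) * r2 ^ n).
  { rewrite E1, <- Rmult_assoc. apply Rmult_lt_compat_r; [exact R2n|].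
    apply Rmult_lt_compat_l with (r := K) in Hn; [|exact K0].
    replace (K * (d * (h x0 / 2) / K)) with (d * (h x0 / 2)) in Hn by (field; lra). exact Hn. }
  unfold K in *. lra.
Qed.

(** On an open interval of zeros the derivative of the transform vanishes too, so multiples of [f]
    by powers of [x] inherit the zeros. *)
Lemma fourier_zero_freq_mult (f : R -> C) (a b : R) : schwartz f ->
  (forall k, a < k < b -> fourier f k = 0) -> forall k, a < k < b -> fourier (freq_mult f) k = 0.
Proof.
  intros Hf H k Hk.
  rewrite <- (is_Cderive_unique _ _ _ (fourier_schwartz_derive f k Hf)).
  apply is_Cderive_unique.
  assert (Lz : locally k (fun u => fourier f u = 0)).
  { assert (Hd : 0 < Rmin (k - a) (b - k)) by (apply Rmin_glb_lt; lra).
    exists (mkposreal _ Hd). intros u Hu. change (Rabs (u - k) < Rmin (k - a) (b - k)) in Hu.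
    pose proof (Rmin_l (k - a) (b - k)). pose proof (Rmin_r (k - a) (b - k)).
    apply Rabs_def2 in Hu. apply H. lra. }
  split.
  - apply (is_derive_ext_loc (fun _ => 0)); [|exact (is_derive_cst 0 k)].
    apply filter_imp with (2 := Lz). intros u ->. reflexivity.
  - apply (is_derive_ext_loc (fun _ => 0)); [|exact (is_derive_cst 0 k)].
    apply filter_imp with (2 := Lz). intros u ->. reflexivity.
Qed.

Lemma fourier_scal (z : C) (f : R -> C) (k : R) : schwartz f ->
  fourier (fun x => (z * f x)%C) k = (z * fourier f k)%C.
Proof.
  intros Hf. replace (fun x => (z * f x)%C) with (fun x => (z * f x + 0 * f x)%C)
    by (apply functional_extensionality; intros; ring).
  rewrite fourier_comb_fun by assumption. ring.
Qed.

Lemma fourier_zero_id_mult (f : R -> C) (a b : R) : schwartz f ->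
  (forall k, a < k < b -> fourier f k = 0) ->
  forall k, a < k < b -> fourier (fun x => (RtoC x * f x)%C) k = 0.
Proof.
  intros Hf H k Hk. pose proof (fourier_zero_freq_mult f a b Hf H k Hk) as E.
  unfold freq_mult in E.
  rewrite (fourier_scal _ (fun x => (RtoC x * f x)%C)) in E by (apply schwartz_mult; [apply multiplier_id | exact Hf]).
  assert (Nz : (RtoC (- (2 * PI)) * Ci)%C <> 0).
  { intros F. apply (f_equal Cmod) in F. rewrite Cmod_mult, Cmod_Ci, Cmod_RtoC, Cmod_0, Rabs_Ropp, Rabs_right in F;
      pose proof PI_RGT_0; lra. }
  apply NNPP. intros F. apply (Cmult_neq_0 _ _ Nz F), E.
Qed.

Definition peak (x0 L x : R) : R := 1 - ((x - x0) / L) ^ 2.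

Lemma fourier_zero_peak (f : R -> C) (a b x0 L : R) (n : nat) : L <> 0 -> schwartz f ->
  (forall k, a < k < b -> fourier f k = 0) ->
  schwartz (fun x => (RtoC (peak x0 L x ^ n) * f x)%C) /\
  forall k, a < k < b -> fourier (fun x => (RtoC (peak x0 L x ^ n) * f x)%C) k = 0.
Proof.
  intros HL Hf H. induction n as [|n [IS IH]].
  - replace (fun x => (RtoC (peak x0 L x ^ 0) * f x)%C) with f; [split; assumption|].
    apply functional_extensionality. intros x. rewrite pow_O. ring.
  - set (g := fun x => (RtoC (peak x0 L x ^ n) * f x)%C) in *.
    set (g1 := fun x => (RtoC x * g x)%C).
    assert (S1 : schwartz g1) by (apply schwartz_mult; [apply multiplier_id | exact IS]).
    assert (S2 : schwartz (fun x => (RtoC x * g1 x)%C)) by (apply schwartz_mult; [apply multiplier_id | exact S1]).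
    pose proof (fourier_zero_id_mult g a b IS IH) as Z1.
    pose proof (fourier_zero_id_mult g1 a b S1 Z1) as Z2.
    (* The coefficients of the quadratic polynomial [peak x0 L], so that one more factor is a
       combination of [g], [x g] and [x ^ 2 g]. *)
    set (z0 := RtoC (1 - (x0 / L) ^ 2)). set (z1 := RtoC (2 * x0 / L ^ 2)). set (z2 := RtoC (- / L ^ 2)).
    replace (fun x => (RtoC (peak x0 L x ^ S n) * f x)%C) with
      (fun x => (1 * (z0 * g x + z1 * g1 x) + z2 * (RtoC x * g1 x))%C).
    + assert (S3 : schwartz (fun x => (z0 * g x + z1 * g1 x)%C)) by (apply schwartz_comb; assumption).
      split.
      * apply (schwartz_comb 1 z2 (fun x => (z0 * g x + z1 * g1 x)%C) (fun x => (RtoC x * g1 x)%C)); assumption.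
      * intros k Hk. rewrite (fourier_comb_fun 1 z2 (fun x => (z0 * g x + z1 * g1 x)%C) (fun x => (RtoC x * g1 x)%C))
          by assumption.
        rewrite (fourier_comb_fun z0 z1 g g1) by assumption.
        rewrite IH, Z1, Z2 by exact Hk. ring.
    + apply functional_extensionality. intros x. unfold g1, z0, z1, z2, g.
      replace (peak x0 L x ^ S n) with
        (((1 - (x0 / L) ^ 2) + 2 * x0 / L ^ 2 * x + - / L ^ 2 * (x * x)) * peak x0 L x ^ n)
        by (simpl; unfold peak; field; exact HL).
      generalize (1 - (x0 / L) ^ 2) (2 * x0 / L ^ 2) (- / L ^ 2) (peak x0 L x ^ n). intros u0 u1 u2 r.
      rewrite !RtoC_mult, !RtoC_plus, !RtoC_mult. ring.
Qed.

(** Takes the place of analyticity: if the transform vanished on an interval, so would the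
    transforms of all powers of the peak polynomial times [phi]. At an interior frequency [k0] this
    contradicts the concentration of these powers at [x0]. *)
Lemma fourier_nonzero_dense (phi : R -> C) (a b : R) :
  Cc_infty phi -> (exists x, phi x <> 0) -> a < b -> exists k, a < k < b /\ fourier phi k <> 0.
Proof.
  intros Hphi [x0 Hx0] Hab. apply NNPP. intros F.
  assert (H : forall k, a < k < b -> fourier phi k = 0).
  { intros k Hk. apply NNPP. intros E. apply F. exists k. auto. }
  pose proof (Cc_infty_schwartz phi Hphi) as Sphi.
  set (k0 := (a + b) / 2). assert (Hk0 : a < k0 < b) by (unfold k0; lra).
  destruct (proj2 Hphi) as [A0 HA0].
  set (A := Rabs A0 + Rabs x0 + 1). set (L := 2 * (A + Rabs x0 + 1)).
  pose proof (Rabs_pos A0). pose proof (Rabs_pos x0).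
  (* Multiplication by this conjugate makes the value at [x0] equal to the positive number
     [|phi x0| ^ 2], so taking real parts loses nothing there. *)
  set (z := Cconj (wave k0 x0 * phi x0)%C).
  set (h := fun x => Re (z * (wave k0 x * phi x))%C).
  destruct (peak_integral_nonzero h A x0 L) as [n Hn].
  - intros x.
    apply (proj1 (continuous_C (fun x => (z * (wave k0 x * phi x))%C) x)).
    apply (continuous_Cmult (fun _ => z)); [apply continuous_const|].
    apply continuous_Cmult; [apply continuous_wave | apply smooth_continuous, Hphi].
  - intros x Hx. unfold h. rewrite HA0; [|unfold A in Hx; pose proof (Rle_abs A0); lra].
    replace (z * (wave k0 x * 0))%C with (RtoC 0) by ring. reflexivity.
  - unfold h, z. set (w := (wave k0 x0 * phi x0)%C).
    assert (W : 0 < Cmod w).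
    { unfold w. rewrite Cmod_mult. unfold wave. rewrite Cmod_cis, Rmult_1_l. apply Cmod_gt_0, Hx0. }
    destruct w as [p q]. pose proof (Cmod2_alt (p, q)) as Q. simpl in Q. simpl.
    replace (p * p - - q * q) with (p * (p * 1) + q * (q * 1)) by ring. rewrite <- Q. nra.
  - unfold L. lra.
  - unfold A. lra.
  - apply Hn.
    destruct (fourier_zero_peak phi a b x0 L n ltac:(unfold L, A; lra) Sphi H) as [S E].
    destruct (schwartz_decays _ S) as [B HB].
    pose proof (fourier_integral B _ k0 HB) as HI. rewrite (E k0 Hk0) in HI.
    pose proof (has_integral_comb z 0 _ _ _ _ HI HI) as HI2.
    apply has_integral_iff in HI2. destruct HI2 as [HI2 _].
    replace (z * 0 + 0 * 0)%C with (RtoC 0) in HI2 by ring.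
    match type of HI2 with is_RInt_gen ?u _ _ _ => match goal with |- is_RInt_gen ?u' _ _ _ =>
      replace u' with u; [exact HI2|] end end.
    apply functional_extensionality. intros x. unfold h. fold (peak x0 L x). clearbody z.
    transitivity (Re (RtoC (peak x0 L x ^ n) * (z * (wave k0 x * phi x)))%C).
    + apply (f_equal Re). ring.
    + generalize (z * (wave k0 x * phi x))%C (peak x0 L x ^ n). intros [p q] r. simpl. ring.
Qed.

(** The Baire argument on the line: nested closed intervals, the [j]-th step avoiding [Z j], have a
    common point by completeness. *)
Lemma avoid_nowhere_dense (Z : nat -> R -> Prop) :
  (forall j a b, a < b -> exists a' b', a <= a' /\ a' < b' /\ b' <= b /\ forall x, a' <= x <= b' -> ~ Z j x) ->
  exists y, forall j, ~ Z j y.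
Proof.
  intros H.
  set (St := {p : R * R | fst p < snd p}).
  assert (Next : forall (j : nat) (s : St), {s' : St | fst (proj1_sig s) <= fst (proj1_sig s') /\
    snd (proj1_sig s') <= snd (proj1_sig s) /\
    forall x, fst (proj1_sig s') <= x <= snd (proj1_sig s') -> ~ Z j x}).
  { intros j [[a b] Hab]. simpl in *. apply constructive_indefinite_description.
    destruct (H j a b Hab) as [a' [b' [H1 [H2 [H3 H4]]]]].
    exists (exist (fun p : R * R => fst p < snd p) (a', b') H2). simpl. auto. }
  set (I := fix I (n : nat) : St := match n with
    | O => exist (fun p : R * R => fst p < snd p) (0, 1) Rlt_0_1
    | S j => proj1_sig (Next j (I j)) end).
  set (lo := fun n => fst (proj1_sig (I n))). set (hi := fun n => snd (proj1_sig (I n))).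
  assert (Step : forall n, lo n <= lo (S n) /\ hi (S n) <= hi n /\ forall x, lo (S n) <= x <= hi (S n) -> ~ Z n x).
  { intros n. unfold lo, hi. simpl. exact (proj2_sig (Next n (I n))). }
  assert (LH : forall n, lo n < hi n) by (intros n; exact (proj2_sig (I n))).
  assert (Mlo : forall n k, lo n <= lo (n + k)%nat).
  { intros n k. induction k as [|k IH]; [rewrite Nat.add_0_r; lra|].
    rewrite Nat.add_succ_r. pose proof (proj1 (Step (n + k)%nat)). lra. }
  assert (Mhi : forall n k, hi (n + k)%nat <= hi n).
  { intros n k. induction k as [|k IH]; [rewrite Nat.add_0_r; lra|].
    rewrite Nat.add_succ_r. pose proof (proj1 (proj2 (Step (n + k)%nat))). lra. }
  assert (Cross : forall n k, lo n <= hi k).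
  { intros n k. destruct (Nat.le_ge_cases n k) as [E|E].
    - pose proof (Mlo n (k - n)%nat) as Q. replace (n + (k - n))%nat with k in Q by lia. pose proof (LH k). lra.
    - pose proof (Mhi k (n - k)%nat) as Q. replace (k + (n - k))%nat with n in Q by lia. pose proof (LH n). lra. }
  destruct (completeness (fun x => exists n, x = lo n)) as [y [Hy1 Hy2]].
  - exists (hi 0%nat). intros x [n ->]. apply Cross.
  - exists (lo 0%nat). exists 0%nat. reflexivity.
  - exists y. intros j. apply (proj2 (proj2 (Step j))). split.
    + apply Hy1. exists (S j). reflexivity.
    + apply Hy2. intros x [n ->]. apply Cross.
Qed.

(** The zero set of each translate is closed and contains no interval, hence is nowhere dense. *)
Lemma fourier_avoid_zeros (phi : R -> C) (r : nat -> R) :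
  Cc_infty phi -> (exists x, phi x <> 0) -> exists y, forall j, fourier phi (r j - y) <> 0.
Proof.
  intros Hphi Hx.
  destruct (avoid_nowhere_dense (fun j y => fourier phi (r j - y) = 0)) as [y Hy]; [|exists y; exact Hy].
  intros j a b Hab.
  destruct (fourier_nonzero_dense phi (r j - b) (r j - a) Hphi Hx ltac:(lra)) as [k [Hk Nk]].
  assert (Ck : continuous (fourier phi) k) by (apply smooth_continuous, fourier_smooth, Cc_infty_schwartz, Hphi).
  assert (P : 0 < Cmod (fourier phi k)) by (apply Cmod_gt_0, Nk).
  assert (Loc : locally k (fun u => fourier phi u <> 0)).
  { assert (P2 : 0 < Cmod (fourier phi k) / 2) by lra.
    pose proof (proj1 (continuous_C _ _) Ck) as [C1 C2].
    apply filter_imp with (2 := filter_and _ _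
      (proj1 (filterlim_locally _ _) C1 (mkposreal _ P2)) (proj1 (filterlim_locally _ _) C2 (mkposreal _ P2))).
    intros u [Hu1 Hu2] E. rewrite E in Hu1, Hu2.
    change (Rabs (0 - Re (fourier phi k)) < Cmod (fourier phi k) / 2) in Hu1.
    change (Rabs (0 - Im (fourier phi k)) < Cmod (fourier phi k) / 2) in Hu2.
    rewrite Rminus_0_l, Rabs_Ropp in Hu1, Hu2. pose proof (Cmod_le_Re_Im (fourier phi k)). lra. }
  destruct Loc as [d Hd].
  set (e := Rmin (d / 2) (Rmin (k - (r j - b)) (r j - a - k))).
  pose proof (cond_pos d).
  assert (e0 : 0 < e) by (repeat apply Rmin_glb_lt; lra).
  assert (e1 : e <= d / 2) by apply Rmin_l.
  assert (e2 : e <= k - (r j - b)) by (eapply Rle_trans; [apply Rmin_r | apply Rmin_l]).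
  assert (e3 : e <= r j - a - k) by (eapply Rle_trans; [apply Rmin_r | apply Rmin_r]).
  exists (r j - k - e), (r j - k + e). repeat split; try lra.
  intros x Hx'. apply Hd. change (Rabs (r j - x - k) < d).
  apply Rle_lt_trans with e; [apply Rabs_le; lra | lra].
Qed.

(** * Rationality *)

Lemma rational_plus u v : rational u -> rational v -> rational (u + v).
Proof.
  intros [p [q [Hq ->]]] [p' [q' [Hq' ->]]].
  exists (p * q' + p' * q)%Z, (q * q')%Z. split; [lia|].
  rewrite plus_IZR, !mult_IZR. field. split; apply not_0_IZR; assumption.
Qed.

Lemma rational_opp u : rational u -> rational (- u).
Proof.
  intros [p [q [Hq ->]]]. exists (- p)%Z, q. split; [exact Hq|].
  rewrite opp_IZR. field. apply not_0_IZR, Hq.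
Qed.

(** Infinite descent: both numbers are even, and halving both yields a smaller solution. *)
Lemma no_square_root_of_two (n : nat) : forall q : nat, (n * n = 2 * (q * q))%nat -> q = 0%nat.
Proof.
  induction n as [n IH] using lt_wf_ind. intros q H.
  destruct (Nat.eq_dec n 0) as [->|N0]; [nia|].
  destruct (Nat.Even_or_Odd n) as [[p Hp]|[p Hp]]; [|exfalso; nia].
  destruct (Nat.Even_or_Odd q) as [[r Hr]|[r Hr]]; [|exfalso; nia].
  assert (r = 0%nat) by (apply (IH p); nia). lia.
Qed.

Lemma sqrt2_irrational u v : rational u -> rational v -> sqrt 2 * u = v -> u = 0.
Proof.
  intros [p [q [Hq ->]]] [p' [q' [Hq' ->]]] H.
  pose proof (not_0_IZR q Hq) as Q. pose proof (not_0_IZR q' Hq') as Q'.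
  assert (E : ((p' * q) * (p' * q) = 2 * ((p * q') * (p * q')))%Z).
  { apply eq_IZR. rewrite !mult_IZR.
    assert (S : sqrt 2 * sqrt 2 = 2) by (apply sqrt_sqrt; lra).
    assert (E : IZR p' * IZR q = sqrt 2 * (IZR p * IZR q')).
    { apply Rmult_eq_reg_r with (/ (IZR q * IZR q')); [|apply Rinv_neq_0_compat; nra].
      replace (IZR p' * IZR q * / (IZR q * IZR q')) with (IZR p' / IZR q') by (field; auto).
      rewrite <- H. field; auto. }
    rewrite E. replace (sqrt 2 * (IZR p * IZR q') * (sqrt 2 * (IZR p * IZR q'))) with
      (sqrt 2 * sqrt 2 * (IZR p * IZR q' * (IZR p * IZR q'))) by ring.
    rewrite S. reflexivity. }
  assert (Z : Z.to_nat (Z.abs (p * q')) = 0%nat).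
  { apply (no_square_root_of_two (Z.to_nat (Z.abs (p' * q)))).
    apply Nat2Z.inj. rewrite !Nat2Z.inj_mul, !Z2Nat.id by lia.
    change (Z.of_nat 2) with 2%Z. rewrite <- !Z.abs_mul, E.
    rewrite !(Z.abs_eq (_ * _)%Z) by nia. reflexivity. }
  assert (p * q' = 0)%Z as Pz by lia.
  apply Z.mul_eq_0 in Pz. destruct Pz as [->|F]; [field; exact Q | contradiction].
Qed.

Lemma sqrt2_pos : 0 < sqrt 2.
Proof. apply sqrt_lt_R0. lra. Qed.

Lemma rational_small (d : R) : 0 < d -> exists r, 0 < r /\ rational r /\ sqrt 2 * r < d.
Proof.
  intros Hd. pose proof sqrt2_pos as S2.
  destruct (inv_INR_S_lt (d / sqrt 2)) as [N HN]; [apply Rdiv_lt_0_compat; assumption|].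
  specialize (HN N (Nat.le_refl N)).
  exists (/ INR (S N)). split; [apply Rinv_0_lt_compat, lt_0_INR; lia|]. split.
  - exists 1%Z, (Z.of_nat (S N)). split; [lia|]. rewrite INR_IZR_INZ. field. apply not_0_IZR. lia.
  - apply Rmult_lt_compat_l with (r := sqrt 2) in HN; [|exact S2].
    replace (sqrt 2 * (d / sqrt 2)) with d in HN by (field; lra). exact HN.
Qed.

(** * The choice of the parameters *)

Definition bsum (b : nat -> R) (n : nat) : R := fold_right (fun k s => b k + s) 0 (seq 0 n).

Lemma bsum_S b n : bsum b (S n) = bsum b n + b n.
Proof.
  unfold bsum. rewrite seq_S, fold_right_app. simpl.
  generalize (seq 0 n). intros l. induction l as [|x l IH]; simpl; [ring | rewrite IH; ring].
Qed.

(** [a k * K k] will bound the [k]-th block whatever its shift, so the demand on [a n] involves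
    earlier weights only and is met by recursion. The state carries the running sum together with
    the current weight. *)
Lemma recursive_weights (K : nat -> R) (F : nat -> R -> R) :
  exists a : nat -> R, (forall n, INR n < a n) /\ (forall n, a n < a (S n)) /\
    forall n, F n (bsum (fun k => a k * K k) n) <= a n.
Proof.
  set (st := fix st (n : nat) : R * R := match n with
    | O => (0, Rmax 1 (F 0%nat 0))
    | S k => (fst (st k) + snd (st k) * K k,
              Rmax (snd (st k) + 1) (F (S k) (fst (st k) + snd (st k) * K k))) end).
  assert (B : forall n, fst (st n) = bsum (fun k => snd (st k) * K k) n).
  { induction n as [|n IH]; [reflexivity|]. rewrite bsum_S, <- IH. reflexivity. }
  exists (fun n => snd (st n)). split; [|split].
  - induction n as [|n IH]; simpl snd.
    + simpl. eapply Rlt_le_trans; [|apply Rmax_l]. lra.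
    + rewrite S_INR. eapply Rlt_le_trans; [|apply Rmax_l]. lra.
  - intros n. simpl snd at 2. eapply Rlt_le_trans; [|apply Rmax_l]. lra.
  - intros n. rewrite <- B. destruct n as [|n]; apply Rmax_r.
Qed.

(** At stage [n + 1] the shift must lie below a threshold that depends on the range [s n] of the
    arguments already used, and only then is [s (n + 1)] obtained. Monotonicity of [P] in [s] lets
    the ranges increase, so a shift respects all earlier arguments at once. *)
Lemma dependent_shifts (delta : nat -> R -> R) (P : nat -> R -> R -> Prop) :
  (forall n s, 0 < delta n s) ->
  (forall n t s s', s <= s' -> P n t s -> P n t s') ->
  (forall n t s, 0 < t < delta n s -> exists s', P n t s') ->
  exists r s : nat -> R,
    (forall n, 0 < r n /\ rational (r n)) /\ (forall n, r (S n) < r n) /\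
    (forall n, s n <= s (S n)) /\ (forall n, exists s0, sqrt 2 * r n < delta n s0) /\
    (forall n, sqrt 2 * r (S n) < delta (S n) (s n)) /\ (forall n, P n (sqrt 2 * r n) (s n)).
Proof.
  intros Hd Hmono HP. pose proof sqrt2_pos as S2.
  set (good := fun (n : nat) (p : R * R) => 0 < fst p /\ rational (fst p) /\
     (exists s0, sqrt 2 * fst p < delta n s0) /\ P n (sqrt 2 * fst p) (snd p)).
  assert (Start : {p : R * R | good 0%nat p}).
  { apply constructive_indefinite_description.
    destruct (rational_small (delta 0%nat 0) (Hd _ _)) as [r [R0 [Rr Rd]]].
    destruct (HP 0%nat (sqrt 2 * r) 0) as [s Hs]; [split; [nra | exact Rd]|].
    exists (r, s). unfold good; simpl. eauto. }
  assert (Next : forall n (p : {p : R * R | good n p}), {p' : R * R | good (S n) p' /\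
    fst p' < fst (proj1_sig p) /\ snd (proj1_sig p) <= snd p' /\
    sqrt 2 * fst p' < delta (S n) (snd (proj1_sig p))}).
  { intros n [[r s] [R0 [Rr [Rd Rs]]]]. simpl in *. apply constructive_indefinite_description.
    destruct (rational_small (Rmin (delta (S n) s) (sqrt 2 * r))) as [r' [R0' [Rr' Rd']]].
    { apply Rmin_glb_lt; [apply Hd | nra]. }
    pose proof (Rmin_l (delta (S n) s) (sqrt 2 * r)). pose proof (Rmin_r (delta (S n) s) (sqrt 2 * r)).
    destruct (HP (S n) (sqrt 2 * r') s) as [s' Hs']; [split; [nra | lra]|].
    exists (r', Rmax s s'). unfold good; simpl. repeat split; auto.
    - exists s. lra.
    - apply Hmono with (2 := Hs'). apply Rmax_r.
    - apply Rmult_lt_reg_l with (sqrt 2); lra.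
    - apply Rmax_l.
    - lra. }
  set (I := fix I (n : nat) : {p : R * R | good n p} := match n with
    | O => Start
    | S k => exist _ (proj1_sig (Next k (I k))) (proj1 (proj2_sig (Next k (I k)))) end).
  exists (fun n => fst (proj1_sig (I n))), (fun n => snd (proj1_sig (I n))).
  assert (G : forall n, good n (proj1_sig (I n))) by (intros n; apply (proj2_sig (I n))).
  assert (Q := fun n => proj2 (proj2_sig (Next n (I n)))).
  split; [intros n; split; apply (G n)|].
  split; [intros n; apply (Q n)|]. split; [intros n; apply (Q n)|].
  split; [intros n; apply (G n)|]. split; [intros n; apply (Q n)|]. intros n; apply (G n).
Qed.

(** * The eigenvalue equation on Schwartz functions *)

Lemma lattice_sum_tempered (c : R -> C) (m : nat) : (0 < m)%nat -> (forall x, Cmod (c x) <= 1) ->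
  tempered_distribution (lattice_sum c m).
Proof.
  intros Hm Hc. split.
  - intros a b f g Hf Hg.
    destruct (schwartz_decays f Hf) as [B [_ HB]]. destruct (schwartz_decays g Hg) as [B' [_ HB']].
    apply (lattice_sum_comb c m Hm Hc a b f g B B' HB HB').
  - exists 2%nat, (2 * lat_mass m). intros f B Hf HB.
    replace (2 * lat_mass m * B) with (2 * B * lat_mass m) by ring.
    apply lattice_sum_bound; auto. apply (schwartz_bound_decays 2 B f); auto. apply Hf.
Qed.

Lemma tempered_scal (z : C) (T : functional) : tempered_distribution T -> tempered_distribution (mscal z T).
Proof.
  intros [L [N [M HM]]]. split.
  - intros a b f g Hf Hg. unfold mscal. rewrite L by assumption. ring.
  - exists N, (Cmod z * M). intros f B Hf HB. unfold mscal. rewrite Cmod_mult, Rmult_assoc.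
    apply Rmult_le_compat_l; [apply Cmod_ge_0 | auto].
Qed.

(** The equation is given for some tempered [T], against test functions only. Uniqueness identifies
    [T] with the lattice sum and [FT T] with [lambda] times the lattice sum on all Schwartz
    functions. *)
Lemma lattice_sum_eigen (lambda : C) (c : R -> C) (m : nat) (mu : functional) :
  has_test_function -> (0 < m)%nat -> (forall x, Cmod (c x) <= 1) ->
  (forall x, c x <> 0 -> exists z : Z, x = IZR z / INR m) ->
  discrete c mu -> has_fourier mu (mscal lambda mu) ->
  forall g, schwartz g -> lattice_sum c m (fourier g) = (lambda * lattice_sum c m g)%C.
Proof.
  intros Ht Hm Hc HL D [T [[TT Ta] [FTt FTa]]] g Hg.
  pose proof (lattice_sum_tempered c m Hm Hc) as LT.
  assert (LM : forall f, Cc_infty f -> lattice_sum c m f = mu f).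
  { intros f Hf. apply lattice_sum_measure; auto. apply Cc_infty_Cc, Hf. }
  assert (E1 : agree_on schwartz T (lattice_sum c m)).
  { apply tempered_unique; auto. intros f Hf. rewrite Ta, LM; auto. }
  assert (E2 : agree_on schwartz (FT T) (mscal lambda (lattice_sum c m))).
  { apply tempered_unique; auto using tempered_scal.
    intros f Hf. rewrite FTa by exact Hf. unfold mscal. rewrite LM; auto. }
  rewrite <- E1 by (apply fourier_schwartz, Hg). apply (E2 g Hg).
Qed.

(** * Failure of temperedness of the total variation *)

Lemma pow2_unbounded (K : R) : exists j : nat, K < 2 ^ j.
Proof.
  destruct (nfloor_ex (Rabs K) (Rabs_pos K)) as [n [_ Hn]]. exists n.
  apply Rle_lt_trans with (1 := Rle_abs K). apply Rlt_le_trans with (1 := Hn).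
  pose proof (poly n 1 Rlt_0_1) as P. replace (1 + 1) with 2 in P by ring. lra.
Qed.

(** A bump translated to [p n] has Schwartz norms growing like a fixed power of [p n], while its
    total variation integral is at least the mass at [p n], which outgrows every power. *)
Lemma total_variation_not_tempered (c : R -> C) (eta : functional) (p : nat -> R) :
  has_test_function -> discrete c eta -> (forall n, (2 + Rabs (p n)) ^ n <= Cmod (c (p n))) ->
  ~ tempered (total_variation eta).
Proof.
  intros [phi [Hphi [x0 Hx0]]] D Hp [T [[_ [N [M HM]]] Ta]].
  pose proof (discrete_measure c eta D) as Hmeas.
  pose proof (sqmod_pos phi x0 Hx0) as Q0.
  (* Normalized to the value 2 at the origin, so that [h >= 1] nearby and narrow tents lie below
     it. *)
  set (h := fun x => 2 / sqmod phi x0 * sqmod phi (1 * x + x0)).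
  assert (Hh : Cc_infty (fun x => RtoC (h x))).
  { unfold h. replace (fun x => RtoC (2 / sqmod phi x0 * sqmod phi (1 * x + x0))) with
      (fun x => (RtoC (2 / sqmod phi x0) * RtoC (sqmod phi (1 * x + x0)%R))%C)
      by (apply functional_extensionality; intros; symmetry; apply RtoC_mult).
    apply (Cc_infty_mult (fun _ => RtoC (2 / sqmod phi x0))); [apply smooth_const|].
    apply (Cc_infty_comp_affine (fun x => RtoC (sqmod phi x)) 1 x0); [apply Rabs_R1 | apply sqmod_Cc_infty, Hphi]. }
  assert (h0 : forall x, 0 <= h x).
  { intros x. apply Rmult_le_pos; [left; apply Rdiv_lt_0_compat; lra | apply sqmod_nonneg]. }
  assert (Hc : continuous h 0).
  { apply (proj1 (continuous_C (fun x => RtoC (h x)) 0)). apply smooth_continuous, Hh. }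
  assert (h2 : h 0 = 2).
  { unfold h. replace (1 * 0 + x0) with x0 by ring. field. lra. }
  destruct (proj1 (filterlim_locally _ _) Hc (mkposreal 1 Rlt_0_1)) as [d Hd].
  assert (h1 : forall x, Rabs x < d -> 1 <= h x).
  { intros x Hx. assert (Hb : ball 0 d x) by (change (Rabs (x - 0) < d); rewrite Rminus_0_r; exact Hx).
    specialize (Hd x Hb). change (Rabs (h x - h 0) < 1) in Hd. rewrite h2 in Hd. apply Rabs_def2 in Hd. lra. }
  destruct (proj2 (Cc_infty_schwartz _ Hh) N) as [B HB].
  set (f := fun n x => RtoC (h (1 * x + - p n))).
  assert (Sf : forall n, Cc_infty (f n)).
  { intros n. apply (Cc_infty_comp_affine (fun x => RtoC (h x)) 1 (- p n)); [apply Rabs_R1 | exact Hh]. }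
  assert (Up : forall n, Cmod (T (f n)) <= M * ((2 * (1 + Rabs (p n))) ^ N * (B + B))).
  { intros n. apply HM; [apply Cc_infty_schwartz, Sf|].
    rewrite <- (Rabs_Ropp (p n)).
    apply (schwartz_bound_comp_affine N B (fun x => RtoC (h x)) 1 (- p n)); [apply Rabs_R1 | apply Hh | exact HB]. }
  assert (Low : forall n, Cmod (c (p n)) <= Cmod (T (f n))).
  { intros n. rewrite Ta by apply Sf. unfold f.
    rewrite total_variation_nonneg by auto.
    rewrite Cmod_RtoC. eapply Rle_trans; [|apply Rle_abs].
    destruct (proj2 (Sf n)) as [A HA]. destruct (proj2 Hmeas A) as [M' HM'].
    destruct (Cc_infty_derivatives_bounded _ 0 (Sf n)) as [B' HB'].
    destruct (tv_pos_lub eta (fun x => h (1 * x + - p n)) (M' * B') Hmeas) as [T1 _].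
    - auto.
    - intros g Hg Hb. apply HM'; auto.
      + intros x Hx. apply Cmod_zero. eapply Rle_trans; [apply Hb|].
        specialize (HA x Hx). unfold f in HA. apply (f_equal Re) in HA. simpl in HA. simpl. lra.
      + intros x. eapply Rle_trans; [apply Hb|]. specialize (HB' x). rewrite CDerive_n_0 in HB'.
        unfold f in HB'. rewrite Cmod_RtoC in HB'. eapply Rle_trans; [apply Rle_abs | exact HB'].
    - destruct (discrete_tent c eta D (p n)) as [N1 H1].
      destruct (inv_INR_S_lt d (cond_pos d)) as [N2 H2].
      rewrite <- (H1 (Nat.max N1 N2)) by lia.
      apply T1; [apply tent_Cc|]. intros x.
      destruct (Rlt_le_dec (Rabs (x - p n)) d) as [E|E].
      + apply Rle_trans with 1.
        * unfold tent. rewrite Cmod_RtoC, Rabs_right; [apply tent_le_1 | apply Rle_ge, tent_le_1].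
        * apply h1. replace (1 * x + - p n) with (x - p n) by ring. exact E.
      + rewrite tent_far, Cmod_0; [apply h0|]. specialize (H2 (Nat.max N1 N2) ltac:(lia)). lra. }
  (* At index [N + j], the first [N] factors absorb the growth of the norms, and the remaining ones,
     at least [2 ^ j], exceed the constant. *)
  destruct (pow2_unbounded (M * 2 ^ N * (B + B))) as [j Hj].
  specialize (Up (N + j)%nat). specialize (Low (N + j)%nat). specialize (Hp (N + j)%nat).
  set (P := Rabs (p (N + j)%nat)) in *.
  assert (P0 : 0 <= P) by apply Rabs_pos.
  assert (PN : 0 < (2 + P) ^ N) by (apply pow_lt; lra).
  assert (B0 : 0 <= B) by (eapply schwartz_bound_nonneg; eassumption).
  rewrite pow_add in Hp.
  assert (2 ^ j <= (2 + P) ^ j) by (apply pow_incr; lra).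
  assert (J0 : 0 < 2 ^ j) by (apply pow_lt; lra).
  assert (E1 : (2 + P) ^ N * 2 ^ j <= M * ((2 * (1 + P)) ^ N * (B + B))).
  { eapply Rle_trans; [|exact Up]. eapply Rle_trans; [|exact Low]. eapply Rle_trans; [|exact Hp].
    apply Rmult_le_compat_l; lra. }
  assert (E2 : (2 * (1 + P)) ^ N <= 2 ^ N * (2 + P) ^ N).
  { rewrite <- Rpow_mult_distr. apply pow_incr. lra. }
  assert (Q1 : 0 < (2 * (1 + P)) ^ N) by (apply pow_lt; lra).
  assert (E3 : M * ((2 * (1 + P)) ^ N * (B + B)) <= (2 + P) ^ N * (M * 2 ^ N * (B + B)) \/
    M * ((2 * (1 + P)) ^ N * (B + B)) <= 0).
  { destruct (Rle_lt_dec 0 M) as [M0|M0].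
    - left. replace ((2 + P) ^ N * (M * 2 ^ N * (B + B))) with (M * (2 ^ N * (2 + P) ^ N * (B + B))) by ring.
      apply Rmult_le_compat_l; [exact M0|]. apply Rmult_le_compat_r; lra.
    - right. assert (0 <= (2 * (1 + P)) ^ N * (B + B)) by (apply Rmult_le_pos; lra). nra. }
  assert (0 < (2 + P) ^ N * 2 ^ j) by (apply Rmult_lt_0_compat; assumption).
  destruct E3 as [E3|E3]; [|lra].
  assert ((2 + P) ^ N * (M * 2 ^ N * (B + B)) < (2 + P) ^ N * 2 ^ j) by (apply Rmult_lt_compat_l; assumption).
  lra.
Qed.

(** * Convolutions as superpositions of waves *)

(** An almost period for error 1 moves any point into the compact interval [[0, L]]. *)
Lemma bohr_bounded (u : R -> C) : bohr_almost_periodic u -> bounded u.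
Proof.
  intros [Hc H]. destruct (H 1 Rlt_0_1) as [L [HL Ht]].
  destruct (continuous_bounded_on u 0 L Hc) as [B HB].
  exists (B + 1). intros x. destruct (Ht (- x)) as [tau [Htau Hd]].
  specialize (Hd x). specialize (HB (x + tau) ltac:(lra)).
  replace (u x) with (u (x + tau)%R - (u (x + tau)%R - u x))%C by ring.
  eapply Rle_trans; [apply Cmod_triangle|]. rewrite Cmod_opp. lra.
Qed.

(** The price of testing at the argument [s]: Schwartz norms of a modulated function grow like a
    power of [s]. It decides how small later shifts must be. *)
Definition wave_bound (B s : R) : R := 2 ^ 3 * (2 * (1 + 2 * PI * s) ^ 3 * B).

Lemma wave_schwartz_bound (v : R -> C) (B s S : R) : smooth v -> schwartz_bound 4 B v -> Rabs s <= S ->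
  schwartz_bound 3 (wave_bound B S) (fun x => (wave s x * v x)%C).
Proof.
  intros Sv HB Hs. pose proof PI_RGT_0 as P. pose proof (Rabs_pos s) as S0.
  assert (X : 0 <= 2 * PI * S) by (apply Rmult_le_pos; lra).
  assert (Ew : wave s = fun x => cis (- (2 * PI * s) * x + 0))
    by (apply functional_extensionality; intros; apply wave_affine).
  apply schwartz_bound_mult_linear; auto.
  - rewrite Ew. apply smooth_cis.
  - apply pow_le. lra.
  - intros j x Hj. rewrite Ew, cis_derivatives, Cmod_mult, Cmod_cis, Rmult_1_r, Cmod_pow, Cmod_mult, Cmod_Ci, Rmult_1_r, Cmod_RtoC.
    rewrite Rabs_Ropp, !Rabs_mult, (Rabs_right 2), (Rabs_right PI) by lra.
    assert (Y : 0 <= 2 * PI * Rabs s <= 2 * PI * S).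
    { split; [apply Rmult_le_pos; lra | apply Rmult_le_compat_l; lra]. }
    apply Rle_trans with ((1 + 2 * PI * S) ^ 3).
    + apply Rle_trans with ((1 + 2 * PI * S) ^ j); [apply pow_incr; lra | apply Rle_pow; [lra | exact Hj]].
    + assert (0 <= (1 + 2 * PI * S) ^ 3) by (apply pow_le; lra). pose proof (Rabs_pos x). nra.
Qed.

(** With the eigenvalue equation this turns the convolution at [s] into the pairing with the wave of
    parameter [s] times a fixed function, up to a unimodular factor. *)
Lemma fourier_reflected_translate (psi : R -> C) (s : R) : schwartz psi ->
  fourier (fun x => psi (s - x)) = fun x => (wave s x * fourier psi (- x))%C.
Proof.
  intros Hpsi. apply functional_extensionality. intros k.
  destruct (schwartz_decays psi Hpsi) as [B HB].
  assert (HR : schwartz (fun x => psi (- x))).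
  { replace (fun x => psi (- x)) with (fun x => psi (-1 * x + 0)).
    - apply schwartz_comp_affine; [rewrite Rabs_left; lra | exact Hpsi].
    - apply functional_extensionality. intros x. f_equal. ring. }
  destruct (schwartz_decays _ HR) as [B' HB'].
  replace (fun x => psi (s - x)) with (fun x => psi (- (x + - s)))
    by (apply functional_extensionality; intros; f_equal; ring).
  pose proof (fourier_modulate B' _ k (- s) HB') as E. cbv beta in E. rewrite <- E.
  rewrite (fourier_reflect B) by exact HB. f_equal. unfold wave. f_equal. ring.
Qed.

(** The [n]-th term is isolated by the triangle inequality; the 2 is the sum of the whole geometric
    series. *)
Lemma series_peak (u : nat -> C) (b : nat -> R) (n : nat) (X : R) :
  (forall k, (k < n)%nat -> Cmod (u k) <= b k) ->
  (forall k, (n < k)%nat -> Cmod (u k) <= (1 / 2) ^ k) ->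
  X <= Cmod (u n) -> X - bsum b n - 2 <= Cmod (CSeries u).
Proof.
  intros H1 H2 HX.
  set (u1 := fun k => if Nat.ltb k n then u k else RtoC 0).
  set (u2 := fun k => if Nat.eqb k n then u k else RtoC 0).
  set (u3 := fun k => if Nat.ltb n k then u k else RtoC 0).
  assert (Z1 : forall k, (n <= k)%nat -> u1 k = 0).
  { intros k Hk. unfold u1. rewrite (proj2 (Nat.ltb_ge k n)) by exact Hk. reflexivity. }
  assert (Z2 : forall k, k <> n -> u2 k = 0).
  { intros k Hk. unfold u2. rewrite (proj2 (Nat.eqb_neq k n)) by exact Hk. reflexivity. }
  assert (B3 : forall k, Cmod (u3 k) <= (1 / 2) ^ k).
  { intros k. unfold u3. destruct (Nat.ltb n k) eqn:E.
    - apply H2, Nat.ltb_lt, E.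
    - rewrite Cmod_0. apply pow_le. lra. }
  assert (S1 : Csummable u1) by (apply Csummable_finite with n; exact Z1).
  assert (S2 : Csummable u2) by (apply Csummable_finite with (S n); intros k Hk; apply Z2; lia).
  assert (S3 : Csummable u3) by (apply Csummable_le with (1 := B3); apply ex_series_half).
  assert (E : CSeries u = (CSeries u1 + u n + CSeries u3)%C).
  { rewrite <- (CSeries_ext (fun k => (u1 k + u2 k + u3 k)%C) u).
    - rewrite CSeries_plus, CSeries_plus by auto using Csummable_plus.
      rewrite (CSeries_single u2 n) by exact Z2. unfold u2 at 1. rewrite Nat.eqb_refl. reflexivity.
    - intros k. unfold u1, u2, u3.
      destruct (Nat.lt_trichotomy k n) as [L|[->|L]].
      + rewrite (proj2 (Nat.ltb_lt k n)), (proj2 (Nat.eqb_neq k n)), (proj2 (Nat.ltb_ge n k)) by lia. ring.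
      + rewrite Nat.ltb_irrefl, Nat.eqb_refl. ring.
      + rewrite (proj2 (Nat.ltb_ge k n)), (proj2 (Nat.eqb_neq k n)), (proj2 (Nat.ltb_lt n k)) by lia. ring. }
  assert (C1 : Cmod (CSeries u1) <= bsum b n).
  { rewrite (CSeries_finite u1 n Z1). apply lsum_bound. intros k Hk. apply in_seq in Hk.
    unfold u1. rewrite (proj2 (Nat.ltb_lt k n)) by lia. apply H1. lia. }
  assert (C3 : Cmod (CSeries u3) <= 2).
  { rewrite <- Series_half. apply CSeries_bound; [exact B3 | apply ex_series_half]. }
  assert (T : Cmod (u n) <= Cmod (CSeries u) + Cmod (CSeries u1) + Cmod (CSeries u3)).
  { replace (u n) with (CSeries u - CSeries u1 - CSeries u3)%C by (rewrite E; ring).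
    eapply Rle_trans; [apply Cmod_triangle|]. rewrite Cmod_opp. apply Rplus_le_compat_r.
    eapply Rle_trans; [apply Cmod_triangle|]. rewrite Cmod_opp. lra. }
  lra.
Qed.

Lemma half_continuity (g : R -> C) (x : R) : continuous g x -> g x <> 0 ->
  exists d, 0 < d /\ forall u, Rabs (u - x) < d -> Cmod (g x) / 2 <= Cmod (g u).
Proof.
  intros Hc Hx. apply Cmod_gt_0 in Hx.
  assert (P : 0 < Cmod (g x) / 4) by lra.
  pose proof (proj1 (continuous_C _ _) Hc) as [C1 C2].
  destruct (filter_and _ _ (proj1 (filterlim_locally _ _) C1 (mkposreal _ P))
    (proj1 (filterlim_locally _ _) C2 (mkposreal _ P))) as [d Hd].
  exists d. split; [apply cond_pos|]. intros u Hu. destruct (Hd u Hu) as [H1 H2].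
  change (Rabs (Re (g u) - Re (g x)) < Cmod (g x) / 4) in H1.
  change (Rabs (Im (g u) - Im (g x)) < Cmod (g x) / 4) in H2.
  pose proof (Cmod_le_Re_Im (g u - g x)%C) as L.
  change (Cmod (g u - g x)%C <= Rabs (Re (g u) - Re (g x)) + Rabs (Im (g u) - Im (g x))) in L.
  assert (T : Cmod (g x) <= Cmod (g u) + Cmod (g u - g x)%C).
  { replace (g x) with (g u - (g u - g x))%C at 1 by ring.
    eapply Rle_trans; [apply Cmod_triangle|]. rewrite Cmod_opp. lra. }
  lra.
Qed.

(* The shifts are rational multiples of sqrt 2, so the points of the shifted lattices are
   separated by irrationality alone. *)
Section Separation.
Variables (c : nat -> R -> C) (yn r : nat -> R).
Hypotheses (Hc : forall n x, c n x <> 0 -> rational x) (Hy : forall n, rational (yn n))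
  (Hr : forall n, 0 < r n /\ rational (r n)) (Hdec : forall n, r (S n) < r n).

Lemma shifts_injective i j : r i = r j -> i = j.
Proof.
  assert (L : forall i d, r (i + S d)%nat < r i).
  { clear i. intros i d. induction d as [|d IH].
    - rewrite Nat.add_1_r. apply Hdec.
    - rewrite Nat.add_succ_r. specialize (Hdec (i + S d)%nat). lra. }
  intros E. destruct (Nat.lt_trichotomy i j) as [H|[H|H]]; [|exact H|]; exfalso.
  - specialize (L i (j - i - 1)%nat). replace (i + S (j - i - 1))%nat with j in L by lia. lra.
  - specialize (L j (i - j - 1)%nat). replace (j + S (i - j - 1))%nat with i in L by lia. lra.
Qed.

Lemma rational_dir_a i n : rational (dir_a i (r n)).
Proof.
  destruct i as [|[|[|i]]]; simpl; try apply Hr; try (exists 0%Z, 1%Z; split; [lia | field]).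
  apply rational_opp, Hr.
Qed.

Lemma dir_a_scal i x : dir_a i (sqrt 2 * x) = sqrt 2 * dir_a i x.
Proof. destruct i as [|[|[|i]]]; simpl; ring. Qed.

Lemma irrational_point u w j : rational u -> rational w -> c j (u + sqrt 2 * w) <> 0 -> w = 0.
Proof.
  intros Hu Hw H. apply Hc in H. apply (sqrt2_irrational w ((u + sqrt 2 * w) + - u) Hw); [|ring].
  apply rational_plus; [exact H | apply rational_opp, Hu].
Qed.

(** An atom at a rational number plus [sqrt 2 * w], with [w] rational, forces [w = 0]. Here
    [w = dir_a i (r j) - r n], and as all [r] are positive and distinct this leaves only the forward
    translation of the [n]-th block. *)
Lemma mass_plus_zero n j i : c j (yn n - sqrt 2 * r n + dir_a i (sqrt 2 * r j)) <> 0 -> i = 0%nat /\ j = n.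
Proof.
  rewrite dir_a_scal. intros H.
  assert (W : dir_a i (r j) + - r n = 0).
  { apply (irrational_point (yn n) _ j); [apply Hy | |].
    - apply rational_plus; [apply rational_dir_a | apply rational_opp, Hr].
    - replace (yn n + sqrt 2 * (dir_a i (r j) + - r n)) with (yn n - sqrt 2 * r n + sqrt 2 * dir_a i (r j)) by ring.
      exact H. }
  pose proof (proj1 (Hr n)). pose proof (proj1 (Hr j)).
  destruct i as [|[|[|i]]]; simpl in W; try lra. split; [reflexivity|]. apply shifts_injective. lra.
Qed.

(** Now [w = dir_a i (r j) + r n], which only a backward translation can cancel. *)
Lemma mass_minus_zero n j i : c j (- yn n + sqrt 2 * r n + dir_a i (sqrt 2 * r j)) <> 0 -> i = 2%nat.
Proof.
  rewrite dir_a_scal. intros H.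
  assert (W : dir_a i (r j) + r n = 0).
  { apply (irrational_point (- yn n) _ j); [apply rational_opp, Hy | |].
    - apply rational_plus; [apply rational_dir_a | apply Hr].
    - replace (- yn n + sqrt 2 * (dir_a i (r j) + r n)) with (- yn n + sqrt 2 * r n + sqrt 2 * dir_a i (r j)) by ring.
      exact H. }
  pose proof (proj1 (Hr n)). pose proof (proj1 (Hr j)).
  destruct i as [|[|[|i]]]; simpl in W; try lra. reflexivity.
Qed.

Lemma block_mass_plus (a : nat -> R) (q : nat -> C) (n j : nat) : c n (yn n) = 1 ->
  block_mass (c j) (a j) (sqrt 2 * r j) q (yn n - sqrt 2 * r n) =
    if Nat.eq_dec j n then (RtoC (a n) * q 0%nat)%C else RtoC 0.
Proof.
  intros H1.
  assert (Z : forall i, (i <> 0%nat \/ j <> n) -> c j (yn n - sqrt 2 * r n + dir_a i (sqrt 2 * r j)) = 0).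
  { intros i Hi. apply NNPP. intros F. destruct (mass_plus_zero n j i F). tauto. }
  (* Direction 1 is a pure modulation, so its translation part is 0 and the same fact covers the
     unshifted comb. *)
  assert (Z0 : c j (yn n - sqrt 2 * r n) = 0).
  { rewrite <- (Z 1%nat) by (left; lia). f_equal. simpl. ring. }
  unfold block_mass. cbn [lsum fold_right four]. rewrite Z0.
  rewrite (Z 1%nat), (Z 2%nat), (Z 3%nat) by (left; lia).
  destruct (Nat.eq_dec j n) as [->|E].
  - simpl dir_a. simpl dir_b.
    replace (yn n - sqrt 2 * r n + sqrt 2 * r n) with (yn n) by ring.
    rewrite H1. replace (2 * PI * 0 * yn n) with 0 by ring. rewrite cis_0. ring.
  - rewrite (Z 0%nat) by (right; exact E). ring.
Qed.

(** Sigma and its first transform have no weight on the backward translation, the only direction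
    that could reach [- y_n + t_n]. *)
Lemma block_mass_minus (a : nat -> R) (q : nat -> C) (n j : nat) : q 2%nat = 0 ->
  block_mass (c j) (a j) (sqrt 2 * r j) q (- yn n + sqrt 2 * r n) = 0.
Proof.
  intros H2.
  assert (Z : forall i, i <> 2%nat -> c j (- yn n + sqrt 2 * r n + dir_a i (sqrt 2 * r j)) = 0).
  { intros i Hi. apply NNPP. intros F. apply Hi, (mass_minus_zero n j i F). }
  assert (Z0 : c j (- yn n + sqrt 2 * r n) = 0).
  { rewrite <- (Z 1%nat) by lia. f_equal. simpl. ring. }
  unfold block_mass. cbn [lsum fold_right four]. rewrite Z0, H2.
  rewrite (Z 0%nat), (Z 1%nat), (Z 3%nat) by lia. ring.
Qed.

Lemma Theta_mass_plus (a : nat -> R) (q : nat -> C) (n : nat) : c n (yn n) = 1 ->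
  Theta_mass c a (fun j => sqrt 2 * r j) q (yn n - sqrt 2 * r n) = (RtoC (a n) * q 0%nat)%C.
Proof.
  intros H1. unfold Theta_mass. rewrite (CSeries_single _ n).
  - rewrite block_mass_plus by exact H1. destruct (Nat.eq_dec n n); [reflexivity | contradiction].
  - intros j Hj. rewrite block_mass_plus by exact H1. destruct (Nat.eq_dec j n); [contradiction | reflexivity].
Qed.

Lemma Theta_mass_minus (a : nat -> R) (q : nat -> C) (n : nat) : q 2%nat = 0 ->
  Theta_mass c a (fun j => sqrt 2 * r j) q (- yn n + sqrt 2 * r n) = 0.
Proof.
  intros H2. unfold Theta_mass. rewrite (CSeries_finite _ 0); [reflexivity|].
  intros j _. apply block_mass_minus, H2.
Qed.

End Separation.

(** * Identification of the two series, and the joint choice of all parameters *)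

(** The weights of sigma: forward translations only. *)
Definition unit_weight (i : nat) : C := match i with O => RtoC 1 | _ => RtoC 0 end.

Lemma block_translate_difference (c : R -> C) (m : nat) (a t : R) (mu : functional) f : (0 < m)%nat ->
  (forall x, c x <> 0 -> exists z : Z, x = IZR z / INR m) -> discrete c mu -> Cc f ->
  block c m a t unit_weight f = mscal (RtoC a) (msub (mtranslate t mu) mu) f.
Proof.
  intros Hm HL D Hf. unfold block, mscal, msub, mtranslate. f_equal. simpl.
  unfold shift_diff. rewrite !(lattice_sum_measure c m Hm mu) by auto using weyl_Cc.
  replace (weyl t 0 f) with (fun x => f (x - t)); [ring|].
  apply functional_extensionality. intros x. unfold weyl.
  replace (2 * PI * 0 * x) with 0 by ring. rewrite cis_0. ring.
Qed.

Lemma block_modulation_difference (lambda : C) (c : R -> C) (m : nat) (a t : R) (mu : functional) f : (0 < m)%nat ->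
  (forall x, c x <> 0 -> exists z : Z, x = IZR z / INR m) -> discrete c mu -> Cc f ->
  block c m a t (qshift lambda unit_weight) f =
    (lambda * mscal (RtoC a) (mdens (fun x => Cminus (cis (2 * PI * x * t)) (RtoC 1)) mu) f)%C.
Proof.
  intros Hm HL D Hf. unfold block, mscal, mdens. simpl.
  unfold shift_diff. rewrite !(lattice_sum_measure c m Hm mu) by auto using weyl_Cc.
  replace (fun x => ((cis (2 * PI * x * t) - 1) * f x)%C) with (fun x => (weyl 0 t f x - f x)%C).
  - rewrite (linear_on_sub mu (weyl 0 t f) f); [ring | apply discrete_linear with c; exact D | apply weyl_Cc, Hf | exact Hf].
  - apply functional_extensionality. intros x. unfold weyl. rewrite Rminus_0_r.
    replace (2 * PI * x * t) with (2 * PI * t * x) by ring. ring.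
Qed.

Lemma is_lim_seq_sum_ge_1 (u : nat -> R) : (forall n, 1 <= u n) -> is_lim_seq (sum_n u) p_infty.
Proof.
  intros H. apply (is_lim_seq_le_p_loc INR); [|apply is_lim_seq_INR].
  exists 0%nat. intros n _. induction n as [|n IH].
  - rewrite sum_O. specialize (H 0%nat). simpl. lra.
  - rewrite sum_Sn, S_INR. specialize (H (S n)). change plus with Rplus. lra.
Qed.

Lemma lattice_rational (m : nat) (z : Z) : (0 < m)%nat -> rational (IZR z / INR m).
Proof. intros Hm. exists z, (Z.of_nat m). rewrite <- INR_IZR_INZ. split; [lia | reflexivity]. Qed.

(* The weights a_n are fixed first; t_n is then chosen small in terms of the arguments at which
   the first n blocks of the convolution have been made large, so that later blocks do not
   disturb them. *)
Lemma construction (c : nat -> R -> C) (m : nat -> nat) (yn : nat -> R) (v g : R -> C) (q1 q2 : nat -> C) :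
  (forall n, (0 < m n)%nat) -> (forall n x, Cmod (c n x) <= 1) ->
  (forall n x, c n x <> 0 -> exists z : Z, x = IZR z / INR (m n)) ->
  (forall n, rational (yn n)) -> (forall n, c n (yn n) = 1) ->
  schwartz v -> (forall n, v (yn n) <> 0) ->
  (forall x, continuous g x) -> (forall n, g (yn n) <> 0) ->
  (forall q, q = q1 \/ q = q2 -> qnorm q = 4 /\ q 0%nat = 1) ->
  exists r a : nat -> R,
    (forall n, 0 < r n /\ rational (r n)) /\ (forall n, r (S n) < r n) /\
    (forall n, sqrt 2 * r n < / INR (S n)) /\
    (forall n, INR n < a n) /\ (forall n, a n < a (S n)) /\
    (forall n, (3 + Rabs (yn n)) ^ n <= a n) /\
    (forall n, a n * (sqrt 2 * r n) * lat_mass (m n) <= (1 / 2) ^ n) /\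
    (forall n, 1 <= a n * Cmod (g (yn n - sqrt 2 * r n))) /\
    forall q, q = q1 \/ q = q2 -> forall n, exists s,
      INR n <= Cmod (Theta c m a (fun j => sqrt 2 * r j) q (fun x => wave s x * v x)%C).
Proof.
  intros Hm Hc HL Hy Hy1 Hv Hvy Hg Hgy Hq.
  pose proof sqrt2_pos as S2.
  destruct (schwartz_decays v Hv) as [Bv HBv].
  pose proof (decays_nonneg _ _ HBv) as Bv0.
  destruct (proj2 Hv 4%nat) as [B4 HB4].
  pose proof (schwartz_bound_nonneg _ _ _ HB4) as B40.
  assert (Lm : forall n, 0 <= lat_mass (m n)) by (intros n; apply lat_mass_nonneg, Hm).
  (* [a n * K n] is the bound from [block_bound] for weights of norm 4, uniform in the shift and in
     the wave. *)
  set (K := fun n => lat_mass (m n) * (4 * 4 * Bv)).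
  assert (K0 : forall n, 0 <= K n) by (intros n; apply Rmult_le_pos; [apply Lm | lra]).
  (* The three demands on [a n]: to exceed [n] and all earlier blocks, to keep the terms of the
     divergent sum at least 1, and to beat the powers of [y_n]. The 3 is the slack 1 of
     [block_large] plus the 2 of [series_peak]; the factors 2 compensate for [v] and [g] dropping to
     half their values near [y_n]. *)
  set (F := fun n H => 2 * (INR n + 3 + H) / Cmod (v (yn n)) + 2 / Cmod (g (yn n)) + (3 + Rabs (yn n)) ^ n).
  destruct (recursive_weights K F) as [a [Ha1 [Ha2 Ha3]]].
  assert (a0 : forall n, 0 < a n) by (intros n; pose proof (pos_INR n); specialize (Ha1 n); lra).
  set (b := fun j => a j * K j).
  assert (H0 : forall n, 0 <= bsum b n).
  { induction n as [|n IH]; [unfold bsum; simpl; lra|]. rewrite bsum_S.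
    pose proof (a0 n). pose proof (K0 n). assert (0 <= b n) by (apply Rmult_le_pos; lra). lra. }
  assert (FA : forall n, INR n + 3 + bsum b n <= a n * (Cmod (v (yn n)) / 2) /\
     1 <= a n * (Cmod (g (yn n)) / 2) /\ (3 + Rabs (yn n)) ^ n <= a n).
  { intros n. specialize (Ha3 n). fold b in Ha3. unfold F in Ha3.
    pose proof (proj1 (Cmod_gt_0 _) (Hvy n)) as V. pose proof (proj1 (Cmod_gt_0 _) (Hgy n)) as G.
    pose proof (pos_INR n). specialize (H0 n).
    assert (P1 : 0 <= 2 * (INR n + 3 + bsum b n) / Cmod (v (yn n))).
    { apply Rmult_le_pos; [lra | left; apply Rinv_0_lt_compat, V]. }
    assert (P2 : 0 <= 2 / Cmod (g (yn n))) by (apply Rmult_le_pos; [lra | left; apply Rinv_0_lt_compat, G]).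
    assert (P3 : 0 <= (3 + Rabs (yn n)) ^ n) by (apply pow_le; pose proof (Rabs_pos (yn n)); lra).
    repeat split.
    - apply Rle_trans with (2 * (INR n + 3 + bsum b n) / Cmod (v (yn n)) * (Cmod (v (yn n)) / 2)).
      + right. field. lra.
      + apply Rmult_le_compat_r; lra.
    - apply Rle_trans with (2 / Cmod (g (yn n)) * (Cmod (g (yn n)) / 2)).
      + right. field. lra.
      + apply Rmult_le_compat_r; lra.
    - lra. }
  assert (HC : forall n, {d : R | 0 < d /\ forall u, Rabs (u - yn n) < d ->
    Cmod (v (yn n)) / 2 <= Cmod (v u) /\ Cmod (g (yn n)) / 2 <= Cmod (g u)}).
  { intros n. apply constructive_indefinite_description.
    destruct (half_continuity v (yn n)) as [d1 [D1 E1]]; [apply smooth_continuous, Hv | apply Hvy|].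
    destruct (half_continuity g (yn n)) as [d2 [D2 E2]]; [apply Hg | apply Hgy|].
    exists (Rmin d1 d2). split; [apply Rmin_glb_lt; assumption|].
    intros u Hu. pose proof (Rmin_l d1 d2). pose proof (Rmin_r d1 d2).
    split; [apply E1; lra | apply E2; lra]. }
  (* The constant of [block_small] for weights of norm 4 and waves with parameter at most [|s|]. In
     [1 + W s] the 1 secures convergence of the series itself, the other part smallness at the
     arguments already used. *)
  set (W := fun s => 4 * weyl_const * wave_bound B4 (Rabs s)).
  assert (W0 : forall s, 0 <= W s).
  { intros s. unfold W, wave_bound. pose proof weyl_const_pos. pose proof PI_RGT_0. pose proof (Rabs_pos s).
    assert (0 <= 2 * PI * Rabs s) by (apply Rmult_le_pos; lra).
    apply Rmult_le_pos; [lra|]. apply Rmult_le_pos; [lra|]. apply Rmult_le_pos; [|exact B40].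
    apply Rmult_le_pos; [lra|]. apply pow_le. lra. }
  set (den := fun n s => 1 + a n * lat_mass (m n) * (1 + W s)).
  assert (aL : forall n, 0 <= a n * lat_mass (m n)).
  { intros n. apply Rmult_le_pos; [left; apply a0 | apply Lm]. }
  assert (den1 : forall n s, 1 <= den n s).
  { intros n s. unfold den. pose proof (W0 s).
    assert (0 <= a n * lat_mass (m n) * (1 + W s)) by (apply Rmult_le_pos; [apply aL | lra]). lra. }
  (* In order: convergence of the shifts to 0, closeness of [y_n - t_n] to [y_n], and smallness of
     the block. *)
  set (delta := fun n s => Rmin (/ INR (S n)) (Rmin (proj1_sig (HC n)) ((1 / 2) ^ n / den n s))).
  assert (half0 : forall n, 0 < (1 / 2) ^ n) by (intros n; apply pow_lt; lra).
  assert (dpos : forall n s, 0 < delta n s).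
  { intros n s. repeat apply Rmin_glb_lt.
    - apply Rinv_0_lt_compat, lt_0_INR. lia.
    - apply (proj2_sig (HC n)).
    - apply Rdiv_lt_0_compat; [apply half0|]. specialize (den1 n s). lra. }
  assert (dprop : forall n s t, 0 < t < delta n s -> t < / INR (S n) /\ t <= 1 /\ t < proj1_sig (HC n) /\
    a n * t * lat_mass (m n) * (1 + W s) <= (1 / 2) ^ n).
  { intros n s t [T0 Td]. unfold delta in Td.
    pose proof (Rmin_l (/ INR (S n)) (Rmin (proj1_sig (HC n)) ((1 / 2) ^ n / den n s))).
    pose proof (Rmin_r (/ INR (S n)) (Rmin (proj1_sig (HC n)) ((1 / 2) ^ n / den n s))).
    pose proof (Rmin_l (proj1_sig (HC n)) ((1 / 2) ^ n / den n s)).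
    pose proof (Rmin_r (proj1_sig (HC n)) ((1 / 2) ^ n / den n s)).
    assert (I1 : / INR (S n) <= 1).
    { rewrite <- Rinv_1. apply Rinv_le_contravar; [lra|]. rewrite S_INR. pose proof (pos_INR n). lra. }
    repeat split; try lra.
    assert (E : t * den n s <= (1 / 2) ^ n).
    { specialize (den1 n s). apply Rle_trans with ((1 / 2) ^ n / den n s * den n s).
      - apply Rmult_le_compat_r; lra.
      - right. field. lra. }
    unfold den in E. lra. }
  (* One range of arguments has to serve both weight vectors, since the parameters are chosen before
     the eigenvalue [kappa]. *)
  set (P := fun n t s => forall q, q = q1 \/ q = q2 -> exists s0, Rabs s0 <= s /\
    Cmod (block_mass (c n) (a n) t q (yn n - t)) * Cmod (v (yn n - t)) - 1 <=
    Cmod (block (c n) (m n) (a n) t q (fun x => wave s0 x * v x)%C)).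
  destruct (dependent_shifts delta P dpos) as [r [s [Hr [Hdec [Hs [Hr0 [HrS HP]]]]]]].
  { intros n t s s' Hss H q Hq'. destruct (H q Hq') as [s0 [E1 E2]]. exists s0. split; [lra | exact E2]. }
  { intros n t s Ht. destruct (dprop n s t Ht) as [_ [T1 _]].
    assert (T : 0 < t <= 1) by lra.
    destruct (block_large (c n) (m n) (Hm n) (Hc n) (HL n) v Bv HBv (a n) t q1 (yn n - t) T) as [s1 E1].
    destruct (block_large (c n) (m n) (Hm n) (Hc n) (HL n) v Bv HBv (a n) t q2 (yn n - t) T) as [s2 E2].
    exists (Rmax (Rabs s1) (Rabs s2)). intros q [-> | ->].
    - exists s1. split; [apply Rmax_l | exact E1].
    - exists s2. split; [apply Rmax_r | exact E2]. }
  set (t := fun n => sqrt 2 * r n).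
  assert (t0 : forall n, 0 < t n) by (intros n; apply Rmult_lt_0_compat; [exact S2 | apply Hr]).
  assert (tprop : forall n, t n < / INR (S n) /\ t n <= 1 /\ t n < proj1_sig (HC n) /\
    a n * t n * lat_mass (m n) <= (1 / 2) ^ n).
  { intros n. destruct (Hr0 n) as [s0 E]. destruct (dprop n s0 (t n) (conj (t0 n) E)) as [E1 [E2 [E3 E4]]].
    repeat split; try assumption. eapply Rle_trans; [|exact E4].
    rewrite <- (Rmult_1_r (a n * t n * lat_mass (m n))) at 1.
    apply Rmult_le_compat_l; [|specialize (W0 s0); lra].
    apply Rmult_le_pos; [apply Rmult_le_pos; left; [apply a0 | apply t0] | apply Lm]. }
  assert (near : forall n, Cmod (v (yn n)) / 2 <= Cmod (v (yn n - t n)) /\ Cmod (g (yn n)) / 2 <= Cmod (g (yn n - t n))).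
  { intros n. apply (proj2 (proj2_sig (HC n))).
    replace (yn n - t n - yn n) with (- t n) by ring. rewrite Rabs_Ropp, Rabs_right.
    - apply (tprop n).
    - apply Rle_ge; left; apply t0. }
  assert (smono : forall n j, s n <= s (n + j)%nat).
  { intros n j. induction j as [|j IH]; [rewrite Nat.add_0_r; lra|].
    rewrite Nat.add_succ_r. specialize (Hs (n + j)%nat). lra. }
  exists r, a. split; [exact Hr|]. split; [exact Hdec|].
  split; [intros n; apply (tprop n)|]. split; [exact Ha1|]. split; [exact Ha2|].
  split; [intros n; apply FA|]. split; [intros n; apply (tprop n)|]. split.
  { intros n. eapply Rle_trans; [apply (FA n)|]. apply Rmult_le_compat_l; [left; apply a0 | apply near]. }
  intros q Hqq n. destruct (Hq q Hqq) as [Hn4 Hq0].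
  destruct (HP n q Hqq) as [s0 [Hs0 Hlow]]. exists s0.
  fold (t n) in Hlow.
  assert (Hrat : forall n x, c n x <> 0 -> rational x).
  { intros j x Hx. destruct (HL j x Hx) as [z ->]. apply lattice_rational, Hm. }
  assert (Emass : block_mass (c n) (a n) (t n) q (yn n - t n) = RtoC (a n)).
  { unfold t. rewrite (block_mass_plus c yn r Hrat Hy Hr Hdec a q n n (Hy1 n)).
    destruct (Nat.eq_dec n n); [|contradiction]. rewrite Hq0. ring. }
  rewrite Emass, Cmod_RtoC, Rabs_right in Hlow by (apply Rle_ge; left; apply a0).
  assert (Hlow' : INR n + 2 + bsum b n <= Cmod (block (c n) (m n) (a n) (t n) q (fun x => wave s0 x * v x)%C)).
  { eapply Rle_trans; [|exact Hlow].
    assert (a n * (Cmod (v (yn n)) / 2) <= a n * Cmod (v (yn n - t n)))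
      by (apply Rmult_le_compat_l; [left; apply a0 | apply near]).
    pose proof (proj1 (FA n)). lra. }
  unfold Theta.
  eapply Rle_trans; [|apply (series_peak _ b n (INR n + 2 + bsum b n)); [| |exact Hlow']]; [lra| |].
  - intros j _.
    eapply Rle_trans; [apply (block_bound (c j) (m j) (a j) (t j) (Hm j) (Hc j)) with (B := Bv)|].
    + split; [apply t0 | apply (tprop j)].
    + left; apply a0.
    + apply (decays_wave Bv s0 v HBv).
    + rewrite Hn4. unfold b, K. right. ring.
  - intros j Hj. destruct j as [|j]; [lia|].
    (* The shift of block [j + 1] was chosen below the threshold for the range [s j], and this range
       contains [s0] since [n <= j]. *)
    destruct (dprop (S j) (s j) (t (S j)) (conj (t0 _) (HrS j))) as [_ [T1 [_ T4]]].
    assert (Hsj : Rabs s0 <= Rabs (s j)).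
    { eapply Rle_trans; [exact Hs0|]. eapply Rle_trans; [|apply Rle_abs].
      replace j with (n + (j - n))%nat by lia. apply smono. }
    eapply Rle_trans; [apply (block_small (c (S j)) (m (S j)) (a (S j)) (t (S j)) (Hm _) (Hc _)) with (B := wave_bound B4 (Rabs (s j)))|].
    + split; [apply t0 | exact T1].
    + left; apply a0.
    + apply smooth_mult; [|apply Hv].
      replace (wave s0) with (fun x => cis (- (2 * PI * s0) * x + 0))
        by (apply functional_extensionality; intros; symmetry; apply wave_affine).
      apply smooth_cis.
    + apply wave_schwartz_bound; [apply Hv | exact HB4 | exact Hsj].
    + rewrite Hn4. fold (W (s j)). eapply Rle_trans; [|exact T4].
      apply Rmult_le_compat_l; [|lra].
      apply Rmult_le_pos; [apply Rmult_le_pos; left; [apply a0 | apply t0] | apply Lm].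
Qed.

(** * Roots of unity and assembly of the eigenmeasure *)

Lemma fourth_root_of_unity (z : C) :
  z = RtoC 1 \/ z = RtoC (-1) \/ z = Ci \/ z = Copp Ci -> (z * z * z * z)%C = 1.
Proof. intros [-> | [-> | [-> | ->]]]; apply C_ext; simpl; ring. Qed.

Lemma fourth_root_Cmod (z : C) : (z * z * z * z)%C = 1 -> Cmod z = 1.
Proof.
  intros H. apply (f_equal Cmod) in H. rewrite !Cmod_mult, Cmod_1 in H.
  pose proof (Cmod_ge_0 z). set (r := Cmod z) in *.
  assert ((r - 1) * ((r + 1) * (r * r + 1)) = 0) as E by (ring_simplify; lra).
  apply Rmult_integral in E. destruct E as [E|E]; [lra|].
  assert (0 < (r + 1) * (r * r + 1)) by (apply Rmult_lt_0_compat; nra). lra.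
Qed.

Lemma growth_gap (k : nat -> nat) : (4 <= k 0%nat)%nat ->
  (forall n, INR (k (S n)) / 4 - 1 >= INR (k n) / 2 + 1) ->
  forall n, (4 <= k n)%nat /\ INR n <= INR (k n) / 4 - 1.
Proof.
  intros H0 H n. assert (E4 : INR 4 = 4) by (simpl; ring). assert (G : INR n <= INR (k n) / 4 - 1).
  { induction n as [|n IH].
    - apply le_INR in H0. rewrite INR_0. lra.
    - rewrite S_INR. specialize (H n). pose proof (pos_INR n). lra. }
  split; [|exact G]. apply INR_le. pose proof (pos_INR n). lra.
Qed.

Lemma eigen_Theta_scal (c : nat -> R -> C) (m : nat -> nat) (a t : nat -> R) (z : C) (q q' : nat -> C) f :
  (forall n, (0 < m n)%nat) -> (forall n x, Cmod (c n x) <= 1) -> (forall n, 0 < t n <= 1) ->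
  (forall n, 0 <= a n) -> (forall n, a n * t n * lat_mass (m n) <= (1 / 2) ^ n) ->
  (forall i, In i four -> q' i = (z * q i)%C) -> schwartz f ->
  Theta c m a t q' f = (z * Theta c m a t q f)%C.
Proof.
  intros Hm Hc Ht Ha Hat Hq Hf.
  rewrite (Theta_ext_q c m a t q' (fun i => (z * q i + 0 * q i)%C)).
  - rewrite Theta_comb_q by assumption. ring.
  - intros i Hi. rewrite Hq by exact Hi. ring.
Qed.

Theorem theorem4p11
  (phi : R -> C)
  (phi_test : Cc_infty phi)
  (phi_nonzero : exists x : R, phi x <> RtoC 0)
  (lambda : C)
  (lambda_val : lambda = RtoC 1 \/ lambda = RtoC (-1) \/ lambda = Ci \/ lambda = Copp Ci)
  (mu : nat -> functional)
  (mu_eigen : forall m : nat, (4 <= m)%nat -> is_periodic_eigenmeasure lambda m (mu m))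
  (k : nat -> nat)
  (k_first : (4 <= k 0)%nat)
  (k_growth : forall n : nat, INR (k (S n)) / 4 - 1 >= INR (k n) / 2 + 1)
  (yn : nat -> R)
  (yn_rational : forall n : nat, rational (yn n))
  (yn_distinct : forall i j : nat, yn i = yn j -> i = j)
  (yn_mass : forall n : nat, mass (mu (k n)) (yn n) = RtoC 1)
  (yn_gap : forall (n m : nat) (z : R), (n < m)%nat -> -1 <= z < 1 ->
     mass (mu (k m)) (yn n + z) = RtoC 0) :
  exists (y : R) (t a : nat -> R),
    (forall n : nat, 0 < t n) /\ (forall n : nat, t (S n) < t n) /\ is_lim_seq t 0 /\
    (forall n : nat, 0 < a n) /\ (forall n : nat, a n < a (S n)) /\ is_lim_seq a p_infty /\
    exists sigma Sigma0 : functional,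
      is_msum
        (fun n => mscal (RtoC (a n)) (msub (mtranslate (t n) (mu (k n))) (mu (k n))))
        sigma /\
      is_msum
        (fun n => mscal (RtoC (a n))
           (mdens (fun x => Cminus (cis (2 * PI * x * t n)) (RtoC 1)) (mu (k n))))
        Sigma0 /\
      let Sigma := mscal lambda Sigma0 in
      crystalline sigma /\ crystalline Sigma /\ has_fourier sigma Sigma /\
      is_lim_seq
        (sum_n (fun n =>
           Cmod (Cmult (mass sigma (yn n - t n)) (fourier phi (yn n - t n - y))) ^ 2))
        p_infty /\
      (forall n : nat,
         mass Sigma (yn n - t n) = RtoC 0 /\
         mass sigma (- yn n + t n) = RtoC 0 /\
         mass Sigma (- yn n + t n) = RtoC 0) /\
      (* kappa = 1 gives eta = sigma + F(sigma) + F^2(sigma) + F^3(sigma), whose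
         eigenvalue is 1 because F^4 = id; the eigenvalue lambda needs the weights
         lambda^{-j} *)
      forall kappa : C, kappa = RtoC 1 \/ kappa = lambda ->
      forall T : functional, represents T sigma ->
      exists eta : functional,
        represents
          (fun f => T f + / kappa * FT T f + / Cpow kappa 2 * FT (FT T) f
                        + / Cpow kappa 3 * FT (FT (FT T)) f)%C
          eta /\
        crystalline eta /\ ~ agree_on Cc eta zero_measure /\
        has_fourier eta (mscal kappa eta) /\
        (let psi := fun x : R => Cmult (cis (2 * PI * x * y)) (phi x) in
         Cc_infty psi /\ ~ bohr_almost_periodic (conv eta psi)) /\
        ~ strongly_almost_periodic_distribution eta /\
        ~ translation_bounded_distribution eta /\
        ~ strongly_tempered eta.
Proof.
  assert (Htest : has_test_function) by (exists phi; auto).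
  pose proof (fourth_root_of_unity lambda lambda_val) as L4.
  pose proof (fourth_root_Cmod lambda L4) as L1.
  assert (Lnz : lambda <> 0) by (apply Cmod_gt_0; lra).
  set (c := fun n => mass (mu (k n))).
  pose proof (growth_gap k k_first k_growth) as Hk.
  assert (Hm : forall n, (0 < k n)%nat) by (intros n; pose proof (proj1 (Hk n)); lia).
  assert (HE : forall n, discrete (c n) (mu (k n)) /\ forall x, c n x <> 0 ->
    (exists z : Z, x = IZR z / INR (k n)) /\ INR (k n) / 4 - 1 <= Rabs x /\ Cmod (c n x) <= 1).
  { intros n. apply (eigenmeasure_discrete lambda (k n)); [apply Hm | apply mu_eigen, Hk]. }
  assert (HD : forall n, discrete (c n) (mu (k n))) by (intros n; apply HE).
  assert (HL : forall n x, c n x <> 0 -> exists z : Z, x = IZR z / INR (k n))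
    by (intros n x Hx; apply HE, Hx).
  assert (Hgap : forall n x, c n x <> 0 -> INR n <= Rabs x).
  { intros n x Hx. pose proof (proj2 (Hk n)). pose proof (proj1 (proj2 (proj2 (HE n) x Hx))). lra. }
  assert (Hc : forall n x, Cmod (c n x) <= 1).
  { intros n x. destruct (classic (c n x = 0)) as [E|E]; [rewrite E, Cmod_0; lra | apply HE, E]. }
  assert (HF : forall n g, schwartz g -> lattice_sum (c n) (k n) (fourier g) = (lambda * lattice_sum (c n) (k n) g)%C).
  { intros n. apply lattice_sum_eigen with (mu (k n)); auto. apply (mu_eigen (k n)), Hk. }
  (* Both signs are interleaved: the divergent sum involves the transform of [phi] near [y_n - y],
     the convolution with [psi] near [- y_n - y]. The points are the unshifted [y_n] because the
     [t_n] are not chosen yet; continuity bridges the gap later. *)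
  destruct (fourier_avoid_zeros phi (fun j => if Nat.even j then yn (Nat.div2 j) else - yn (Nat.div2 j))
    phi_test phi_nonzero) as [y Hy].
  assert (Hy1 : forall n, fourier phi (yn n - y) <> 0).
  { intros n. specialize (Hy (2 * n)%nat). rewrite Nat.even_mul, Nat.div2_double in Hy. exact Hy. }
  assert (Hy2 : forall n, fourier phi (- yn n - y) <> 0).
  { intros n. specialize (Hy (S (2 * n))). rewrite Nat.even_succ, <- Nat.negb_even, Nat.even_mul, Nat.div2_succ_double in Hy.
    exact Hy. }
  clear Hy.
  set (psi := fun x : R => Cmult (cis (2 * PI * x * y)) (phi x)).
  assert (Epsi : psi = fun x => (cis (2 * PI * y * x) * phi x)%C).
  { apply functional_extensionality. intros x. unfold psi. do 2 f_equal. ring. }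
  assert (Cpsi : Cc_infty psi).
  { rewrite Epsi. apply (Cc_infty_mult (fun x => cis (2 * PI * y * x))); [apply multiplier_modulation | exact phi_test]. }
  pose proof (Cc_infty_schwartz psi Cpsi) as Spsi.
  (* The amplitude of the waves that make up the convolution with [psi]. *)
  set (v := fun x => fourier psi (- x)).
  assert (Ev : forall x, v x = fourier phi (- x - y)).
  { intros x. unfold v. rewrite fourier_shift, Epsi. reflexivity. }
  assert (Sv : schwartz v).
  { replace v with (fun x => fourier psi (-1 * x + 0)).
    - apply schwartz_comp_affine; [rewrite Rabs_left; lra | apply fourier_schwartz, Spsi].
    - apply functional_extensionality. intros x. unfold v. f_equal. ring. }
  set (g := fun x => fourier phi (1 * x + - y)).
  (* Geometric weights: the cyclic shift by [qshift] multiplies them by [kappa], since [lambda] and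
     [kappa] are fourth roots of unity. *)
  set (geo := fun (kappa : C) (i : nat) => Cpow (lambda * / kappa) i).
  destruct (construction c k yn v g (geo 1) (geo lambda) Hm Hc HL yn_rational yn_mass Sv) as
    [r [a [Hr [Hdec [Hsmall [Ha1 [Ha2 [Hpoly [Hat [Hcoef Hlarge]]]]]]]]]].
  { intros n. rewrite Ev. apply Hy2. }
  { intros x. apply smooth_continuous, smooth_comp_affine, fourier_smooth, Cc_infty_schwartz, phi_test. }
  { intros n. unfold g. replace (1 * yn n + - y) with (yn n - y) by ring. apply Hy1. }
  { assert (Q : forall kappa, Cmod kappa = 1 -> kappa <> 0 -> qnorm (geo kappa) = 4 /\ geo kappa 0%nat = 1).
    { intros kappa K1 Knz. split; [|reflexivity].
      unfold qnorm, geo. rewrite !Cmod_pow, Cmod_mult, Cmod_inv, K1, L1 by exact Knz.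
      rewrite Rinv_1, Rmult_1_r, !pow1. ring. }
    intros q [-> | ->]; apply Q; auto using Cmod_1. apply C1_nz. }
  set (t := fun n => sqrt 2 * r n).
  pose proof sqrt2_pos as S2.
  assert (t0 : forall n, 0 < t n) by (intros n; apply Rmult_lt_0_compat; [exact S2 | apply Hr]).
  assert (Ht : forall n, 0 < t n <= 1).
  { intros n. split; [apply t0|]. eapply Rle_trans; [left; apply Hsmall|].
    rewrite <- Rinv_1. apply Rinv_le_contravar; [lra|]. rewrite S_INR. pose proof (pos_INR n). lra. }
  assert (a0 : forall n, 0 < a n) by (intros n; pose proof (pos_INR n); specialize (Ha1 n); lra).
  assert (Ha0 : forall n, 0 <= a n) by (intros n; left; apply a0).
  assert (Hrat : forall n x, c n x <> 0 -> rational x).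
  { intros j x Hx. destruct (HL j x Hx) as [z ->]. apply lattice_rational, Hm. }
  set (Th := Theta c k a t).
  assert (Cr : forall q, crystalline (Th q)).
  { intros q. apply Theta_crystalline with (fun n => mu (k n)) lambda; auto. }
  assert (Di : forall q, discrete (Theta_mass c a t q) (Th q)).
  { intros q. apply Theta_discrete with (fun n => mu (k n)); auto. }
  assert (M1 : forall q n, mass (Th q) (yn n - t n) = (RtoC (a n) * q 0%nat)%C).
  { intros q n. rewrite (discrete_mass _ _ (Di q)). exact (Theta_mass_plus c yn r Hrat yn_rational Hr Hdec a q n (yn_mass n)). }
  assert (M2 : forall (q : nat -> C) n, q 2%nat = 0 -> mass (Th q) (- yn n + t n) = 0).
  { intros q n Hq. rewrite (discrete_mass _ _ (Di q)). exact (Theta_mass_minus c yn r Hrat yn_rational Hr a q n Hq). }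
  exists y, t, a.
  split; [exact t0|].
  split; [intros n; apply Rmult_lt_compat_l; [exact S2 | apply Hdec]|].
  split.
  { apply is_lim_seq_spec. intros eps. destruct (inv_INR_S_lt eps (cond_pos eps)) as [N HN].
    exists N. intros n Hn. rewrite Rminus_0_r, Rabs_right by (apply Rle_ge; left; apply t0).
    specialize (HN n Hn). specialize (Hsmall n). unfold t. lra. }
  split; [exact a0|]. split; [exact Ha2|].
  split.
  { apply (is_lim_seq_le_p_loc INR); [|apply is_lim_seq_INR]. exists 0%nat. intros n _. left. apply Ha1. }
  (* The transform of sigma already contains the factor [lambda], which is divided out here because
     the second series is stated without it. *)
  exists (Th unit_weight), (mscal (/ lambda) (Th (qshift lambda unit_weight))).
  split.
  { intros f Hf. apply (is_series_ext (fun n => block (c n) (k n) (a n) (t n) unit_weight f)).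
    - intros n. apply block_translate_difference; auto.
    - apply CSeries_correct. apply Theta_summable_Cc with (fun n => mu (k n)); auto. }
  split.
  { intros f Hf.
    assert (Sm : Csummable (fun n => block (c n) (k n) (a n) (t n) (qshift lambda unit_weight) f)).
    { apply Theta_summable_Cc with (fun n => mu (k n)); auto. }
    apply (is_series_ext (fun n => (/ lambda * block (c n) (k n) (a n) (t n) (qshift lambda unit_weight) f)%C)).
    - intros n. rewrite (block_modulation_difference lambda (c n) (k n) (a n) (t n) (mu (k n))) by auto.
      rewrite Cmult_assoc, Cinv_l by exact Lnz. apply Cmult_1_l.
    - unfold mscal, Th, Theta. rewrite <- CSeries_scal by exact Sm.
      apply CSeries_correct, Csummable_scal, Sm. }
  replace (mscal lambda (mscal (/ lambda) (Th (qshift lambda unit_weight)))) with (Th (qshift lambda unit_weight)).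
  2: { apply functional_extensionality. intros f. unfold mscal.
       rewrite Cmult_assoc, Cinv_r by exact Lnz. symmetry. apply Cmult_1_l. }
  cbv zeta.
  split; [apply Cr|]. split; [apply Cr|].
  split; [apply Theta_has_fourier; auto|].
  split.
  { apply is_lim_seq_sum_ge_1. intros n. rewrite M1. simpl unit_weight. rewrite Cmult_1_r, Cmod_mult, Cmod_RtoC.
    rewrite Rabs_right by (apply Rle_ge, Ha0). specialize (Hcoef n). unfold g in Hcoef.
    replace (1 * (yn n - sqrt 2 * r n) + - y) with (yn n - t n - y) in Hcoef by (unfold t; ring).
    rewrite <- (pow1 2). apply pow_incr. split; [lra | exact Hcoef]. }
  split.
  { intros n. split; [|split].
    - rewrite M1. simpl. ring.
    - apply M2. reflexivity.
    - apply M2. simpl. ring. }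
  intros kappa Hkappa T HT.
  assert (K4 : (kappa * kappa * kappa * kappa)%C = 1).
  { destruct Hkappa as [-> | ->]; [ring | exact L4]. }
  pose proof (fourth_root_Cmod kappa K4) as K1.
  assert (Knz : kappa <> 0) by (apply Cmod_gt_0; lra).
  set (q := geo kappa).
  assert (Hq : q = geo 1 \/ q = geo lambda) by (destruct Hkappa as [E | E]; [left | right]; unfold q; rewrite E; reflexivity).
  assert (Tmp : forall q', tempered_distribution (Th q')) by (intros q'; apply Theta_tempered; auto).
  assert (Fou : forall q' f, schwartz f -> Th q' (fourier f) = Th (qshift lambda q') f)
    by (intros q' f Hf; apply Theta_fourier; auto).
  (* The representative [T] of sigma is arbitrary, but its values on Schwartz functions are
     determined by density. *)
  assert (ET : agree_on schwartz T (Th unit_weight)).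
  { apply tempered_unique; [exact Htest | apply HT | apply Tmp | apply HT]. }
  assert (Eig : forall f, schwartz f -> Th (qshift lambda q) f = (kappa * Th q f)%C).
  { intros f Hf. apply eigen_Theta_scal; auto.
    intros i [<-|[<-|[<-|[<-|[]]]]]; unfold q, geo; simpl.
    (* The wrap-around from direction 3 to direction 0 is where the fourth powers enter. *)
    - transitivity (kappa * ((lambda * lambda * lambda * lambda) * / (kappa * kappa * kappa * kappa)))%C.
      + field. exact Knz.
      + rewrite L4, K4. field.
    - field. exact Knz.
    - field. exact Knz.
    - field. exact Knz. }
  exists (Th q).
  assert (Hrep : agree_on schwartz
    (fun f => T f + / kappa * FT T f + / Cpow kappa 2 * FT (FT T) f + / Cpow kappa 3 * FT (FT (FT T)) f)%C (Th q)).
  { intros f Hf. unfold FT.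
    pose proof (fourier_schwartz f Hf) as Hf1. pose proof (fourier_schwartz _ Hf1) as Hf2.
    pose proof (fourier_schwartz _ Hf2) as Hf3.
    (* The [i]-th transform has the single weight [lambda ^ i] in direction [i]; divided by
       [kappa ^ i] and added up, these are the geometric weights. *)
    set (p0 := unit_weight). set (p1 := qshift lambda p0). set (p2 := qshift lambda p1). set (p3 := qshift lambda p2).
    assert (X0 : T f = Th p0 f) by exact (ET f Hf).
    assert (X1 : T (fourier f) = Th p1 f) by exact (eq_trans (ET _ Hf1) (Fou p0 f Hf)).
    assert (X2 : T (fourier (fourier f)) = Th p2 f)
      by exact (eq_trans (ET _ Hf2) (eq_trans (Fou p0 _ Hf1) (Fou p1 f Hf))).
    assert (X3 : T (fourier (fourier (fourier f))) = Th p3 f)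
      by exact (eq_trans (ET _ Hf3) (eq_trans (Fou p0 _ Hf2) (eq_trans (Fou p1 _ Hf1) (Fou p2 f Hf)))).
    rewrite X0, X1, X2, X3.
    unfold Th.
    rewrite (Theta_ext_q c k a t q (fun i => (1 * (1 * (1 * p0 i + / kappa * p1 i) + / Cpow kappa 2 * p2 i) + / Cpow kappa 3 * p3 i)%C)).
    - rewrite (Theta_comb_q c k a t Hm Hc Ht Ha0 Hat 1 (/ Cpow kappa 3)
        (fun i => (1 * (1 * p0 i + / kappa * p1 i) + / Cpow kappa 2 * p2 i)%C) p3 f Hf).
      rewrite (Theta_comb_q c k a t Hm Hc Ht Ha0 Hat 1 (/ Cpow kappa 2) (fun i => (1 * p0 i + / kappa * p1 i)%C) p2 f Hf).
      rewrite (Theta_comb_q c k a t Hm Hc Ht Ha0 Hat 1 (/ kappa) p0 p1 f Hf). ring.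
    - intros i [<-|[<-|[<-|[<-|[]]]]]; unfold q, geo, p3, p2, p1, p0; simpl; field; exact Knz. }
  split.
  { split.
    - apply tempered_agree with (2 := Tmp q). intros f Hf. symmetry. apply Hrep, Hf.
    - intros f Hf. apply Hrep, Cc_infty_schwartz, Hf. }
  split; [apply Cr|].
  assert (Eta0 : forall n, Theta_mass c a t q (yn n - t n) = RtoC (a n)).
  { intros n. rewrite <- (discrete_mass _ _ (Di q)), M1. unfold q, geo. simpl. ring. }
  split.
  (* Eta is nonzero since its mass at [y_0 - t_0] is [a_0]. *)
  { intros Z. pose proof (discrete_agree _ _ _ Z (Di q)) as DZ.
    destruct (discrete_tent _ _ DZ (yn 0%nat - t 0%nat)) as [N HN]. specialize (HN N (Nat.le_refl N)).
    rewrite Eta0 in HN. unfold zero_measure in HN. apply RtoC_inj in HN. specialize (a0 0%nat). lra. }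
  split.
  { exists (Th q). split; [apply Theta_represents; auto|]. split.
    - apply FT_tempered, Tmp.
    - intros f Hf. unfold FT, mscal. rewrite Fou, Eig by (apply Cc_infty_schwartz, Hf). reflexivity. }
  assert (Unb : ~ bounded (conv (Th q) psi)).
  { intros [M HM].
    destruct (nfloor_ex (Rabs M) (Rabs_pos M)) as [n [_ Hn]].
    destruct (Hlarge q Hq (S n)) as [s Hs]. specialize (HM s).
    assert (Hg : schwartz (fun x => psi (s - x))).
    { replace (fun x => psi (s - x)) with (fun x => psi (-1 * x + s)).
      - apply schwartz_comp_affine; [rewrite Rabs_left; lra | exact Spsi].
      - apply functional_extensionality. intros x. f_equal. ring. }
    (* As [kappa] has modulus 1, pairing eta with the reflected translate or with its transform
       gives the same modulus; the transform is the wave times [v], for which large values were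
       arranged. *)
    pose proof (Fou q _ Hg) as E. rewrite Eig in E by exact Hg.
    rewrite (fourier_reflected_translate psi s Spsi) in E.
    apply (f_equal Cmod) in E. rewrite Cmod_mult, K1, Rmult_1_l in E.
    unfold conv in HM. rewrite <- E in HM. rewrite S_INR in Hs.
    pose proof (Rle_abs M). change (INR n + 1 <= Cmod (Th q (fun x => (wave s x * v x)%C))) in Hs.
    unfold v in Hs. lra. }
  assert (Hcz : Cc_infty psi /\ ~ bohr_almost_periodic (conv (Th q) psi)).
  { split; [exact Cpsi|]. intros B. apply Unb, bohr_bounded, B. }
  split; [exact Hcz|].
  split; [intros H; apply Hcz, H, Cpsi|].
  split; [intros H; apply Unb, H, Cpsi|].
  intros [_ TV]. apply (total_variation_not_tempered _ (Th q) (fun n => yn n - t n) Htest (Di q)); [|exact TV].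
  (* The base 3 chosen for [a_n] absorbs the shift: [2 + |y_n - t_n|] is at most [3 + |y_n|] because
     [t_n <= 1]. *)
  intros n. rewrite Eta0, Cmod_RtoC, (Rabs_right (a n)) by (apply Rle_ge, Ha0).
  eapply Rle_trans; [|apply Hpoly]. apply pow_incr. pose proof (Rabs_pos (yn n - t n)). split; [lra|].
  pose proof (Rabs_triang (yn n) (- t n)) as Tr. rewrite Rabs_Ropp, (Rabs_right (t n)) in Tr by (apply Rle_ge; left; apply t0).
  specialize (Ht n). unfold Rminus. lra.
Qed.
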